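(* If $b\ge a>0$ and $\Phi$ is continuous at every point of $[a,b]$, then the sequence of functions $\{\Phi_q\}_{q\text{ prime}}$ converges to $\Phi$ uniformly on $[a,b]$ as $q\to\infty$ through the primes. In particular, the sequence of distributions $\{\Phi_q\}_{q\text{ prime}}$ converges weakly to $\Phi$.
   Context: For a non-principal Dirichlet character $\chi\pmod q$, $M(\chi)=\max_{1\le x\le q}\left|\sum_{n\le x}\chi(n)\right|$ and $m(\chi)=\dfrac{M(\chi)}{e^\gamma\sqrt q/\pi}$, with $\gamma$ the Euler--Mascheroni constant. For $q$ prime, $\Phi_q(\tau)=\frac1{\varphi(q)}\#\{\chi\ (\mathrm{mod}\ q):\ m(\chi)>\tau\}$ (over non-principal $\chi$). Random model: let $\{X_p:\ p\text{ prime}\}$ be independent random variables, each uniformly distributed on the unit circle $\{z\in\mathbb C:|z|=1\}$, and for $n=p_1^{e_1}\cdots p_k^{e_k}$ put $X_n=X_{p_1}^{e_1}\cdots X_{p_k}^{e_k}$. Let $X_{-1}$ be a random variable independent of the $X_p$'s taking each of the values $-1$ and $1$ with probability $1/2$, and put $X_{-n}=X_{-1}X_n$ for $n\ge1$. With $e(x)=e^{2\pi ix}$, set $$S=\max_{0\le\alpha\le1}\left|\sum_{n\in\mathbb Z,\ n\ne0}\frac{X_n(1-e(n\alpha))}{n}\right|,$$ where the infinite sum (ordered by $|n|$) converges with probability $1$, so that $S$ is well defined. Then $\Phi(\tau)=\mathbf{Prob}(S>2e^\gamma\tau)$, a decreasing function of $\tau$. Weak convergence is meant in the sense that $\int_{\mathbb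 R}f(\tau)\Phi_q(\tau)\,d\tau\to\int_{\mathbb R}f(\tau)\Phi(\tau)\,d\tau$ as $q\to\infty$ through primes, for every continuous $f:\mathbb R\to\mathbb R$ of bounded support. *)

(* Defs.v *)
From mathcomp Require Import all_boot all_order all_algebra.
From mathcomp Require Import finmap complex.
From mathcomp Require Import all_classical all_reals all_analysis.

Set Implicit Arguments.
Unset Strict Implicit.
Unset Printing Implicit Defensive.

Import Order.TTheory GRing.Theory Num.Theory numFieldNormedType.Exports.

Local Open Scope classical_set_scope.
Local Open Scope ring_scope.
Local Open Scope complex_scope.

Notation modulus := Normc.normc (only parsing).

Definition euler_gamma (R : realType) : R :=
  limn (fun N : nat => \sum_(1 <= k < N.+1) (k%:R : R)^-1 - ln N%:R).

Definition dirichlet_character (R : realType) (q : nat) (chi : int -> R[i]) :=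
  [/\ forall m n : int, chi (m * n) = chi m * chi n,
      forall n : int, chi (n + q%:Z) = chi n
    & forall n : int, chi n != 0 <-> coprimez n q%:Z].

Definition principal (R : realType) (q : nat) (chi : int -> R[i]) :=
  forall n : int, chi n = (coprimez n q%:Z)%:R.

(* The sum over n <= x depends only on the integer part of x, so integers x
   suffice. *)
Definition max_char_sum (R : realType) (q : nat) (chi : int -> R[i]) : R :=
  \big[Num.max/0]_(1 <= x < q.+1) modulus (\sum_(1 <= n < x.+1) chi n%:Z).

Definition m_char (R : realType) (q : nat) (chi : int -> R[i]) : R :=
  max_char_sum q chi / (expR (euler_gamma R) * Num.sqrt q%:R / pi).

(* [fset_set] sends infinite sets to the empty set; here, for q > 0, the set
   is finite because there are totient q characters mod q. *)
Definition Phi_q (R : realType) (q : nat) (tau : R) : R :=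
  #|` fset_set [set chi : int -> R[i] | [/\ dirichlet_character q chi,
        ~ principal q chi & tau < m_char q chi]] |%:R / (totient q)%:R.

Definition cis1 (R : realType) (x : R) : R[i] :=
  cos (2 * pi * x) +i* sin (2 * pi * x).

(* The Borel sigma-algebra of the complex plane is the product one on R * R. *)
Definition plane (R : realType) (z : R[i]) : measurableTypeR R * measurableTypeR R :=
  (complex.Re z, complex.Im z).

Definition mutually_independent (R : realType) (d : measure_display)
    (T : measurableType d) (P : probability T R) (I : choiceType) (D : set I)
    (X : I -> T -> R[i]) :=
  forall (J : {fset I}) (B : I -> set (measurableTypeR R * measurableTypeR R)),
    [set` J] `<=` D -> (forall i, measurable (B i)) ->
    P (\bigcap_(i in [set` J]) [set w | B i (plane (X i w))]) =
    (\prod_(i <- J) P [set w | B i (plane (X i w))])%E.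

Definition base_index : set int :=
  [set -1] `|` [set p%:Z | p in [set p : nat | prime p]].

(* Only the values of X at -1 and at the primes matter; the other X_n are given
   by [X_ext]. *)
Record random_model (R : realType) (d : measure_display)
    (T : measurableType d) (P : probability T R) (X : int -> T -> R[i]) : Prop :=
  RandomModel {
    model_measurable : forall i, base_index i ->
      measurable_fun [set: T] (fun w => plane (X i w));
    model_independent : mutually_independent P base_index X;
    model_prime : forall (p : nat)
        (B : set (measurableTypeR R * measurableTypeR R)),
      prime p -> measurable B ->
      P [set w | B (plane (X p%:Z w))] =
      lebesgue_measure [set t : R | 0 <= t <= 1 /\ B (plane (cis1 t))];
    model_pos : P [set w | X (-1) w = 1] = (2^-1)%:E;
    model_neg : P [set w | X (-1) w = -1] = (2^-1)%:E }.

Definition X_ext (R : realType) (T : Type) (X : int -> T -> R[i]) (n : int)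
    (w : T) : R[i] :=
  (if n < 0 then X (-1) w else 1) *
  \prod_(p <- primes `|n|%N) X p%:Z w ^+ logn p `|n|%N.

Definition S_term (R : realType) (T : Type) (X : int -> T -> R[i]) (w : T)
    (alpha : R) (n : int) : R[i] :=
  X_ext X n w * (1 - cis1 (n%:~R * alpha)) / n%:~R.

(* The terms n and -n are added together: the series is ordered by |n|. *)
Definition S_series (R : realType) (T : Type) (X : int -> T -> R[i]) (w : T)
    (alpha : R) : R[i] :=
  limn ((fun N : nat => \sum_(1 <= n < N.+1)
    (S_term X w alpha n%:Z + S_term X w alpha (- n%:Z))) : nat -> R[i]^o).

Definition S_max (R : realType) (T : Type) (X : int -> T -> R[i]) (w : T)
    : \bar R :=
  ereal_sup [set (modulus (S_series X w alpha))%:E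
            | alpha in [set alpha : R | 0 <= alpha <= 1]].

(* S is determined only outside the null event where the series diverges, so
   {S > c} is measurable only up to a null set (P need not be complete). The
   outer measure of P is used because it gives such events the probability they
   have in the completion of P, and agrees with P on measurable events. *)
Definition Phi (R : realType) (d : measure_display) (T : measurableType d)
    (P : probability T R) (X : int -> T -> R[i]) (tau : R) : R :=
  fine (mu_ext P
    [set w | ((2 * expR (euler_gamma R) * tau)%:E < S_max X w)%E]).

(* Main.v *)
(* By Polya's Fourier expansion, for a nonprincipal character chi modulo a prime
   q, (2 pi / sqrt q) |sum_(n <= x) chi n| is close to the modulus of
     sum_(1 <= |n| <= N) chi(n) (1 - e(n x / q)) / n,
   which for fixed N is a function of chi(-1) and of chi(p), p <= N.  As q grows,
   these values equidistribute like X_(-1) and X_p, p <= N; both families are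
   compared with the uniform distribution on signs and m-th roots of unity.  The
   terms n > N are negligible outside a proportion o(1) of the characters, resp.
   outside an event of probability o(1), as N grows: over blocks of n, a fourth
   moment bound at each of polynomially many sample points alpha and a Lipschitz
   bound in alpha control the maximum over alpha.  Both tails follow from one
   estimate for families of completely multiplicative functions satisfying a
   large sieve type inequality.  Hence
     Phi (tau + e) - e <= Phi_q tau <= Phi (tau - e) + e
   uniformly in tau for large q, and monotonicity of Phi does the rest. *)

Require Import Defs.
From mathcomp Require Import all_boot all_order all_algebra.
From mathcomp Require Import finmap complex.
From mathcomp Require Import all_classical all_reals all_analysis.
From mathcomp Require Import zify ring lra.
From mathcomp Require Import measurable_realfun.
From mathcomp Require cyclic finfield.
Import Order.TTheory GRing.Theory Num.Theory numFieldNormedType.Exports.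
Local Open Scope classical_set_scope.
Local Open Scope ring_scope.

Set Implicit Arguments.
Unset Strict Implicit.
Unset Printing Implicit Defensive.

(** Events about [S] need not be measurable, so every comparison is an upper bound for an outer
    measure or a proportion. A bound from below is an upper bound for the complement: proportions in
    the discrete model add up to exactly 1, and the outer measures of an event and its complement to
    at least 1.

    The obstacle is the maximum over alpha. For a block ending at x = (j+1)^20 the Lipschitz bound
    is of order x, so more than x sample points are taken, and a second moment is too weak to pay
    for the union bound; the fourth moment suffices. With blocks cut at j^c, thresholds of order
    j^-2 and a second moment constant up to j^6, the proportion lost is of order j^(18 - c); c = 20
    makes it j^-2, summable like the thresholds. The exponent 6 is what the characters require:
    products of two integers of a block reach (j+1)^40, while q is only known to be at least
    (j+1)^34. *)

Local Notation nc := (@Normc.normc _).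

(** * Complex modulus and the unit circle *)

Section Modulus.
Context (R : realType).
Implicit Types (z w : R[i]) (x : R).

Lemma nc_ge0 z : 0 <= nc z.
Proof. by case: z => a b; exact: sqrtr_ge0. Qed.

Lemma nc0 : nc (0 : R[i]) = 0.
Proof. exact: Normc.normc0. Qed.

Lemma nc1 : nc (1 : R[i]) = 1.
Proof. exact: Normc.normc1. Qed.

Lemma ncD z w : nc (z + w) <= nc z + nc w.
Proof. exact: le_normcD. Qed.

Lemma ncN z : nc (- z) = nc z.
Proof. exact: normcN. Qed.

Lemma ncB z w : nc (z - w) <= nc z + nc w.
Proof. by rewrite -(ncN w); exact: ncD. Qed.

Lemma nc_distC z w : nc (z - w) = nc (w - z).
Proof. by rewrite -ncN opprB. Qed.

Lemma nc_dist_trans z w v : nc (z - v) <= nc (z - w) + nc (w - v).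
Proof.
by apply: le_trans (ncD _ _); rewrite addrA subrK.
Qed.

Lemma nc_leD z w : nc z <= nc w + nc (z - w).
Proof. by apply: le_trans (ncD _ _); rewrite addrC subrK. Qed.

Lemma nc_dist_dist z w : `|nc z - nc w| <= nc (z - w).
Proof.
rewrite ler_norml; apply/andP; split.
  by have := nc_leD w z; rewrite nc_distC; lra.
by have := nc_leD z w; lra.
Qed.

Lemma nc_sum (I : Type) (r : seq I) (Q : pred I) (F : I -> R[i]) :
  nc (\sum_(i <- r | Q i) F i) <= \sum_(i <- r | Q i) nc (F i).
Proof.
elim/big_ind2: _ => //; first by rewrite nc0.
by move=> z x w y zx wy; apply: le_trans (ncD _ _) (lerD zx wy).
Qed.

Lemma nc_prod (I : Type) (r : seq I) (Q : pred I) (F : I -> R[i]) :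
  nc (\prod_(i <- r | Q i) F i) = \prod_(i <- r | Q i) nc (F i).
Proof. by apply: big_morph; [exact: Normc.normcM|exact: nc1]. Qed.

Lemma ncX z n : nc (z ^+ n) = nc z ^+ n.
Proof.
by elim: n => [|n IH]; rewrite ?expr0 ?nc1// !exprS Normc.normcM IH.
Qed.

Lemma nc_real x : nc (x%:C%C) = `|x|.
Proof. by rewrite /= expr0n addr0 sqrtr_sqr. Qed.

Lemma nc_nat n : nc (n%:R : R[i]) = n%:R.
Proof.
by rewrite -(rmorph_nat (real_complex R)) nc_real ger0_norm.
Qed.

Lemma nc_sqr z : (nc z ^+ 2)%:C%C = z * z^*%C.
Proof. by rewrite -sqr_normc rmorphXn /= normc_def; case: z. Qed.

Lemma nc_sqrE z : nc z ^+ 2 = complex.Re z ^+ 2 + complex.Im z ^+ 2.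
Proof. by case: z => a b; rewrite sqr_sqrtr // addr_ge0 ?sqr_ge0. Qed.

Lemma nc_conj z : nc (z^*%C) = nc z.
Proof. by case: z => a b /=; rewrite sqrrN. Qed.

Lemma nc_eq0 z : (nc z == 0) = (z == 0).
Proof.
by apply/eqP/eqP => [/Normc.eq0_normc//|->]; exact: nc0.
Qed.

Lemma conjc_sum (I : Type) (r : seq I) (Q : pred I) (F : I -> R[i]) :
  (\sum_(i <- r | Q i) F i)^*%C = \sum_(i <- r | Q i) (F i)^*%C.
Proof. exact: raddf_sum. Qed.

Lemma nc_Re z : `|complex.Re z| <= nc z.
Proof.
by rewrite -sqrtr_sqr; case: z => a b /=; rewrite ler_wsqrtr // lerDl sqr_ge0.
Qed.

Lemma nc_Im z : `|complex.Im z| <= nc z.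
Proof.
by rewrite -sqrtr_sqr; case: z => a b /=; rewrite ler_wsqrtr // lerDr sqr_ge0.
Qed.

Lemma nc_le_ReIm z : nc z <= `|complex.Re z| + `|complex.Im z|.
Proof.
rewrite -(@ler_pXn2r _ 2) ?nnegrE ?nc_ge0 ?addr_ge0 // nc_sqrE.
have : 0 <= `|complex.Re z| * `|complex.Im z| by apply: mulr_ge0.
by rewrite sqrrD -(real_normK (num_real (complex.Re z)))
  -(real_normK (num_real (complex.Im z))); lra.
Qed.

Lemma nc_prod_dist (I : Type) (r : seq I) (F G : I -> R[i]) :
  (forall i, nc (F i) <= 1) -> (forall i, nc (G i) <= 1) ->
  nc (\prod_(i <- r) F i - \prod_(i <- r) G i) <= \sum_(i <- r) nc (F i - G i).
Proof.
move=> F1 G1; elim: r => [|i r IH]; first by rewrite !big_nil subrr nc0.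
rewrite !big_cons.
set a := \prod_(j <- r) F j; set b := \prod_(j <- r) G j.
have -> : F i * a - G i * b = (F i - G i) * b + F i * (a - b) by ring.
apply: le_trans (ncD _ _) _; rewrite !Normc.normcM; apply: lerD; last first.
  by apply: le_trans IH; rewrite ler_piMl ?nc_ge0.
rewrite ler_piMr ?nc_ge0 // nc_prod; apply: prodr_ile1 => j _; rewrite nc_ge0 /=.
exact: G1.
Qed.

End Modulus.

Section UnitCircle.
Context (R : realType).
Implicit Types (x y a b : R) (n : nat).

Lemma pi_lt4 : (pi : R) < 4.
Proof. by have := pihalf_lt2 R; lra. Qed.

Lemma cos_dist a b : `|cos a - cos b| <= `|a - b|.
Proof.
wlog ab : a b / b <= a.
  by move=> H; case: (leP b a) => [/H//|/ltW/H]; rewrite distrC (distrC b).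
have [z _ ->] := @MVT_segment R cos (fun x => - sin x) b a ab
  (fun x _ => is_derive_cos x) (continuous_subspaceT (@continuous_cos R)).
by rewrite normrM ler_piMl // normrN sin_max.
Qed.

Lemma sin_dist a b : `|sin a - sin b| <= `|a - b|.
Proof.
wlog ab : a b / b <= a.
  by move=> H; case: (leP b a) => [/H//|/ltW/H]; rewrite distrC (distrC b).
have [z _ ->] := @MVT_segment R sin cos b a ab
  (fun x _ => is_derive_sin x) (continuous_subspaceT (@continuous_sin R)).
by rewrite normrM ler_piMl // cos_max.
Qed.

Lemma cos_sub1 a : `|cos a - 1| <= a ^+ 2.
Proof.
have -> : cos a = 1 - sin (a / 2) ^+ 2 *+ 2.
  by rewrite {1}(_ : a = a / 2 *+ 2) ?cos_mulr2n ?cos2sin2; [ring|rewrite mulr2n; lra].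
have := sin_dist (a / 2) 0; rewrite sin0 !subr0 => H.
have : sin (a / 2) ^+ 2 <= (a / 2) ^+ 2.
  rewrite -[leLHS]real_normK ?num_real // -[leRHS]real_normK ?num_real //.
  by rewrite lerXn2r ?nnegrE.
have : 0 <= sin (a / 2) ^+ 2 by apply: sqr_ge0.
have -> : (a / 2) ^+ 2 = a ^+ 2 / 4 by field.
have := sqr_ge0 a; rewrite ler_norml; move: (sin _ ^+ 2) (a ^+ 2) => u v.
by move=> ? ? ?; rewrite mulr2n; apply/andP; split; lra.
Qed.

Lemma sin_sub a : `|sin a - a| <= `|a| ^+ 3.
Proof.
wlog a0 : a / 0 <= a.
  move=> H; case: (leP 0 a) => [/H//|a0].
  have := H (- a); rewrite sinN -opprD !normrN; apply; lra.
have cf : continuous (fun x : R => sin x - x).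
  by move=> z; apply: continuousB; [exact: continuous_sin|exact: cvg_id].
have df x : is_derive x 1 (fun x : R => sin x - x) (cos x - 1).
  by apply: is_deriveB.
have [z] := @MVT_segment R (fun x => sin x - x) (fun x => cos x - 1) 0 a a0
  (fun x _ => df x) (continuous_subspaceT cf).
rewrite in_itv /= sin0 !subr0 => /andP[z0 za] ->.
rewrite normrM exprSr; apply: ler_pM => //.
by apply: le_trans (cos_sub1 _) _; rewrite ger0_norm // lerXn2r // nnegrE.
Qed.

(** By doubling and the mean value theorem on [0, x/2], sin x >= 2 cos(x/2)^2 (x/2), and cos(x/2)^2
    >= 1/2 because cos x >= 0. *)
Lemma sin_half_le x : 0 <= x <= pi / 2 -> x / 2 <= sin x.
Proof.
move=> /andP[x0 xp]; have pi0 := pi_gt0 R.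
have [z] := @MVT_segment R sin cos 0 (x / 2) ltac:(lra)
  (fun x _ => is_derive_sin x) (continuous_subspaceT (@continuous_sin R)).
rewrite in_itv /= sin0 !subr0 => /andP[z0 zx] sE.
have cc : cos (x / 2) <= cos z.
  have [->//|ne] := eqVneq z (x / 2).
  have zlt : z < x / 2 by rewrite lt_neqAle ne.
  by rewrite ltW // ltr_cos // in_itv /=; lra.
have c0 : 0 <= cos (x / 2) by apply: cos_ge0_pihalf; lra.
have cx : 0 <= cos x by apply: cos_ge0_pihalf; lra.
have xE : x = x / 2 *+ 2 by rewrite mulr2n; lra.
have -> : sin x = cos (x / 2) * sin (x / 2) *+ 2 by rewrite {1}xE sin_mulr2n.
have : cos x = cos (x / 2) ^+ 2 *+ 2 - 1 by rewrite {1}xE cos_mulr2n.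
rewrite sE => cxE.
have H : cos (x / 2) ^+ 2 * (x / 2) <= cos (x / 2) * (cos z * (x / 2)).
  by rewrite expr2 -mulrA ler_wpM2l // ler_wpM2r //; lra.
have : 1 / 2 * (x / 2) <= cos (x / 2) ^+ 2 * (x / 2).
  by rewrite ler_wpM2r //; lra.
by lra.
Qed.

Lemma cis1D x y : cis1 (x + y) = cis1 x * cis1 y.
Proof.
by rewrite /cis1 mulrDr cosD sinD; apply/eqP; rewrite eq_complex /= eqxx /= addrC.
Qed.

Lemma cis10 : cis1 (0 : R) = 1.
Proof. by rewrite /cis1 mulr0 cos0 sin0. Qed.

Lemma cis1N x : cis1 (- x) = (cis1 x)^*%C.
Proof. by rewrite /cis1 mulrN cosN sinN. Qed.

Lemma nc_cis1 x : nc (cis1 x) = 1.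
Proof. by rewrite /= cos2Dsin2 sqrtr1. Qed.

Lemma cis1MJ x : cis1 x * (cis1 x)^*%C = 1.
Proof. by rewrite -nc_sqr nc_cis1 expr1n. Qed.

Lemma cis1B x y : cis1 (x - y) = cis1 x * (cis1 y)^*%C.
Proof. by rewrite cis1D cis1N. Qed.

Lemma cis1Mn n x : cis1 (n%:R * x) = cis1 x ^+ n.
Proof.
elim: n => [|n IH]; first by rewrite mul0r cis10.
by rewrite -addn1 natrD mulrDl mul1r cis1D IH exprD expr1.
Qed.

Lemma cis11 : cis1 (1 : R) = 1.
Proof. by rewrite /cis1 mulr1 mulr_natl cos2pi sin2pi. Qed.

Lemma cis1_nat n : cis1 (n%:R : R) = 1.
Proof. by rewrite -[n%:R]mulr1 cis1Mn cis11 expr1n. Qed.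

Lemma cis1Dn x n : cis1 (x + n%:R) = cis1 x.
Proof. by rewrite cis1D cis1_nat mulr1. Qed.

Lemma cis1_lip x y : nc (cis1 x - cis1 y) <= 16 * `|x - y|.
Proof.
apply: le_trans (nc_le_ReIm _) _ => /=.
have := cos_dist (2 * pi * x) (2 * pi * y).
have := sin_dist (2 * pi * x) (2 * pi * y).
rewrite -mulrBr normrM ger0_norm; last by have := pi_ge0 R; lra.
have : 2 * pi * `|x - y| <= 8 * `|x - y|.
  by rewrite ler_wpM2r //; have := pi_lt4; lra.
by move: (pi : R) => p; lra.
Qed.

Lemma nc_cis1_sub1 x : nc (cis1 x - 1) = 2 * `|sin (pi * x)|.
Proof.
apply/eqP; rewrite -(@eqrXn2 _ 2) ?nc_ge0 ?mulr_ge0 // nc_sqrE /=.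
have E : 2 * pi * x = (pi * x) *+ 2 by rewrite mulr2n; ring.
rewrite E cos_mulr2n sin_mulr2n exprMn real_normK ?num_real //.
have := cos2Dsin2 (pi * x); move: (cos _) (sin _) => c s cs.
have -> : (c ^+ 2 *+ 2 - 1 - 1) ^+ 2 + (c * s *+ 2 - 0) ^+ 2
   = 4 * ((c ^+ 2 - 1) ^+ 2 + c ^+ 2 * s ^+ 2) by ring.
have -> : c ^+ 2 = 1 - s ^+ 2 by rewrite -cs; ring.
by apply/eqP; ring.
Qed.

Lemma cis1_sub1_ge x : `|x| <= 1 / 2 -> 2 * `|x| <= nc (cis1 x - 1).
Proof.
move=> x2; rewrite nc_cis1_sub1.
have p2 := pi_ge2 R.
have -> : `|sin (pi * x)| = `|sin (pi * `|x|)|.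
  by case: (ger0P x) => // _; rewrite mulrN sinN normrN.
have H : pi * `|x| / 2 <= sin (pi * `|x|).
  apply: sin_half_le; rewrite mulr_ge0 ?pi_ge0 //=.
  by have := ler_wpM2l (pi_ge0 R) x2; lra.
have : 2 * `|x| <= pi * `|x| by rewrite ler_wpM2r.
have := ler_norm (sin (pi * `|x|)); lra.
Qed.

Lemma cis1_sub1_taylor x :
  nc (cis1 x - 1 - 'i%C * (2 * pi * x)%:C%C) <=
  (2 * pi * x) ^+ 2 + `|2 * pi * x| ^+ 3.
Proof.
apply: le_trans (nc_le_ReIm _) _.
have -> : cis1 x - 1 - 'i%C * (2 * pi * x)%:C%C =
  Complex (cos (2 * pi * x) - 1) (sin (2 * pi * x) - 2 * pi * x).
  by apply/eqP; rewrite eq_complex /=; apply/andP; split; apply/eqP; ring.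
by apply: lerD; [exact: cos_sub1|exact: sin_sub].
Qed.

End UnitCircle.

(** * Moments of completely multiplicative families *)

(** The coefficients of the square of a Dirichlet polynomial of length [x] with all coefficients
    1. *)
Definition nfact2 (x m : nat) : nat :=
  (\sum_(1 <= a < x.+1) \sum_(1 <= b < x.+1) (a * b == m))%N.

Definition ndiv_upto (x m : nat) : nat := (\sum_(1 <= c < x.+1) (c %| m))%N.

Lemma sum_eq1_le (m n k : nat) : (\sum_(m <= i < n) (i == k) <= 1)%N.
Proof.
rewrite (eq_bigr (fun i => if i == k then 1%N else 0%N)); last by move=> i _; case: eqP.
by rewrite -big_mkcond sum1_count /= count_uniq_mem ?iota_uniq //; case: (_ \in _).
Qed.

Lemma leq_sum_term (m n k : nat) (F : nat -> nat) : (m <= k < n)%N ->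
  (F k <= \sum_(m <= i < n) F i)%N.
Proof.
move=> kmn; rewrite (bigD1_seq k) /= ?leq_addr ?iota_uniq //.
by rewrite mem_index_iota.
Qed.

Lemma nfact2_le x m : (nfact2 x m <= ndiv_upto x m)%N.
Proof.
rewrite /nfact2 /ndiv_upto !big_nat; apply: leq_sum => a /andP[a1 _].
have [/dvdnP[k ->]|am] := boolP (a %| m)%N.
  apply: leq_trans (sum_eq1_le 1 x.+1 k); apply: leq_sum => b _.
  by rewrite mulnC eqn_pmul2r.
rewrite big1 // => b _; apply/eqP; rewrite eqb0.
by apply: contra am => /eqP <-; rewrite dvdn_mulr.
Qed.

(* Submultiplicativity of the divisor function: a divisor [c] of [a * b] is
   recovered from [gcd(c, a)] and [c / gcd(c, a)], which divide [a] and [b]. *)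
Lemma ndiv_uptoM x a b : (ndiv_upto x (a * b) <= ndiv_upto x a * ndiv_upto x b)%N.
Proof.
rewrite /ndiv_upto big_distrl /=.
apply: (@leq_trans (\sum_(1 <= c < x.+1) \sum_(1 <= u < x.+1)
   \sum_(1 <= v < x.+1) (u %| a) * (v %| b) * (c == u * v))%N); last first.
  rewrite exchange_big /=; apply: leq_sum => u _.
  rewrite exchange_big /= big_distrr /=; apply: leq_sum => v _.
  rewrite -big_distrr /= -[leqRHS]muln1 leq_mul2l.
  by apply/orP; right; apply: sum_eq1_le.
rewrite !big_nat; apply: leq_sum => c /andP[c1 cx].
have [cab|//] := boolP (c %| a * b)%N.
have g0 : (0 < gcdn c a)%N by rewrite gcdn_gt0 c1.
have [g1 g2] := (dvdn_gcdl c a, dvdn_gcdr c a).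
have cE : c = (gcdn c a * (c %/ gcdn c a))%N by rewrite mulnC divnK.
have gx : (1 <= gcdn c a < x.+1)%N.
  by rewrite g0 /= (leq_ltn_trans _ cx) // dvdn_leq.
have hx : (1 <= c %/ gcdn c a < x.+1)%N.
  by rewrite divn_gt0 // dvdn_leq //= (leq_ltn_trans _ cx) // leq_div.
apply: leq_trans (leq_sum_term _ gx); apply: leq_trans (leq_sum_term _ hx).
rewrite g2 -cE eqxx muln1 mul1n lt0b.
have : (c %/ gcdn c a * gcdn c a %| (a %/ gcdn c a * gcdn c a) * b)%N.
  by rewrite !divnK.
rewrite mulnAC dvdn_pmul2r // Gauss_dvdr // /coprime -(eqn_pmul2r g0) mul1n muln_gcdl !divnK //.
Qed.

Lemma sum_ndiv_upto x :
  (\sum_(1 <= a < x.+1) ndiv_upto x a = \sum_(1 <= c < x.+1) x %/ c)%N.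
Proof.
rewrite /ndiv_upto exchange_big /= !big_nat; apply: eq_bigr => c /andP[c0 _].
elim: x => [|x IH]; first by rewrite big_nil div0n.
by rewrite big_nat_recr //= IH divnS // addnC.
Qed.

(** The left side is the multiplicative energy of the integers up to [x]. Expanding one factor of
    the square leaves the sum of [nfact2 x (a * b)] over a, b <= x; submultiplicativity of the
    divisor count then splits it into a product of two equal sums. *)
Lemma sum_nfact2_sqr x :
  (\sum_(0 <= m < (x * x).+1) nfact2 x m ^ 2 <= (\sum_(1 <= c < x.+1) x %/ c) ^ 2)%N.
Proof.
have -> : (\sum_(0 <= m < (x * x).+1) nfact2 x m ^ 2 =
   \sum_(1 <= a < x.+1) \sum_(1 <= b < x.+1) nfact2 x (a * b))%N.
  under eq_bigr => m _ do rewrite expnS expn1 {2}/nfact2 big_distrr /=.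
  rewrite exchange_big /=; rewrite !big_nat; apply: eq_bigr => a /andP[a1 ax].
  under eq_bigr => m _ do rewrite big_distrr /=.
  rewrite exchange_big /=; rewrite !big_nat; apply: eq_bigr => b /andP[b1 bx].
  rewrite (bigD1_seq (a * b)%N) ?iota_uniq ?mem_index_iota ?leq0n ?ltnS ?leq_mul //=.
  rewrite eqxx muln1 big1 ?addn0 // => i /negbTE; rewrite eq_sym => ->.
  by rewrite muln0.
rewrite -(sum_ndiv_upto x) expnS expn1 big_distrl /=; apply: leq_sum => a _.
rewrite big_distrr /=; apply: leq_sum => b _.
exact: leq_trans (nfact2_le _ _) (ndiv_uptoM _ _ _).
Qed.

Section Harmonic.
Context (R : realType).

Lemma harmonic_le_ln (n : nat) : (0 < n)%N ->
  \sum_(1 <= k < n.+1) (k%:R : R)^-1 <= 1 + ln n%:R.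
Proof.
case: n => // n _; elim: n => [|n IH]; first by rewrite big_nat1 invr1 ln1 addr0.
rewrite big_nat_recr //=; apply: le_trans (lerD IH (lexx _)) _.
rewrite -addrA lerD2l.
have n1 : 0 < n.+1%:R :> R by rewrite ltr0n.
have n2 : 0 < n.+2%:R :> R by rewrite ltr0n.
have n3 : 1 + - (n.+2%:R)^-1 = n.+1%:R / n.+2%:R :> R.
  have e : n.+1%:R = n.+2%:R - 1 :> R by rewrite -[n.+2]addn1 natrD addrK.
  by rewrite e mulrBl divff ?mul1r // lt0r_neq0.
have := @le_ln1Dx R (- (n.+2%:R)^-1); rewrite n3 ln_div ?posrE //.
move=> H; have : -1 < - (n.+2%:R)^-1 :> R.
  by rewrite ltrN2 invf_lt1 // ltr1n.
by move=> /H; move: (_^-1) (ln _) (ln _) => u v w; lra.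
Qed.

Lemma harmonic_pow_le (j : nat) : (0 < j)%N ->
  \sum_(1 <= k < ((j.+1) ^ 20).+1) (k%:R : R)^-1 <= 21 * j%:R.
Proof.
move=> j0; apply: le_trans (harmonic_le_ln _) _; first by rewrite expn_gt0.
rewrite natrX lnXn ?ltr0n // -[X in 1 + X]mulr_natl.
have H1 : 1 <= j%:R :> R by rewrite ler1n.
have : ln (j.+1)%:R <= j%:R :> R.
  by rewrite -[j.+1]addn1 natrD addrC; apply: le_ln1Dx; lra.
move: (ln _) => u. lra.
Qed.

Lemma nfact2_energy (x : nat) (h : R) :
  \sum_(1 <= k < x.+1) (k%:R : R)^-1 <= h ->
  \sum_(0 <= m < (x * x).+1) (nfact2 x m)%:R ^+ 2 <= (x%:R * h) ^+ 2.
Proof.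
move=> hh; have H : \sum_(1 <= k < x.+1) (k%:R : R)^-1 * x%:R >= (\sum_(1 <= c < x.+1) x %/ c)%:R.
  rewrite natr_sum !big_nat; apply: ler_sum => c /andP[c1 _].
  by rewrite mulrC ler_pdivlMr ?ltr0n // -natrM ler_nat leq_trunc_div.
apply: (@le_trans _ _ ((\sum_(1 <= c < x.+1) x %/ c)%:R ^+ 2)).
  rewrite (eq_bigr (fun m => (nfact2 x m ^ 2)%:R)) => [|m _]; last by rewrite natrX.
  by rewrite -natr_sum -natrX ler_nat sum_nfact2_sqr.
have h0 : 0 <= h by apply: le_trans hh; apply: sumr_ge0 => i _; rewrite invr_ge0.
rewrite lerXn2r ?nnegrE ?mulr_ge0 //; apply: le_trans H _.
by rewrite -mulr_suml mulrC ler_wpM2l.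
Qed.

End Harmonic.

(** A real sum of indicators of arbitrary propositions, so that it can be weighted and exchanged
    with other sums. *)
Definition cnt (R : realType) (I : finType) (Q : I -> Prop) : R :=
  \sum_(w : I) (`[< Q w >])%:R.
Arguments cnt R {I} Q.

Section Counting.
Context (R : realType) (I : finType).
Implicit Types (Q : I -> Prop).

Lemma cnt_ge0 Q : 0 <= cnt R Q.
Proof. by apply: sumr_ge0. Qed.

Lemma cnt_le Q Q' : (forall w, Q w -> Q' w) -> cnt R Q <= cnt R Q'.
Proof.
move=> QQ'; apply: ler_sum => w _; rewrite ler_nat.
by case: asboolP => // /QQ' /asboolP ->.
Qed.

Lemma cnt_or Q Q' : cnt R (fun w => Q w \/ Q' w) <= cnt R Q + cnt R Q'.
Proof.
rewrite -big_split /=; apply: ler_sum => w _; rewrite -natrD ler_nat.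
by rewrite asbool_or; case: asboolP => //; case: asboolP.
Qed.

Lemma cnt_not Q : cnt R (fun w => ~ Q w) = #|I|%:R - cnt R Q.
Proof.
apply/eqP; rewrite eq_sym subr_eq -big_split /= -sum1_card natr_sum; apply/eqP.
by apply: eq_bigr => w _; rewrite asbool_neg -natrD; case: asboolP.
Qed.

Lemma cnt_bigcup m n (Q : nat -> I -> Prop) :
  cnt R (fun w => exists2 t, (m <= t < n)%N & Q t w) <=
  \sum_(m <= t < n) cnt R (Q t).
Proof.
rewrite exchange_big /=; apply: ler_sum => w _.
case: asboolP => [[t tmn Qt]|_]; last by apply: sumr_ge0.
rewrite (bigD1_seq t) ?iota_uniq ?mem_index_iota //=.
by rewrite asboolT // lerDl sumr_ge0.
Qed.

Lemma cnt_markov (s : R) (f : I -> R) : 0 <= s -> (forall w, 0 <= f w) ->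
  s * cnt R (fun w => s < f w) <= \sum_w f w.
Proof.
move=> s0 f0; rewrite mulr_sumr; apply: ler_sum => w _.
by case: asboolP => [/ltW|_]; rewrite ?mulr1 ?mulr0.
Qed.

End Counting.

Section Multiplicative.
Context (R : realType).
Implicit Types (y : nat -> R[i]).

(** The product that [X_ext] takes at positive integers, used for characters and for the random
    model alike. *)
Definition cmul y (n : nat) : R[i] := \prod_(p <- primes n) y p ^+ logn p n.

Lemma cmulE y n N : (0 < n)%N -> (n < N)%N ->
  cmul y n = \prod_(0 <= p < N | prime p) y p ^+ logn p n.
Proof.
move=> n0 nN; rewrite /cmul.
rewrite [RHS](bigID (fun p => p \in primes n)) /= [X in _ * X]big1 ?mulr1.
  rewrite -[RHS]big_filter. apply: perm_big; apply: uniq_perm.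
  - exact: primes_uniq.
  - by rewrite filter_uniq // iota_uniq.
  move=> p; rewrite mem_filter mem_index_iota /=.
  case E : (p \in primes n); last by rewrite andbF.
  move: E; rewrite mem_primes => /and3P[pp _ pn]; rewrite pp /=.
  by rewrite (leq_ltn_trans _ nN) // dvdn_leq.
move=> p /andP[pp]; rewrite mem_primes pp n0 /= => pn.
by rewrite (_ : logn p n = 0%N) ?expr0 //; apply/eqP; rewrite -leqn0 leqNgt logn_gt0 mem_primes pp n0.
Qed.

Lemma cmulM y m n : (0 < m)%N -> (0 < n)%N -> cmul y (m * n) = cmul y m * cmul y n.
Proof.
move=> m0 n0; rewrite !(@cmulE y _ (m * n).+1) ?muln_gt0 ?m0 // ?ltnS ?leq_pmull ?leq_pmulr //.
by rewrite -big_split /=; apply: eq_bigr => p pp; rewrite lognM // exprD.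
Qed.

End Multiplicative.

Section BlockLemma.
Context (R : realType).

(** The shape of a large sieve inequality: [lam] measures the loss against exact orthogonality. It
    will be 1 for roots of unity and [N / q + 1] for the characters modulo [q]. *)
Definition second_moment_le (I : finType) (Y : I -> nat -> R[i]) (N : nat) (lam : R) :=
  forall d : nat -> R[i],
    \sum_w nc (\sum_(1 <= m < N.+1) d m * Y w m) ^+ 2
    <= lam * #|I|%:R * \sum_(1 <= m < N.+1) nc (d m) ^+ 2.

(** By complete multiplicativity the square of the sum is again such a sum, of length x^2, to which
    the second moment bound applies. Its coefficients are at most beta^2 times [nfact2], whose sum
    of squares is the multiplicative energy. *)
Lemma fourth_moment (I : finType) (Y : I -> nat -> R[i]) (x : nat) (lam beta h : R)
    (b : nat -> R[i]) :
  (forall w m n, (0 < m)%N -> (0 < n)%N -> Y w (m * n)%N = Y w m * Y w n) ->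
  second_moment_le Y (x * x) lam -> 0 <= lam ->
  0 <= beta -> (forall n, nc (b n) <= beta) ->
  \sum_(1 <= k < x.+1) (k%:R : R)^-1 <= h ->
  \sum_w nc (\sum_(1 <= n < x.+1) b n * Y w n) ^+ 4 <=
  lam * #|I|%:R * (beta ^+ 4 * (x%:R * h) ^+ 2).
Proof.
move=> YM m2 lam0 beta0 bb hh.
pose d m := \sum_(1 <= n < x.+1) \sum_(1 <= k < x.+1)
  b n * b k * (n * k == m)%N%:R.
have sqE w : (\sum_(1 <= n < x.+1) b n * Y w n) ^+ 2 =
    \sum_(1 <= m < (x * x).+1) d m * Y w m.
  rewrite expr2 mulr_suml /d.
  under [RHS]eq_bigr do rewrite mulr_suml.
  rewrite [RHS]exchange_big /= !big_nat; apply: eq_bigr => n /andP[n1 nx].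
  under [RHS]eq_bigr do rewrite mulr_suml.
  rewrite mulr_sumr [RHS]exchange_big /= !big_nat; apply: eq_bigr => k /andP[k1 kx].
  rewrite (bigD1_seq (n * k)%N) ?iota_uniq ?mem_index_iota ?muln_gt0 ?n1 ?k1 ?ltnS ?leq_mul //=.
  rewrite eqxx big1 ?addr0; first by rewrite YM // !mulr1; ring.
  by move=> m /negbTE; rewrite eq_sym => ->; rewrite mulr0 mul0r.
have dle m : nc (d m) <= beta ^+ 2 * (nfact2 x m)%:R.
  rewrite /nfact2 natr_sum mulr_sumr; apply: le_trans (nc_sum _ _ _) _.
  apply: ler_sum => i _; rewrite natr_sum mulr_sumr; apply: le_trans (nc_sum _ _ _) _.
  apply: ler_sum => k _; rewrite !Normc.normcM nc_nat ler_wpM2r //.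
  by rewrite expr2 ler_pM ?nc_ge0.
rewrite (eq_bigr (fun w => nc (\sum_(1 <= m < (x * x).+1) d m * Y w m) ^+ 2)); last first.
  by move=> w _; rewrite -sqE ncX -exprM.
apply: le_trans (m2 d) _; rewrite ler_wpM2l ?mulr_ge0 //.
apply: le_trans (_ : _ <= beta ^+ 4 * \sum_(0 <= m < (x * x).+1) (nfact2 x m)%:R ^+ 2) _.
  rewrite mulr_sumr [leRHS]big_ltn // -[leLHS]add0r; apply: lerD.
    by rewrite mulr_ge0 ?exprn_ge0.
  apply: ler_sum => m _; rewrite (_ : beta ^+ 4 * _ = (beta ^+ 2 * (nfact2 x m)%:R) ^+ 2); last by ring.
  by rewrite lerXn2r ?nnegrE ?nc_ge0 ?mulr_ge0 ?exprn_ge0.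
by rewrite ler_wpM2l ?exprn_ge0 // nfact2_energy.
Qed.

End BlockLemma.

Section BadBlocks.
Context (R : realType).
Implicit Types (c Y : nat -> R[i]) (al : R).

Definition tsum c Y (a b : nat) al : R[i] :=
  \sum_(a.+1 <= n < b.+1) c n * Y n * cis1 (n%:R * al).

(** The thresholds telescope: over all j >= J they sum to th / J. The level [th] is 1 for the random
    variables and 1/2 for the finite families; the gap absorbs the rounding of the former to roots
    of unity. *)
Definition bad c Y (j : nat) (th : R) : Prop :=
  exists2 al : R, 0 <= al <= 1 &
    th / (j * j.+1)%N%:R < nc (tsum c Y (j ^ 20) (j.+1 ^ 20) al).

Lemma tsum_lip c Y a b al be (B : R) : (forall n, nc (Y n) <= 1) ->
  (forall n, (0 < n)%N -> nc (c n) <= B / n%:R) ->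
  nc (tsum c Y a b al - tsum c Y a b be) <= 16 * B * b%:R * `|al - be|.
Proof.
move=> Y1 cB; rewrite /tsum -sumrB; apply: le_trans (nc_sum _ _ _) _.
have B0 : 0 <= B by have := cB 1%N isT; rewrite divr1; apply: le_trans; exact: nc_ge0.
apply: (@le_trans _ _ (\sum_(a.+1 <= n < b.+1) 16 * B * `|al - be|)).
  rewrite !big_nat; apply: ler_sum => n /andP[n0 _].
  have n1 : 0 < n%:R :> R by rewrite ltr0n (leq_ltn_trans _ n0).
  rewrite -mulrBr !Normc.normcM.
  have h1 := cB n (leq_ltn_trans (leq0n _) n0).
  have h2 := cis1_lip (n%:R * al) (n%:R * be).
  rewrite -mulrBr normrM (ger0_norm (ltW n1)) in h2.
  apply: le_trans (ler_pM (mulr_ge0 (nc_ge0 _) (nc_ge0 _)) (nc_ge0 _)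
     (ler_pM (nc_ge0 _) (nc_ge0 _) h1 (Y1 n)) h2) _.
  rewrite le_eqVlt; apply/orP; left; apply/eqP; field; exact: lt0r_neq0.
rewrite sumr_const_nat -[leLHS]mulr_natl.
have -> : 16 * B * b%:R * `|al - be| = b%:R * (16 * B * `|al - be|) by ring.
by rewrite ler_wpM2r ?mulr_ge0 // ler_nat subSS leq_subr.
Qed.

Lemma sample_point (T : nat) al : (0 < T)%N -> 0 <= al <= 1 ->
  exists2 t, (t < T.+1)%N & `|al - t%:R / T%:R| <= T%:R^-1.
Proof.
move=> T0 /andP[a0 a1]; have TR : 0 < T%:R :> R by rewrite ltr0n.
have /andP[h1 h2] := truncn_itv (mulr_ge0 a0 (ltW TR)).
exists (Num.truncn (al * T%:R)).
  by rewrite ltnS -(ler_nat R) (le_trans h1) // ler_piMl // ltW.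
rewrite -(ler_pM2r TR) mulVf ?lt0r_neq0 // -[X in _ * X](ger0_norm (ltW TR)) -normrM.
rewrite mulrBl mulfVK ?lt0r_neq0 // ger0_norm ?subr_ge0 //.
by move: h2; rewrite -natr1; lra.
Qed.

Lemma tsum_sample_moment (I : finType) (Y : I -> nat -> R[i]) c (j : nat) (lam al : R) :
  (0 < j)%N ->
  (forall w m n, (0 < m)%N -> (0 < n)%N -> Y w (m * n)%N = Y w m * Y w n) ->
  (forall n, (0 < n)%N -> nc (c n) <= 4 / n%:R) ->
  second_moment_le Y (j.+1 ^ 20 * j.+1 ^ 20) lam -> 0 <= lam ->
  \sum_w nc (tsum c (Y w) (j ^ 20) (j.+1 ^ 20) al) ^+ 4 <=
  lam * #|I|%:R * ((4 / j%:R ^+ 20) ^+ 4 * ((j.+1)%:R ^+ 20 * (21 * j%:R)) ^+ 2).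
Proof.
move=> j0 YM cB m2 lam0.
(* Zero coefficients up to j^20 complete the block to an initial segment; the others are at most 4 /
   j^20. *)
pose b n := if (j ^ 20 < n)%N then c n * cis1 (n%:R * al) else 0.
have jR : 0 < j%:R :> R by rewrite ltr0n.
have bb n : nc (b n) <= 4 / j%:R ^+ 20.
  rewrite /b; case: ifP => jn; last by rewrite nc0 divr_ge0 // exprn_ge0 // ltW.
  have n0 : (0 < n)%N by apply: leq_ltn_trans jn.
  rewrite Normc.normcM nc_cis1 mulr1; apply: le_trans (cB _ n0) _.
  rewrite ler_pM2l // lef_pV2 ?posrE ?ltr0n ?exprn_gt0 // -natrX ler_nat ltnW //.
have := fourth_moment YM m2 lam0 _ bb (harmonic_pow_le R j0).
rewrite natrX; move=> /(_ ltac:(by rewrite divr_ge0 // exprn_ge0 // ltW)).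
apply: le_trans; rewrite le_eqVlt; apply/orP; left; apply/eqP.
apply: eq_bigr => w _; congr (nc _ ^+ 4); rewrite /tsum.
rewrite [RHS](@big_cat_nat _ _ _ (j ^ 20).+1) //=; last by rewrite ltnS leq_exp2r.
rewrite [X in _ = X + _]big_nat_cond [X in _ = X + _]big1 ?add0r; last first.
  by move=> n /andP[/andP[_ +] _]; rewrite ltnS leqNgt /b => /negbTE ->; rewrite mul0r.
rewrite !big_nat; apply: eq_bigr => n /andP[jn _].
by rewrite /b jn; ring.
Qed.

(* Markov's inequality and a union bound over about [j ^ 22] sample points: the
   fourth moment is [O(j ^ -32)] and the threshold is of order [j ^ -2], so the
   proportion of bad [w] is [O(j ^ (22 - 32 + 8))]. *)
Lemma bad_block : exists2 C : R, 0 < C &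
  forall (I : finType) (Y : I -> nat -> R[i]) c (j : nat) (lam : R),
  (0 < j)%N ->
  (forall w m n, (0 < m)%N -> (0 < n)%N -> Y w (m * n)%N = Y w m * Y w n) ->
  (forall w n, nc (Y w n) <= 1) ->
  (forall n, (0 < n)%N -> nc (c n) <= 4 / n%:R) ->
  second_moment_le Y (j.+1 ^ 20 * j.+1 ^ 20) lam ->
  0 <= lam <= 2 * (j.+1)%:R ^+ 6 ->
  cnt R (fun w => bad c (Y w) j 2^-1) <= C / (j * j.+1)%N%:R * #|I|%:R.
Proof.
pose A : R := 2 ^+ 20.
have A0 : 0 < A by rewrite exprn_gt0.
(* The Lipschitz constant 64 (j+1)^20 <= 64 A j^20 times the spacing 1 / (D j^22) must be at most 1
   / (8 j^2), which is at most half of the threshold 1 / (2 j (j+1)). This is 512 A <= D. *)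
pose D := (Num.truncn (512 * A)).+1.
have D1 : 512 * A < D%:R.
  by have /andP[] := truncn_itv (mulr_ge0 (ler0n R 512) (ltW A0)).
have DR : 0 < D%:R :> R by rewrite ltr0n.
(* The factors come in turn from the number of sample points, the threshold 1 / (8 j^2), the bound
   on [lam], and the two parts of the fourth moment. *)
pose K : R := 2 * D%:R * 8 ^+ 4 * (2 * 2 ^+ 6) * 4 ^+ 4 * (A * 21) ^+ 2.
have K0 : 0 < K by rewrite /K !mulr_gt0 // exprn_gt0 // mulr_gt0.
exists (2 * K) => [|I Y c j lam j0 YM Y1 cB m2 /andP[lam0 lam1]].
  by rewrite mulr_gt0.
set J : R := j%:R; have J1 : 1 <= J by rewrite ler1n.
have J0 : 0 < J by lra.
have Jn : J != 0 by apply: lt0r_neq0.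
have jS : (j.+1)%:R = J + 1 :> R by rewrite natr1.
have S2 : J + 1 <= 2 * J by lra.
have J11 : 0 < J + 1 by lra.
have xA : (j.+1)%:R ^+ 20 <= A * J ^+ 20.
  rewrite jS /A -exprMn lerXn2r ?nnegrE //; first by lra.
  by rewrite mulr_ge0 // ltW.
pose T := (D * j ^ 22)%N.
have T0 : (0 < T)%N by rewrite muln_gt0 expn_gt0 j0.
have TE : T%:R = D%:R * J ^+ 22 by rewrite natrM natrX.
have TR : 0 < T%:R :> R by rewrite ltr0n.
pose de : R := 2^-1 / (j * j.+1)%N%:R; have jjE : (j * j.+1)%N%:R = J * (J + 1) :> R.
  by rewrite natrM jS.
have jj0 : 0 < J * (J + 1) by rewrite mulr_gt0 //; lra.
have jj2 : J * (J + 1) <= 2 * J ^+ 2 by rewrite expr2 mulrCA ler_pM2l.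
have de0 : 0 < de by rewrite /de jjE divr_gt0.
have de2 : (8 * J ^+ 2)^-1 <= de / 2.
  rewrite /de jjE -[leRHS]invrK lef_pV2 ?posrE ?invr_gt0 ?divr_gt0 ?mulr_gt0 ?exprn_gt0 //.
  by rewrite !invf_div invrK; lra.
have u0 : 0 < (8 * J ^+ 2)^-1 by rewrite invr_gt0 mulr_gt0 // exprn_gt0.
apply: (@le_trans _ _ (\sum_(0 <= t < T.+1)
   cnt R (fun w => ((8 * J ^+ 2)^-1) ^+ 4 <
     nc (tsum c (Y w) (j ^ 20) (j.+1 ^ 20) (t%:R / T%:R)) ^+ 4))).
  apply: le_trans (cnt_bigcup R 0 T.+1 _); apply: cnt_le => w [al al01 Hal].
  have [t tT alt] := sample_point T0 al01; exists t => //.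
  rewrite ltrXn2r //= ?nc_ge0 ?(ltW u0) //.
  have := tsum_lip (j ^ 20) (j.+1 ^ 20) al (t%:R / T%:R) (Y1 w) cB.
  set P1 := tsum _ _ _ _ _; set P2 := tsum _ _ _ _ _ => lip.
  have lip2 : 16 * 4 * (j.+1 ^ 20)%:R * `|al - t%:R / T%:R| <= (8 * J ^+ 2)^-1.
    apply: (@le_trans _ _ (64 * (A * J ^+ 20) * (D%:R * J ^+ 22)^-1)).
      rewrite natrX TE in alt *; apply: ler_pM => //.
      by rewrite (_ : 16 * 4 = 64) ?ler_pM2l //; lra.
    rewrite (_ : (8 * J ^+ 2)^-1 = 64 * (D%:R / 512 * J ^+ 20) / (D%:R * J ^+ 22)).
      rewrite ler_pM2r ?invr_gt0 ?mulr_gt0 ?exprn_gt0 // ler_pM2l // ler_pM2r ?exprn_gt0 //.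
      by lra.
    by field; rewrite Jn lt0r_neq0.
  have Hal2 : de < nc P1 := Hal.
  have lip3 := le_trans lip lip2.
  have := nc_leD P1 P2; move: de2 lip3 Hal2; clear; move: (_^-1) => u; lra.
apply: (@le_trans _ _ (\sum_(0 <= t < T.+1) K / (2 * D%:R * J ^+ 24) * #|I|%:R)).
  apply: ler_sum => t _.
  have := cnt_markov (exprn_ge0 4 (ltW u0)) (fun w =>
    exprn_ge0 4 (nc_ge0 (tsum c (Y w) (j ^ 20) (j.+1 ^ 20) (t%:R / T%:R)))).
  have M := tsum_sample_moment (t%:R / T%:R) j0 YM cB m2 lam0.
  move=> /le_trans /(_ M); rewrite mulrC -ler_pdivlMr ?exprn_gt0 //.
  move=> /le_trans; apply; rewrite exprVn invrK -/J.
  apply: (@le_trans _ _ ((2 * (2 ^+ 6 * J ^+ 6)) * #|I|%:R *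
     ((4 / J ^+ 20) ^+ 4 * (A * J ^+ 20 * (21 * J)) ^+ 2) * (8 * J ^+ 2) ^+ 4)).
    rewrite ler_wpM2r ?exprn_ge0 // ?mulr_ge0 ?exprn_ge0 ?(ltW J0) //.
    apply: ler_pM.
    - by rewrite mulr_ge0.
    - by apply: mulr_ge0; apply: exprn_ge0; rewrite ?divr_ge0 ?mulr_ge0 ?exprn_ge0 ?(ltW J0) // mulr_ge0 ?(ltW J0).
    - rewrite ler_wpM2r //; apply: le_trans lam1 _.
      rewrite ler_pM2l // -exprMn jS lerXn2r ?nnegrE //; first by lra.
      by rewrite mulr_ge0 // ltW.
    - rewrite ler_wpM2l ?exprn_ge0 ?divr_ge0 ?exprn_ge0 ?(ltW J0) //.
      have hJ : 0 <= 21 * J by rewrite mulr_ge0 // ltW.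
      rewrite lerXn2r ?nnegrE ?mulr_ge0 ?exprn_ge0 ?(ltW A0) ?(ltW J0) //.
      by rewrite ler_wpM2r.
  rewrite le_eqVlt; apply/orP; left; apply/eqP; rewrite /K.
  by field; rewrite Jn lt0r_neq0.
rewrite sumr_const_nat subn0 -[leLHS]mulr_natl mulrA ler_wpM2r //.
apply: (@le_trans _ _ (2 * T%:R * (K / (2 * D%:R * J ^+ 24)))).
  rewrite ler_wpM2r //.
    by rewrite divr_ge0 ?(ltW K0) // !mulr_ge0 // exprn_ge0 // ltW.
  by rewrite -natrM ler_nat mul2n -addnn -addn1 leq_add2l.
rewrite TE jjE (_ : _ * _ = K / J ^+ 2); last by field; rewrite Jn lt0r_neq0.
rewrite -(ler_pM2r jj0) divfK ?lt0r_neq0 //.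
rewrite mulrAC ler_pdivrMr ?exprn_gt0 //.
have -> : 2 * K * J ^+ 2 = K * (2 * J ^+ 2) by ring.
by rewrite ler_pM2l.
Qed.

End BadBlocks.

(** * Characters modulo a prime *)

Section RootsOfUnity.
Context (R : realType).
Implicit Types (x y : R) (i j k T : nat).

Lemma cis1_inj01 x y : 0 <= x < 1 -> 0 <= y < 1 -> cis1 x = cis1 y -> x = y.
Proof.
wlog xy : x y / y <= x.
  move=> H x1 y1 e; case: (leP y x) => [yx|/ltW xy]; first exact: H.
  by apply/esym; apply: H.
move=> /andP[x0 x1] /andP[y0 y1] e.
have e1 : cis1 (x - y) = 1 by rewrite cis1B e cis1MJ.
have := nc_cis1_sub1 (x - y); rewrite e1 subrr nc0 => /esym/eqP.
rewrite mulf_eq0 pnatr_eq0 /= normr_eq0 => s0.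
apply/eqP; rewrite -subr_eq0; apply: contraTT s0 => xy0.
have d0 : 0 < x - y by rewrite lt_neqAle eq_sym xy0 subr_ge0.
rewrite gt_eqF // sin_gt0_pi // mulr_gt0 ?pi_gt0 //=.
by rewrite -[ltRHS]mulr1 ltr_pM2l ?pi_gt0 //; lra.
Qed.

Definition rootu T (l : nat) : R[i] := cis1 (l%:R / T%:R).

Lemma rootuD T k l : rootu T (k + l) = rootu T k * rootu T l.
Proof. by rewrite /rootu natrD mulrDl cis1D. Qed.

Lemma rootuM T k l : rootu T (k * l) = rootu T l ^+ k.
Proof. by rewrite /rootu natrM -mulrA cis1Mn. Qed.

Lemma rootuT T : (0 < T)%N -> rootu T T = 1.
Proof. by move=> T0; rewrite /rootu divff ?cis11 // pnatr_eq0 -lt0n. Qed.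

Lemma rootu0 T : rootu T 0 = 1.
Proof. by rewrite /rootu mul0r cis10. Qed.

Lemma nc_rootu T l : nc (rootu T l) = 1.
Proof. exact: nc_cis1. Qed.

Lemma rootuMJ T l : rootu T l * (rootu T l)^*%C = 1.
Proof. exact: cis1MJ. Qed.

Lemma rootu_mod T l : (0 < T)%N -> rootu T (l %% T) = rootu T l.
Proof.
move=> T0; rewrite {2}(divn_eq l T) rootuD rootuM rootuT // expr1n mul1r.
by [].
Qed.

Lemma rootu_inj T i j : (0 < T)%N -> (rootu T i == rootu T j) = (i == j %[mod T]).
Proof.
move=> T0; apply/eqP/eqP => [|e]; last by rewrite -rootu_mod // e rootu_mod.
rewrite -(rootu_mod i T0) -(rootu_mod j T0) => /cis1_inj01 H.
have TR : 0 < T%:R :> R by rewrite ltr0n.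
have H01 (l : nat) :
    ((0 : R) <= (l %% T)%N%:R / T%:R) && ((l %% T)%N%:R / T%:R < 1 :> R).
  by rewrite divr_ge0 //= ltr_pdivrMr // mul1r ltr_nat ltn_pmod.
have /(mulIf (invr_neq0 (lt0r_neq0 TR)))/eqP := H (H01 i) (H01 j).
by rewrite eqr_nat => /eqP.
Qed.

Lemma rootu_orth T i j : (0 < T)%N ->
  \sum_(t < T) rootu T (t * i) * (rootu T (t * j))^*%C = T%:R * (i == j %[mod T])%:R.
Proof.
move=> T0; pose w := rootu T i * (rootu T j)^*%C.
rewrite (eq_bigr (fun t : 'I_T => w ^+ t)); last first.
  by move=> t _; rewrite !rootuM exprMn rmorphXn.
have wE : (w == 1) = (i == j %[mod T]).
  rewrite -rootu_inj // /w; apply/eqP/eqP => [e|->]; last exact: rootuMJ.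
  by rewrite -[LHS]mulr1 -(rootuMJ T j) mulrA mulrAC e mul1r.
rewrite -wE; case: eqP => [->|/eqP w1].
  by under eq_bigr do rewrite expr1n; rewrite sumr_const card_ord mulr1.
rewrite mulr0; apply/eqP; move: (subrX1 w T).
rewrite exprMn -rmorphXn -!rootuM !(mulnC T) !rootuM !rootuT // !expr1n rmorph1 mulr1 subrr.
by move/esym/eqP; rewrite mulf_eq0 subr_eq0 (negbTE w1).
Qed.

Lemma rootu_prim T : (0 < T)%N -> T.-primitive_root (rootu T 1).
Proof.
move=> T0; apply/andP; split=> //; apply/forallP => i; apply/eqP.
rewrite unity_rootE -rootuM muln1 -(rootu0 T) rootu_inj // mod0n.
have [->|iT] := eqVneq i.+1 T; first by rewrite modnn eqxx.
by rewrite modn_small ?(negbTE iT) // ltn_neqAle iT ltn_ord.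
Qed.

End RootsOfUnity.

Section Characters.
Context (R : realType) (q : nat) (q_pr : prime q).
Implicit Types (a b : 'F_q) (n m : int).

Lemma Fq_exp a : a != 0 -> a ^+ q.-1 = 1.
Proof.
move=> a0; have := finfield.expf_card a; rewrite card_Fp // => H.
by apply: (mulfI a0); rewrite -exprS prednK ?prime_gt0 // mulr1.
Qed.

Lemma Fq_gen_exists : exists z : 'F_q, q.-1.-primitive_root z.
Proof.
have q1 := prime_gt1 q_pr.
have L0 : (0 < q.-1)%N by rewrite -subn1 subn_gt0.
have /hasP[z _ zP] : has q.-1.-primitive_root [seq x <- enum 'F_q | x != 0]; last by exists z.
apply: cyclic.has_prim_root => //; last 2 first.
- by rewrite filter_uniq ?enum_uniq.
- have <- := card_uniqP (filter_uniq (fun x : 'F_q => x != 0) (enum_uniq 'F_q)).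
  rewrite (@eq_card _ _ (predC1 (0 : 'F_q))) ?cardC1 ?card_Fp // => x.
  by rewrite !inE mem_filter mem_enum andbT.
by apply/allP => x; rewrite mem_filter => /andP[x0 _]; rewrite unity_rootE Fq_exp.
Qed.

Definition Fq_gen : 'F_q := xchoose Fq_gen_exists.

Lemma Fq_genP : q.-1.-primitive_root Fq_gen.
Proof. exact: xchooseP. Qed.

Definition dlog a : nat := index a [seq Fq_gen ^+ i | i <- iota 0 q.-1].

Lemma qp0 : (0 < q.-1)%N.
Proof. by rewrite -subn1 subn_gt0 prime_gt1. Qed.

Lemma dlogP a : a != 0 -> Fq_gen ^+ dlog a = a.
Proof.
move=> a0; have ain : a \in [seq Fq_gen ^+ i | i <- iota 0 q.-1].
  have [i ->] := prim_rootP Fq_genP (Fq_exp a0); apply: map_f.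
  by rewrite mem_iota add0n ltn_ord.
have ilt : (dlog a < q.-1)%N by move: ain; rewrite -index_mem size_map size_iota.
by have := nth_index 0 ain; rewrite (nth_map 0%N) ?size_iota // nth_iota.
Qed.

Lemma Fq_gen_neq0 : Fq_gen != 0.
Proof.
apply/eqP => e; have := prim_expr_order Fq_genP.
by rewrite e expr0n gtn_eqF ?qp0 // => /esym/eqP; rewrite oner_eq0.
Qed.

Lemma dlogM a b : a != 0 -> b != 0 -> dlog (a * b) = (dlog a + dlog b)%N %[mod q.-1].
Proof.
move=> a0 b0; apply/eqP; rewrite -(eq_prim_root_expr Fq_genP).
by rewrite exprD !dlogP ?mulf_neq0.
Qed.

Lemma dlog_inj a b : a != 0 -> b != 0 -> (dlog a == dlog b %[mod q.-1]) = (a == b).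
Proof. by move=> a0 b0; rewrite -(eq_prim_root_expr Fq_genP) !dlogP. Qed.

(** Discrete logarithms to a fixed generator make the characters explicit, with index k < q - 1;
    their orthogonality becomes that of roots of unity. *)
Definition Fchar (k : nat) a : R[i] := if a == 0 then 0 else rootu R q.-1 (k * dlog a).

Definition dchar (k : nat) n : R[i] := Fchar k n%:~R.

Lemma Fchar0 k : Fchar k 0 = 0.
Proof. by rewrite /Fchar eqxx. Qed.

Lemma nc_Fchar k a : nc (Fchar k a) = (a != 0)%:R.
Proof. by rewrite /Fchar; case: eqP => _; rewrite ?nc0 ?nc_rootu. Qed.

Lemma FcharM k a b : Fchar k (a * b) = Fchar k a * Fchar k b.
Proof.
rewrite /Fchar mulf_eq0; case: eqP => [_|/eqP a0] /=; first by rewrite mul0r.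
case: eqP => [_|/eqP b0] /=; first by rewrite mulr0.
rewrite -rootuD -mulnDr; apply/eqP; rewrite rootu_inj ?qp0 //.
by rewrite -modnMmr dlogM // modnMmr.
Qed.

Lemma Fchar1 k : Fchar k 1 = 1.
Proof.
have u0 : Fchar k 1 != 0 by rewrite -nc_eq0 nc_Fchar oner_neq0.
by apply: (mulfI u0); rewrite -FcharM !mulr1.
Qed.

Lemma Fchar_orth a b : a != 0 -> b != 0 ->
  \sum_(k < q.-1) Fchar k a * (Fchar k b)^*%C = q.-1%:R * (a == b)%:R.
Proof.
move=> a0 b0; rewrite /Fchar (negbTE a0) (negbTE b0) rootu_orth ?qp0 //.
by rewrite dlog_inj.
Qed.

Lemma Fchar_gen k : Fchar k Fq_gen = rootu R q.-1 k.
Proof.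
rewrite /Fchar (negbTE Fq_gen_neq0); apply/eqP; rewrite rootu_inj ?qp0 //.
rewrite -modnMmr (_ : dlog Fq_gen = 1 %[mod q.-1]) ?modnMmr ?muln1 //.
by apply/eqP; rewrite -(eq_prim_root_expr Fq_genP) dlogP ?expr1 ?Fq_gen_neq0.
Qed.

Lemma intq_eq0 n : ((n%:~R : 'F_q) == 0) = ~~ coprimez n q%:Z.
Proof.
rewrite coprimezE coprime_sym /= prime_coprime // negbK (dvdn_pcharf (pchar_Fp q_pr)).
by case: n => n; rewrite /= ?NegzE ?mulrNz ?oppr_eq0 ?absz_nat.
Qed.

Lemma intq_addq n : ((n + q%:Z)%:~R : 'F_q) = n%:~R.
Proof.
rewrite intrD; have /eqP -> : (q%:Z%:~R : 'F_q) == 0; last by rewrite addr0.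
by rewrite intq_eq0 coprimezE /= /coprime gcdnn gtn_eqF ?prime_gt1.
Qed.

Lemma dchar_dirichlet k : dirichlet_character q (dchar k).
Proof.
split=> [m n|n|n]; rewrite /dchar.
- by rewrite intrM FcharM.
- by rewrite intq_addq.
- by rewrite -nc_eq0 nc_Fchar pnatr_eq0 eqb0 negbK intq_eq0 negbK.
Qed.

Lemma Fchar_inj (k l : nat) : (k < q.-1)%N -> (l < q.-1)%N ->
  Fchar k =1 Fchar l -> k = l.
Proof.
move=> kq lq /(_ Fq_gen); rewrite !Fchar_gen => /eqP; rewrite rootu_inj ?qp0 //.
by rewrite !modn_small // => /eqP.
Qed.

Lemma intq_val a : ((val a)%:Z%:~R : 'F_q) = a.
Proof. by rewrite -pmulrn natr_Zp. Qed.

Lemma dchar_inj (k l : nat) : (k < q.-1)%N -> (l < q.-1)%N ->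
  dchar k = dchar l -> k = l.
Proof.
move=> kq lq e; apply: Fchar_inj => // a.
by have := congr1 (fun f => f (val a)%:Z) e; rewrite /dchar intq_val.
Qed.

Lemma principal_dchar (k : nat) : (k < q.-1)%N -> principal q (dchar k) <-> k = 0%N.
Proof.
move=> kq; split=> [H|-> n].
  apply: (@Fchar_inj k 0) => // [|a]; first exact: qp0.
  have := H (val a)%:Z; rewrite /dchar intq_val => ->.
  have := intq_eq0 (val a)%:Z; rewrite intq_val => /esym/(congr1 negb); rewrite negbK => ->.
  by rewrite /Fchar; case: eqP => //; rewrite mul0n rootu0.
rewrite /dchar /Fchar intq_eq0; case: (coprimez _ _) => //=.
by rewrite mul0n rootu0.
Qed.

Lemma dirichlet_periodic (chi : int -> R[i]) : dirichlet_character q chi ->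
  forall m n, (m%:~R : 'F_q) = n%:~R -> chi m = chi n.
Proof.
case=> _ per _; have perN (t : nat) n : chi (n + (t * q)%N%:Z) = chi n.
  elim: t => [|t IH]; first by rewrite mul0n addr0.
  by rewrite mulSn addnC PoszD addrA per IH.
have perZ t n : chi (n + t * q%:Z) = chi n.
  case: t => t; first by rewrite -PoszM perN.
  by rewrite -(perN t.+1 (n + _)) NegzE PoszM mulNr subrK.
move=> m n /eqP; rewrite -subr_eq0 -intrB intq_eq0 coprimezE coprime_sym /= prime_coprime // negbK => qmn.
have /dvdzP[t e] : (q%:Z %| m - n)%Z by rewrite dvdzE.
by rewrite -(subrK n m) e addrC perZ.
Qed.

(** The value of [chi] at the generator is a (q-1)-th root of unity, hence the value of some
    [Fchar k], and it determines [chi]. Characters can therefore be counted by their index. *)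
Lemma dirichlet_dchar (chi : int -> R[i]) : dirichlet_character q chi ->
  exists2 k, (k < q.-1)%N & chi = dchar k.
Proof.
move=> chiD; have per := dirichlet_periodic chiD; case: chiD => chiM _ chi0.
pose f a := chi (val a)%:Z.
have fM a b : f (a * b) = f a * f b.
  by rewrite /f -chiM; apply: per; rewrite intrM !intq_val.
have f0 a : (f a != 0) <-> (a != 0).
  by rewrite /f chi0 -[X in _ <-> X != _]intq_val intq_eq0 negbK.
have f1 : f 1 = 1.
  have u0 : f 1 != 0 by apply/f0; rewrite oner_eq0.
  by apply: (mulfI u0); rewrite -fM !mulr1.
have fX a (n : nat) : f (a ^+ n) = f a ^+ n.
  by elim: n => [|n IH]; rewrite ?expr0 ?f1 // !exprS fM IH.
have : f Fq_gen ^+ q.-1 = 1 by rewrite -fX prim_expr_order ?f1 //; exact: Fq_genP.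
move=> /(prim_rootP (rootu_prim R qp0))[k kE].
exists k => //; apply/funext => n; have -> : chi n = f n%:~R.
  by apply: per; rewrite intq_val.
rewrite /dchar /Fchar; case: eqP => [->|/eqP n0].
  by apply/eqP; apply: contraT => /f0; rewrite eqxx.
by rewrite -{1}(dlogP n0) fX kE -exprM -rootuM muln1.
Qed.

End Characters.

(** * Second moments from orthogonality *)

Section SecondMoment.
Context (R : realType).

(** A Schur test: opening the square gives a form with the symmetric matrix [E], and |d_m d_n| <=
    (|d_m|^2 + |d_n|^2) / 2 reduces it to row sums. *)
Lemma second_moment_of_orth (I : finType) (Y : I -> nat -> R[i]) (N : nat)
    (E : nat -> nat -> bool) (lam : R) :
  (forall m n, (0 < m <= N)%N -> (0 < n <= N)%N ->
     \sum_w Y w m * (Y w n)^*%C = #|I|%:R * (E m n)%:R) ->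
  (forall m n, E m n = E n m) ->
  (forall m, (0 < m <= N)%N -> \sum_(1 <= n < N.+1) (E m n)%:R <= lam) ->
  second_moment_le Y N lam.
Proof.
move=> orth Esym Elam d.
set S := (X in X <= _).
have S0 : 0 <= S by apply: sumr_ge0 => w _; rewrite exprn_ge0 // nc_ge0.
have SE : S%:C%C = \sum_(1 <= m < N.+1) \sum_(1 <= n < N.+1)
    d m * (d n)^*%C * (#|I|%:R * (E m n)%:R).
  rewrite /S rmorph_sum /=.
  under eq_bigr => w _.
    rewrite nc_sqr conjc_sum mulr_suml.
    under eq_bigr do rewrite mulr_sumr.
    over.
  rewrite exchange_big /= !big_nat; apply: eq_bigr => m mN.
  rewrite exchange_big /= !big_nat; apply: eq_bigr => n nN.
  rewrite -orth // mulr_sumr; apply: eq_bigr => w _.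
  by rewrite rmorphM /=; ring.
have -> : S = nc (S%:C%C) by rewrite nc_real ger0_norm.
rewrite SE.
apply: (@le_trans _ _ (\sum_(1 <= m < N.+1) \sum_(1 <= n < N.+1)
    (nc (d m) ^+ 2 / 2 + nc (d n) ^+ 2 / 2) * (#|I|%:R * (E m n)%:R))).
  apply: le_trans (nc_sum _ _ _) _; apply: ler_sum => m _.
  apply: le_trans (nc_sum _ _ _) _; apply: ler_sum => n _.
  rewrite !Normc.normcM !nc_nat nc_conj ler_wpM2r ?mulr_ge0 //.
  by have := sqr_ge0 (nc (d m) - nc (d n)); rewrite sqrrB; lra.
have half : \sum_(1 <= m < N.+1) \sum_(1 <= n < N.+1)
    nc (d m) ^+ 2 / 2 * (#|I|%:R * (E m n)%:R) <=
    lam * #|I|%:R * (\sum_(1 <= m < N.+1) nc (d m) ^+ 2) / 2.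
  rewrite mulr_sumr mulr_suml !big_nat; apply: ler_sum => m mN.
  rewrite -mulr_sumr -mulr_sumr mulrCA.
  rewrite (_ : lam * _ * _ / 2 = #|I|%:R * (nc (d m) ^+ 2 / 2 * lam)); last by ring.
  rewrite ler_wpM2l // ler_wpM2l ?Elam //.
  by rewrite divr_ge0 // exprn_ge0 // nc_ge0.
have half2 : \sum_(1 <= m < N.+1) \sum_(1 <= n < N.+1)
    nc (d n) ^+ 2 / 2 * (#|I|%:R * (E m n)%:R) <=
    lam * #|I|%:R * (\sum_(1 <= m < N.+1) nc (d m) ^+ 2) / 2.
  rewrite exchange_big /=; apply: le_trans half.
  by apply: ler_sum => m _; apply: ler_sum => n _; rewrite Esym.
apply: (@le_trans _ _ (lam * #|I|%:R * (\sum_(1 <= m < N.+1) nc (d m) ^+ 2) / 2 +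
  lam * #|I|%:R * (\sum_(1 <= m < N.+1) nc (d m) ^+ 2) / 2)); last by lra.
apply: le_trans (lerD half half2).
rewrite -big_split /=; apply: ler_sum => m _.
by rewrite -big_split /=; apply: ler_sum => n _; rewrite mulrDl.
Qed.

Lemma count_residue_le (q N m : nat) : (0 < q)%N ->
  (\sum_(1 <= n < N.+1) (m == n %[mod q]) <= N %/ q + 1)%N.
Proof.
move=> q0; apply: (@leq_trans (\sum_(1 <= n < N.+1) \sum_(0 <= t < N %/ q + 1)
   (n == t * q + m %% q)))%N.
  rewrite !big_nat; apply: leq_sum => n /andP[_ nN].
  case: eqP => // e; apply: leq_trans (@leq_sum_term 0 _ (n %/ q) _ _).
    by rewrite e -divn_eq eqxx.
  by rewrite leq0n addn1 ltnS leq_div2r.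
rewrite exchange_big /=; apply: (@leq_trans (\sum_(0 <= t < N %/ q + 1) 1)%N).
  by apply: leq_sum => t _; apply: sum_eq1_le.
by rewrite sum_nat_const_nat subn0 muln1.
Qed.

End SecondMoment.

(** * Additive characters and Gauss sums *)

Section Gauss.
Context (R : realType) (q : nat) (q_pr : prime q).
Implicit Types (a b : 'F_q) (k : nat).
Local Notation chi := (@Fchar R q q_pr).
Local Notation dch := (@dchar R q q_pr).

Lemma dchar_nat k (n : nat) : dch k n%:Z = chi k n%:R.
Proof. by rewrite /dchar -pmulrn. Qed.

Lemma natq_eq (m n : nat) : ((m%:R : 'F_q) == n%:R) = (m == n %[mod q]).
Proof.
transitivity (nat_of_ord (m%:R : 'F_q) == nat_of_ord (n%:R : 'F_q)); first by [].
by rewrite !val_Fp_nat.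
Qed.

Lemma natq_eq0 (m : nat) : ((m%:R : 'F_q) == 0) = (q %| m)%N.
Proof. by rewrite (dvdn_pcharf (pchar_Fp q_pr)). Qed.

Lemma dchar_orth (m n : nat) :
  \sum_(k < q.-1) dch k m%:Z * (dch k n%:Z)^*%C =
  q.-1%:R * (~~ (q %| m)%N && (m == n %[mod q]))%:R.
Proof.
under eq_bigr do rewrite !dchar_nat.
have [qm|qm] := boolP (q %| m)%N.
  rewrite mulr0 big1 // => k _; have /eqP -> : (m%:R : 'F_q) == 0 by rewrite natq_eq0.
  by rewrite Fchar0 mul0r.
have m0 : (m%:R : 'F_q) != 0 by rewrite natq_eq0.
have [qn|qn] := boolP (q %| n)%N; last by rewrite Fchar_orth ?natq_eq0 // natq_eq.
rewrite big1 => [|k _]; last first.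
  have /eqP -> : (n%:R : 'F_q) == 0 by rewrite natq_eq0.
  by rewrite Fchar0 rmorph0 mulr0.
rewrite -natq_eq; have /eqP -> : (n%:R : 'F_q) == 0 by rewrite natq_eq0.
by rewrite (negbTE m0) mulr0.
Qed.

Lemma dchar_second_moment (N : nat) :
  second_moment_le (fun (k : 'I_q.-1) (n : nat) => dch k n%:Z) N (N%:R / q%:R + 1).
Proof.
have q0 := prime_gt0 q_pr.
apply: (@second_moment_of_orth _ _ _ _
  (fun m n => ~~ (q %| m)%N && (m == n %[mod q]))) => [m n _ _|m n|m mN].
- by rewrite dchar_orth card_ord.
- rewrite eq_sym; case: eqP => [e|_]; last by rewrite !andbF.
  by rewrite !andbT /dvdn e.
- apply: (@le_trans _ _ (N %/ q + 1)%N%:R).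
    rewrite -natr_sum ler_nat; apply: leq_trans (count_residue_le N m q0).
    by apply: leq_sum => n _; case: (q %| m)%N.
  by rewrite natrD lerD2r ler_pdivlMr ?ltr0n // -natrM ler_nat leq_trunc_div.
Qed.

Lemma sum_Fq (V : zmodType) (f : 'F_q -> V) :
  \sum_a f a = \sum_(0 <= t < q) f t%:R.
Proof.
have H : \sum_a f a = \sum_(0 <= t < (Zp_trunc (pdiv q)).+2) f t%:R.
  by rewrite big_mkord; apply: eq_bigr => a _; rewrite natr_Zp.
by rewrite H Fp_cast.
Qed.

Definition psi a : R[i] := rootu R q (nat_of_ord a).

Lemma psi_nat (n : nat) : psi n%:R = rootu R q n.
Proof. by rewrite /psi val_Fp_nat // rootu_mod // prime_gt0. Qed.

Lemma psiD a b : psi (a + b) = psi a * psi b.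
Proof.
rewrite -(natr_Zp a) -(natr_Zp b) -natrD !psi_nat.
by rewrite rootuD.
Qed.

Lemma psi0 : psi 0 = 1.
Proof. by rewrite (psi_nat 0) rootu0. Qed.

Lemma nc_psi a : nc (psi a) = 1.
Proof. exact: nc_rootu. Qed.

Lemma psiN a : psi (- a) = (psi a)^*%C.
Proof.
have p0 : psi a != 0 by rewrite -nc_eq0 nc_psi oner_neq0.
by apply: (mulfI p0); rewrite -psiD subrr psi0 rootuMJ.
Qed.

Lemma psiMn a n : psi (a * n%:R) = psi a ^+ n.
Proof.
elim: n => [|n IH]; first by rewrite mulr0 psi0.
by rewrite -addn1 natrD mulrDr mulr1 psiD IH exprD expr1.
Qed.

Lemma psi_orth a b : \sum_n psi (a * n) * (psi (b * n))^*%C = q%:R * (a == b)%:R.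
Proof.
rewrite sum_Fq big_mkord -{2}(natr_Zp a) -{2}(natr_Zp b) natq_eq -rootu_orth ?prime_gt0 //.
apply: eq_bigr => t _; rewrite -{1}(natr_Zp a) -{1}(natr_Zp b) -!natrM !psi_nat.
by rewrite !(mulnC t).
Qed.

Definition gauss k a : R[i] := \sum_b chi k b * psi (b * a).

Lemma sum_Fchar k : (0 < k < q.-1)%N -> \sum_a chi k a = 0.
Proof.
move=> /andP[k0 kq]; pose g := Fq_gen q_pr.
have g0 : g != 0 by apply: Fq_gen_neq0.
have e : \sum_a chi k a = chi k g * \sum_a chi k a.
  rewrite {1}(reindex_inj (mulfI g0)) /= mulr_sumr.
  by apply: eq_bigr => a _; rewrite FcharM.
apply/eqP; move/eqP: e; rewrite -subr_eq0 -{1}[\sum_a _]mul1r -mulrBl mulf_eq0.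
rewrite subr_eq0 Fchar_gen eq_sym -(rootu0 R q.-1) rootu_inj ?qp0 //.
by rewrite mod0n modn_small // (gtn_eqF k0).
Qed.

Lemma gaussE k a : (0 < k < q.-1)%N -> gauss k a = (chi k a)^*%C * gauss k 1.
Proof.
move=> kq; rewrite /gauss; have [->|a0] := eqVneq a 0.
  rewrite Fchar0 rmorph0 mul0r -[RHS](sum_Fchar kq).
  by apply: eq_bigr => b _; rewrite mulr0 psi0 mulr1.
have e : chi k a * (chi k a)^*%C = 1 by rewrite -nc_sqr nc_Fchar a0 expr1n.
rewrite mulr_sumr [RHS](reindex_inj (mulIf a0)) /=.
by apply: eq_bigr => b _; rewrite FcharM mulr1 -[LHS]mul1r -e; ring.
Qed.

Lemma sum_nc_Fchar k : \sum_a nc (chi k a) ^+ 2 = q.-1%:R.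
Proof.
rewrite (eq_bigr (fun a => (a != 0)%:R)); last first.
  by move=> a _; rewrite nc_Fchar; case: (a != 0); rewrite ?expr1n ?expr0n.
rewrite -natr_sum; congr (_%:R).
have := cardC1 (0 : 'F_q); rewrite card_Fp // => <-.
by rewrite -sum1_card [RHS]big_mkcond; apply: eq_bigr => a _; rewrite inE; case: eqP.
Qed.

(** Parseval: summing the squared modulus of [gauss k a] over all [a] gives q - 1 times that of
    [gauss k 1] by separability, and q (q - 1) by orthogonality of the additive characters. *)
Lemma nc_gauss k : (0 < k < q.-1)%N -> nc (gauss k 1) = Num.sqrt q%:R.
Proof.
move=> kq; have L0 : q.-1%:R != 0 :> R by rewrite pnatr_eq0 -lt0n qp0.
suff e : nc (gauss k 1) ^+ 2 = q%:R by rewrite -e sqrtr_sqr ger0_norm ?nc_ge0.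
apply: (mulIf L0); rewrite -{1}(sum_nc_Fchar k) mulr_sumr.
transitivity (\sum_a nc (gauss k a) ^+ 2).
  by apply: eq_bigr => a _; rewrite (gaussE a kq) Normc.normcM nc_conj exprMn mulrC.
apply: (@complexI R); rewrite rmorph_sum /=.
under eq_bigr => a _.
  rewrite nc_sqr /gauss conjc_sum mulr_suml.
  under eq_bigr do rewrite mulr_sumr.
  over.
rewrite exchange_big /=.
transitivity (\sum_b \sum_c chi k b * (chi k c)^*%C * (q%:R * (b == c)%:R)).
  apply: eq_bigr => b _; rewrite exchange_big /=; apply: eq_bigr => c _.
  rewrite -psi_orth mulr_sumr; apply: eq_bigr => a _.
  by rewrite rmorphM /=; ring.
rewrite rmorphM /= -(sum_nc_Fchar k) rmorph_sum /= mulr_sumr rmorph_nat.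
apply: eq_bigr => b _; rewrite (bigD1 b) //= eqxx big1 => [|c cb]; last first.
  by rewrite eq_sym (negbTE cb) !mulr0.
by rewrite nc_sqr addr0 mulr1; ring.
Qed.

(** Folding residues into pairs n, -n with n <= q/2 yields frequencies at which e(n/q) - 1 is
    bounded below by a multiple of n/q. *)
Lemma sum_Fq_half (V : zmodType) (f : 'F_q -> V) : odd q -> f 0 = 0 ->
  \sum_a f a = \sum_(1 <= n < (q./2).+1) (f n%:R + f (- n%:R)).
Proof.
move=> qodd f0; rewrite sum_Fq big_split /=.
have qE : q = (q./2 + q./2).+1 by rewrite -[LHS]odd_double_half qodd add1n addnn.
rewrite (@big_cat_nat _ _ _ (q./2).+1) //=; last by rewrite {2}qE ltnS leq_addr.
rewrite big_ltn // f0 add0r; congr (_ + _).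
rewrite -[(q./2).+1 in LHS]add0n big_addn big_nat_rev [RHS]big_add1 /=.
have -> : (q - q./2.+1 = q./2)%N by rewrite {1}qE; lia.
rewrite !big_nat; apply: eq_bigr => i /andP[_ ih]; congr f.
apply/eqP; rewrite -addr_eq0 -natrD natq_eq0 {1}qE.
have -> : (0 + q./2 - i.+1 + q./2.+1 + i.+1 = (q./2 + q./2).+1)%N by lia.
by rewrite dvdnn.
Qed.

End Gauss.

(** * Smoothed Polya expansion *)

Section Smoothing.
Context (R : realType).
Implicit Types (z : R[i]) (H x n : nat) (t al : R).

Lemma nc_i : nc ('i%C : R[i]) = 1.
Proof. by rewrite /= expr0n expr1n add0r sqrtr1. Qed.

Lemma real_complexM (x y : R) : (x * y)%:C%C = x%:C%C * y%:C%C :> R[i].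
Proof. exact: rmorphM. Qed.

(* Averaging a character sum over [H] shifts of its range multiplies its Fourier
   coefficients by [fejer H], hence makes them decay quadratically, and changes
   the sum by at most [2 * H]. *)
Definition fejer H z : R[i] := H%:R^-1 * \sum_(0 <= h < H) z ^+ h.

Definition cfz H z : R[i] := fejer H z * (z / (z - 1)).

Lemma geom_sum z x : z != 1 ->
  \sum_(1 <= n < x.+1) z ^+ n = z / (z - 1) * (z ^+ x - 1).
Proof.
move=> z1; have d0 : z - 1 != 0 by rewrite subr_eq0.
rewrite big_add1 /= big_mkord; under eq_bigr do rewrite exprS.
by rewrite -mulr_sumr subrX1; field.
Qed.

Lemma fejer_le1 H z : nc z = 1 -> nc (fejer H z) <= 1.
Proof.
move=> z1; case: H => [|H]; first by rewrite /fejer big_nil mulr0 nc0.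
rewrite /fejer Normc.normcM Normc.normcV nc_nat mulrC ler_pdivrMr ?ltr0n // mul1r.
apply: le_trans (nc_sum _ _ _) _; under eq_bigr do rewrite ncX z1 expr1n.
by rewrite sumr_const_nat subn0.
Qed.

Lemma fejer_decay H z : nc z = 1 -> nc (fejer H z) * (H%:R * nc (z - 1)) <= 2.
Proof.
move=> z1; rewrite /fejer Normc.normcM Normc.normcV nc_nat.
case: H => [|H]; first by rewrite mul0r mulr0.
rewrite mulrACA mulVf ?pnatr_eq0 // mul1r mulrC -Normc.normcM big_mkord -subrX1.
by apply: le_trans (ncB _ _) _; rewrite ncX z1 expr1n nc1.
Qed.

Lemma fejer_sub1 H al : (0 < H)%N -> nc (fejer H (cis1 al) - 1) <= 16 * H%:R * `|al|.
Proof.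
move=> H0; have HR : 0 < H%:R :> R by rewrite ltr0n.
have HC : H%:R != 0 :> R[i] by rewrite pnatr_eq0 -lt0n.
have -> : fejer H (cis1 al) - 1 = H%:R^-1 * \sum_(0 <= h < H) (cis1 al ^+ h - 1).
  by rewrite sumrB sumr_const_nat subn0 mulrBr mulVf.
rewrite Normc.normcM Normc.normcV nc_nat mulrC ler_pdivrMr //.
apply: le_trans (nc_sum _ _ _) _.
apply: (@le_trans _ _ (\sum_(0 <= h < H) 16 * H%:R * `|al|)).
  rewrite !big_nat; apply: ler_sum => h /andP[_ hH].
  have := cis1_lip (h%:R * al) 0; rewrite cis10 subr0 cis1Mn => /le_trans; apply.
  rewrite normrM ger0_norm // mulrA ler_wpM2r // ler_wpM2l // ler_nat.
  exact: ltnW.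
by rewrite sumr_const_nat subn0 [leRHS]mulr_natr.
Qed.

(** Since e(t/q) - 1 is close to 2 pi i t / q, the prefactor normalizes the coefficient to be close
    to 1 / t. *)
Definition cf (q H : nat) t : R[i] :=
  'i%C * (2 * pi / q%:R)%:C%C * cfz H (cis1 (t / q%:R)).

(** Multiplication by z - 1 removes the pole and leaves small quantities only: F - 1, z - 1 and the
    Taylor remainder z - 1 - u t. *)
Lemma cf_key_identity (K : fieldType) (z F u t : K) : t != 0 -> z - 1 != 0 ->
  (u * (F * (z / (z - 1))) - t^-1) * (z - 1) =
  u * (F * (z - 1) + (F - 1)) - t^-1 * (z - 1 - u * t).
Proof. by move=> t0 z0; field; rewrite t0 z0. Qed.

Section CoefBounds.
Context (q H : nat) (t : R) (q0 : (0 < q)%N) (H0 : (0 < H)%N)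
  (t1 : 1 <= `|t|) (tq : `|t| <= q%:R / 2).

Let qR : 0 < q%:R :> R. Proof. by rewrite ltr0n. Qed.
Let HR : 0 < H%:R :> R. Proof. by rewrite ltr0n. Qed.
Let z : R[i] := cis1 (t / q%:R).

Let norm_tq : `|t / q%:R| = `|t| / q%:R.
Proof. by rewrite normrM normfV (ger0_norm (ltW qR)). Qed.

Let z1 : 2 * `|t| / q%:R <= nc (z - 1).
Proof.
rewrite -mulrA -norm_tq; apply: cis1_sub1_ge.
by rewrite norm_tq ler_pdivrMr // mulrC; move: tq; lra.
Qed.

Let t0 : 0 < `|t|. Proof. by apply: lt_le_trans t1. Qed.

Let z1_gt0 : 0 < nc (z - 1).
Proof. by apply: lt_le_trans z1; rewrite divr_gt0 // mulr_gt0. Qed.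

Lemma cis1_neq1 : z != 1.
Proof. by rewrite -subr_eq0 -nc_eq0 gt_eqF. Qed.

Let nc_cf : nc (cf q H t) = 2 * pi / q%:R * (nc (fejer H z) / nc (z - 1)).
Proof.
rewrite /cf /cfz -/z !Normc.normcM Normc.normcV nc_cis1 mul1r nc_real.
rewrite ger0_norm ?divr_ge0 ?mulr_ge0 ?pi_ge0 // nc_i.
by rewrite mul1r Normc.normcV.
Qed.

(** The chord bound |z - 1| >= 2 |t| / q and pi < 4 give the constant 4, the one that the block
    estimate assumes. *)
Lemma cf_le : nc (cf q H t) <= 4 / `|t|.
Proof.
rewrite nc_cf; have F1 := fejer_le1 H (nc_cis1 (t / q%:R)); rewrite -/z in F1.
apply: (@le_trans _ _ (2 * 4 / q%:R * (1 / (2 * `|t| / q%:R)))).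
  have pi4 := pi_lt4 R; have pi0 := pi_ge0 R.
  apply: ler_pM; rewrite ?divr_ge0 ?mulr_ge0 ?nc_ge0 //.
    by rewrite ler_pM2r ?invr_gt0 // ler_pM2l // ltW.
  apply: ler_pM; rewrite ?invr_ge0 ?nc_ge0 //.
  by rewrite lef_pV2 // posrE // divr_gt0 // mulr_gt0.
rewrite le_eqVlt; apply/orP; left; apply/eqP; field.
by rewrite !lt0r_neq0.
Qed.

Lemma cf_decay : nc (cf q H t) <= 4 * q%:R / (H%:R * `|t| ^+ 2).
Proof.
rewrite nc_cf; have F1 := fejer_decay H (nc_cis1 (t / q%:R)); rewrite -/z in F1.
have pi4 := pi_lt4 R; have pi0 := pi_ge0 R.
apply: (@le_trans _ _ (2 * 4 / q%:R * (2 / (H%:R * (2 * `|t| / q%:R) ^+ 2)))).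
  apply: ler_pM; rewrite ?divr_ge0 ?mulr_ge0 ?nc_ge0 //.
    by rewrite ler_pM2r ?invr_gt0 // ler_pM2l // ltW.
  apply: (@le_trans _ _ (2 / (H%:R * nc (z - 1) ^+ 2))).
    rewrite -[leLHS](mulfK (lt0r_neq0 (mulr_gt0 HR (exprn_gt0 2 z1_gt0)))).
    rewrite ler_pM2r ?invr_gt0 ?mulr_gt0 ?exprn_gt0 //.
    apply: le_trans F1; rewrite le_eqVlt; apply/orP; left; apply/eqP.
    by field; rewrite lt0r_neq0.
  rewrite ler_pM2l // lef_pV2 ?posrE ?mulr_gt0 ?exprn_gt0 ?divr_gt0 ?mulr_gt0 ?invr_gt0 //.
  by rewrite ler_pM2l // lerXn2r // nnegrE ?nc_ge0 // divr_ge0 // mulr_ge0.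
rewrite le_eqVlt; apply/orP; left; apply/eqP; field.
by rewrite !lt0r_neq0.
Qed.

Lemma cf_approx : nc (cf q H t - (t^-1)%:C%C) <= 300 * H%:R / q%:R.
Proof.
have pi4 := pi_lt4 R; have pi0 := pi_ge0 R.
have H1 : 1 <= H%:R :> R by rewrite ler1n.
have zn1 : z - 1 != 0 by rewrite subr_eq0 cis1_neq1.
pose u : R[i] := 'i%C * (2 * pi / q%:R)%:C%C.
pose e : R[i] := z - 1 - 'i%C * (2 * pi * (t / q%:R))%:C%C.
have tR : t != 0 by rewrite -normr_eq0 lt0r_neq0.
have tC : t%:C%C != 0 by apply: contra tR => /eqP/(@complexI R) ->.
have eE : e = z - 1 - u * t%:C%C.
  have eq2 : 2 * pi * (t / q%:R) = 2 * pi / q%:R * t by ring.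
  by rewrite /e /u eq2 real_complexM mulrA.
have ne : nc e <= (8 * (`|t| / q%:R)) ^+ 2 + (8 * (`|t| / q%:R)) ^+ 3.
  have := cis1_sub1_taylor (t / q%:R); rewrite -/z -/e => /le_trans; apply.
  have h : `|2 * pi * (t / q%:R)| <= 8 * (`|t| / q%:R).
    rewrite normrM norm_tq ler_wpM2r ?divr_ge0 // ger0_norm ?mulr_ge0 //.
    by move: pi4 pi0; move: (pi : R) => p; lra.
  have h8 : 0 <= 8 * (`|t| / q%:R) by rewrite mulr_ge0 // divr_ge0.
  apply: lerD; last by rewrite lerXn2r // nnegrE.
  by rewrite -[leLHS]real_normK ?num_real // lerXn2r // nnegrE.
have nu : nc u <= 8 / q%:R.
  rewrite /u Normc.normcM nc_real ger0_norm ?divr_ge0 ?mulr_ge0 //.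
  rewrite /= expr0n expr1n add0r sqrtr1 mul1r ler_pM2r ?invr_gt0 //.
  by move: pi4; move: (pi : R) => p; lra.
have F1 := fejer_sub1 (t / q%:R) H0; rewrite -/z norm_tq in F1.
have F2 := fejer_le1 H (nc_cis1 (t / q%:R)); rewrite -/z in F2.
have zl : nc (z - 1) <= 16 * (`|t| / q%:R).
  by have := cis1_lip (t / q%:R) 0; rewrite cis10 subr0 norm_tq.
have key : (cf q H t - (t^-1)%:C%C) * (z - 1) =
  u * (fejer H z * (z - 1) + (fejer H z - 1)) - (t^-1)%:C%C * e.
  have -> : (t^-1)%:C%C = (t%:C%C)^-1 by rewrite -fmorphV.
  by rewrite eE; exact: cf_key_identity.
have : nc (cf q H t - (t^-1)%:C%C) * nc (z - 1) <=
   8 / q%:R * (16 * (`|t| / q%:R) + 16 * H%:R * (`|t| / q%:R)) +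
   `|t|^-1 * ((8 * (`|t| / q%:R)) ^+ 2 + (8 * (`|t| / q%:R)) ^+ 3).
  rewrite -Normc.normcM key; apply: le_trans (ncB _ _) _.
  rewrite (Normc.normcM u) (Normc.normcM _ e); apply: lerD; apply: ler_pM; rewrite ?nc_ge0 //.
    apply: le_trans (ncD _ _) _; apply: lerD => //; rewrite Normc.normcM.
    by apply: le_trans zl; rewrite ler_piMl ?nc_ge0.
  by rewrite nc_real normfV.
set B := (X in _ <= X) => HB.
rewrite -(ler_pM2r (_ : 0 < 2 * `|t| / q%:R)); last by rewrite divr_gt0 // mulr_gt0.
apply: (@le_trans _ _ B).
  by apply: le_trans HB; rewrite ler_wpM2l ?nc_ge0.
have s2 : `|t| / q%:R <= 1 / 2 by rewrite ler_pdivrMr // mulrC; move: tq; lra.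
set s := `|t| / q%:R in s2 B HB *.
have s0 : 0 <= s by rewrite divr_ge0.
(* As H >= 1 and s <= 1/2, the bracket is at most 576 H; the constant 300 is half of the rounded
   value 600. *)
have BE : B = s / q%:R * (128 + 128 * H%:R + 64 + 512 * s).
  by rewrite /B /s; field; rewrite !lt0r_neq0.
rewrite BE (_ : 300 * H%:R / q%:R * _ = s / q%:R * (600 * H%:R)); last first.
  by rewrite /s; field; rewrite !lt0r_neq0.
by rewrite ler_wpM2l ?divr_ge0 //; lra.
Qed.

End CoefBounds.

End Smoothing.

Section Polynomials.
Context (R : realType).

(** The frequencies n and -n are paired, with coefficients [cp n] and [cm n]; [s] stands for the
    value at -1. *)
Definition pol (cp cm : nat -> R[i]) (s : R[i]) (Y : nat -> R[i]) (a b : nat) (al : R) :=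
  \sum_(a.+1 <= n < b.+1) Y n *
    (cp n * (1 - cis1 (n%:R * al)) + s * (cm n * (1 - cis1 (- (n%:R * al))))).

Lemma shift_sum_dist (u : nat -> R[i]) (x h : nat) : (forall n, nc (u n) <= 1) ->
  nc (\sum_(1 <= n < x.+1) u n - \sum_(1 <= n < x.+1) u (n + h)%N) <= 2 * h%:R.
Proof.
move=> u1; elim: h => [|h IH].
  by under [X in _ - X]eq_bigr do rewrite addn0; rewrite subrr nc0 mulr0.
apply: le_trans (nc_dist_trans _ (\sum_(1 <= n < x.+1) u (n + h)%N) _) _.
rewrite -[h.+1]addn1 natrD mulrDr mulr1; apply: lerD IH _.
rewrite nc_distC -sumrB.
rewrite (@telescope_sumr_eq _ 1 x.+1 (fun n => u (n + h)%N)) //; last first.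
  by move=> n _; rewrite addn1 addnS addSn.
by apply: le_trans (ncB _ _) _; rewrite -[2]/(1 + 1) lerD.
Qed.

End Polynomials.

Section SmoothedPolya.
Context (R : realType) (q : nat) (q_pr : prime q) (q_odd : odd q).
Local Notation chi := (@Fchar R q q_pr).
Local Notation dch := (@dchar R q q_pr).

Definition cpq (H n : nat) : R[i] := if (n <= q./2)%N then cf q H n%:R else 0.
Definition cmq (H n : nat) : R[i] := if (n <= q./2)%N then cf q H (- n%:R) else 0.

Lemma half_bounds (n : nat) : (0 < n <= q./2)%N -> 1 <= `|n%:R : R| /\ `|n%:R : R| <= q%:R / 2.
Proof.
move=> /andP[n0 nq]; rewrite ger0_norm // ler1n n0; split=> //.
rewrite ler_pdivlMr // -natrM ler_nat muln2.
by rewrite -(odd_double_half q) q_odd (leq_trans _ (leqnSn _)) // leq_double.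
Qed.

Lemma psi_nat_cis (n : nat) : psi R (n%:R : 'F_q) = cis1 (n%:R / q%:R).
Proof. exact: psi_nat. Qed.

Lemma psiN_nat_cis (n : nat) : psi R (- n%:R : 'F_q) = cis1 (- n%:R / q%:R).
Proof. by rewrite psiN // psi_nat_cis mulNr cis1N. Qed.

(** The Gauss sum turns each conjugate character value into a combination of additive characters,
    for which the shift [h] and the variable [n] separate; the shifts add up to [fejer]. *)
Lemma average_gauss k (H x : nat) : (0 < k < q.-1)%N ->
  (H%:R^-1 * \sum_(0 <= h < H) \sum_(1 <= n < x.+1) dch k (n + h)%N%:Z)^*%C * gauss R q_pr k 1 =
  \sum_b chi k b * (fejer H (psi R b) * \sum_(1 <= n < x.+1) psi R b ^+ n).
Proof.
move=> kq; rewrite rmorphM /= conjc_inv conjc_nat -mulrA conjc_sum mulr_suml.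
transitivity (H%:R^-1 * \sum_(0 <= h < H) \sum_(1 <= n < x.+1)
    \sum_b chi k b * psi R b ^+ (n + h)).
  congr (_ * _); apply: eq_bigr => h _; rewrite conjc_sum mulr_suml.
  apply: eq_bigr => n _; rewrite dchar_nat -gaussE //.
  by apply: eq_bigr => b _; rewrite psiMn.
transitivity (\sum_(0 <= h < H) \sum_b H%:R^-1 *
    \sum_(1 <= n < x.+1) chi k b * psi R b ^+ (n + h)).
  by rewrite mulr_sumr; apply: eq_bigr => h _; rewrite exchange_big /= mulr_sumr.
rewrite exchange_big /=; apply: eq_bigr => b _.
rewrite /fejer; set B := \sum_(1 <= n < x.+1) psi R b ^+ n.
have -> : chi k b * (H%:R^-1 * (\sum_(0 <= h < H) psi R b ^+ h) * B) =
    \sum_(0 <= h < H) H%:R^-1 * (chi k b * (psi R b ^+ h * B)).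
  by rewrite -!mulr_sumr -mulr_suml; ring.
apply: eq_bigr => h _; congr (_ * _).
by rewrite /B !mulr_sumr; apply: eq_bigr => n _; rewrite exprD; ring.
Qed.

(** On the finite field the Fourier expansion of the averaged sum is an exact identity over
    frequencies up to q/2. The error is only the cost 2 H of averaging, times 2 pi / sqrt q. *)
Lemma smoothed_polya k (H x : nat) : (0 < k < q.-1)%N -> (0 < H)%N ->
  `|2 * pi / Num.sqrt q%:R * nc (\sum_(1 <= n < x.+1) dch k n%:Z) -
    nc (pol (cpq H) (cmq H) (dch k (-1)) (fun n => dch k n%:Z) 0 q./2 (x%:R / q%:R))|
  <= 4 * pi * H%:R / Num.sqrt q%:R.
Proof.
move=> kq H0.
have q0 := prime_gt0 q_pr.
have qR : 0 < q%:R :> R by rewrite ltr0n.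
have sq0 : 0 < Num.sqrt q%:R :> R by rewrite sqrtr_gt0.
have HR : 0 < H%:R :> R by rewrite ltr0n.
have pi0 := pi_ge0 R.
pose u n := dch k n%:Z; have u1 n : nc (u n) <= 1.
  by rewrite /u /dchar nc_Fchar lern1 leq_b1.
set T := \sum_(1 <= n < x.+1) _; set Q := pol _ _ _ _ _ _ _.
pose avg := H%:R^-1 * \sum_(0 <= h < H) \sum_(1 <= n < x.+1) u (n + h)%N.
have Tavg : nc (T - avg) <= 2 * H%:R.
  have -> : T - avg = H%:R^-1 * \sum_(0 <= h < H) (T - \sum_(1 <= n < x.+1) u (n + h)%N).
    rewrite sumrB sumr_const_nat subn0 mulrBr -[T *+ H]mulr_natl mulKf //.
    by rewrite pnatr_eq0 -lt0n.
  rewrite Normc.normcM Normc.normcV nc_nat mulrC ler_pdivrMr //.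
  apply: le_trans (nc_sum _ _ _) _.
  apply: (@le_trans _ _ (\sum_(0 <= h < H) 2 * H%:R)).
    rewrite !big_nat; apply: ler_sum => h /andP[_ hH].
    apply: le_trans (shift_sum_dist _ _ u1) _.
    by rewrite ler_pM2l // ler_nat ltnW.
  by rewrite sumr_const_nat subn0 [leRHS]mulr_natr.
have E := average_gauss H x kq; rewrite -/avg in E.
have Qavg : nc Q = 2 * pi / Num.sqrt q%:R * nc avg.
  have -> : 2 * pi / Num.sqrt q%:R * nc avg =
     2 * pi / q%:R * (nc avg * Num.sqrt q%:R).
    rewrite -{2}(sqr_sqrtr (ltW qR)) expr2; field.
    by rewrite lt0r_neq0.
  rewrite -(nc_gauss R q_pr kq) -(nc_conj avg) -Normc.normcM E.
  have c0 : 0 <= 2 * pi / q%:R :> R by rewrite divr_ge0 ?mulr_ge0.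
  rewrite -{1}(ger0_norm c0) -nc_real -Normc.normcM.
  (* A phase of modulus 1 has to be adjusted: [cf] carries a factor i, and [pol] has 1 - e(.) where
     the geometric sum has e(.) - 1. *)
  have nI z : nc z = nc ('i%C * z) :> R by rewrite Normc.normcM nc_i mul1r.
  rewrite [RHS]nI -ncN; congr nc.
  rewrite (sum_Fq_half q_pr) //; last by rewrite Fchar0 mul0r.
  rewrite /Q /pol -sumrN mulrA mulr_sumr !big_nat; apply: eq_bigr => n /andP[n1 nh].
  rewrite ltnS in nh; have nb : (0 < n <= q./2)%N by rewrite n1.
  have [b1 b2] := half_bounds nb.
  rewrite /cpq /cmq nh /cf dchar_nat.
  have -> : chi k (- n%:R) = dch k (-1) * chi k n%:R.
    by rewrite /dchar -FcharM mulrN1z mulN1r.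
  rewrite psi_nat_cis psiN_nat_cis !geom_sum; first last.
  - by apply: (cis1_neq1 q0 b1 b2).
  - by apply: (@cis1_neq1 R q (- n%:R) q0); rewrite normrN.
  rewrite -!cis1Mn.
  have -> : x%:R * (n%:R / q%:R) = n%:R * (x%:R / q%:R) :> R by ring.
  have -> : x%:R * (- n%:R / q%:R) = - (n%:R * (x%:R / q%:R)) :> R by ring.
  rewrite /cfz.
  move: (cis1 (n%:R * (x%:R / q%:R))) (cis1 (- (n%:R * (x%:R / q%:R)))) => e1 e2.
  by ring.
have c1 : 0 <= 2 * pi / Num.sqrt q%:R :> R by rewrite divr_ge0 ?mulr_ge0 ?(ltW sq0).
rewrite Qavg -mulrBr normrM ger0_norm //.
apply: (@le_trans _ _ (2 * pi / Num.sqrt q%:R * (2 * H%:R))).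
  rewrite ler_wpM2l ?divr_ge0 ?mulr_ge0 ?(ltW sq0) //.
  exact: le_trans (nc_dist_dist _ _) Tavg.
by rewrite le_eqVlt; apply/orP; left; apply/eqP; ring.
Qed.

End SmoothedPolya.

(** * Trigonometric polynomials block by block *)

Section PolBounds.
Context (R : realType).
Implicit Types (cp cm Y : nat -> R[i]) (s : R[i]) (al : R).

Lemma pol_cat cp cm s Y al (a b c : nat) : (a <= b <= c)%N ->
  pol cp cm s Y a c al = pol cp cm s Y a b al + pol cp cm s Y b c al.
Proof. by move=> /andP[ab bc]; rewrite /pol (@big_cat_nat _ _ _ b.+1). Qed.

(** Replacing -al by 1 - al keeps the parameter in [0, 1], where [bad] is tested. On a good block
    each of the four sums is then below the threshold. *)
Lemma pol_tsum cp cm s Y (a b : nat) al : pol cp cm s Y a b al =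
  (tsum cp Y a b 0 - tsum cp Y a b al) + s * (tsum cm Y a b 0 - tsum cm Y a b (1 - al)).
Proof.
rewrite /pol /tsum -!sumrB mulr_sumr -big_split /=; apply: eq_bigr => n _.
have -> : n%:R * (1 - al) = - (n%:R * al) + n%:R :> R by ring.
by rewrite cis1Dn mulr0 cis10; ring.
Qed.

Lemma pol_abs_le cp cm s Y (a b : nat) al : nc s <= 1 -> (forall n, nc (Y n) <= 1) ->
  nc (pol cp cm s Y a b al) <= \sum_(a.+1 <= n < b.+1) 2 * (nc (cp n) + nc (cm n)).
Proof.
move=> s1 Y1; apply: le_trans (nc_sum _ _ _) _; apply: ler_sum => n _.
have d x : nc (1 - cis1 x) <= 2 :> R.
  by apply: le_trans (ncB _ _) _; rewrite nc1 nc_cis1.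
rewrite Normc.normcM; apply: le_trans (ler_piMl (nc_ge0 _) (Y1 n)) _.
apply: le_trans (ncD _ _) _; rewrite [leRHS]mulrDr; apply: lerD.
  by rewrite Normc.normcM mulrC ler_wpM2r ?nc_ge0.
rewrite Normc.normcM; apply: le_trans (ler_piMl (nc_ge0 _) s1) _.
by rewrite Normc.normcM mulrC ler_wpM2r ?nc_ge0.
Qed.

Lemma pol_coefB cp cm cp' cm' s Y (a b : nat) al :
  pol cp cm s Y a b al - pol cp' cm' s Y a b al =
  pol (fun n => cp n - cp' n) (fun n => cm n - cm' n) s Y a b al.
Proof. by rewrite /pol -sumrB; apply: eq_bigr => n _; ring. Qed.

Lemma tsum_not_bad c Y (j : nat) (th al : R) : ~ bad c Y j th -> 0 <= al <= 1 ->
  nc (tsum c Y (j ^ 20) (j.+1 ^ 20) al) <= th / (j * j.+1)%N%:R.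
Proof. by move=> nb al01; rewrite leNgt; apply/negP => lt; apply: nb; exists al. Qed.

Lemma pol_block_le cp cm s Y (j : nat) (th al : R) : nc s <= 1 -> 0 <= al <= 1 ->
  ~ bad cp Y j th -> ~ bad cm Y j th ->
  nc (pol cp cm s Y (j ^ 20) (j.+1 ^ 20) al) <= 4 * th / (j * j.+1)%N%:R.
Proof.
move=> s1 al01 nbp nbm; rewrite pol_tsum.
have z01 : ((0 : R) <= 0) && ((0 : R) <= 1) by rewrite lexx ler01.
have al01' : 0 <= 1 - al <= 1 by move/andP: al01 => [? ?]; apply/andP; lra.
have p0 := tsum_not_bad nbp z01; have p1 := tsum_not_bad nbp al01.
have m0 := tsum_not_bad nbm z01; have m1 := tsum_not_bad nbm al01'.
apply: le_trans (ncD _ _) _; rewrite Normc.normcM.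
have := ncB (tsum cp Y (j ^ 20) (j.+1 ^ 20) 0) (tsum cp Y (j ^ 20) (j.+1 ^ 20) al).
have := ncB (tsum cm Y (j ^ 20) (j.+1 ^ 20) 0) (tsum cm Y (j ^ 20) (j.+1 ^ 20) (1 - al)).
have := ler_piMl (nc_ge0 (tsum cm Y (j ^ 20) (j.+1 ^ 20) 0 -
  tsum cm Y (j ^ 20) (j.+1 ^ 20) (1 - al))) s1.
rewrite -mulrA; set d := th / _ in p0 p1 m0 m1 *.
by lra.
Qed.

Lemma sum_inv_consecutive (J K : nat) : (0 < J)%N -> (J <= K)%N ->
  \sum_(J <= j < K) ((j * j.+1)%N%:R : R)^-1 = J%:R^-1 - K%:R^-1.
Proof.
move=> J0 JK; rewrite (@telescope_sumr_eq _ J K (fun j => - (j%:R)^-1)) //.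
  by rewrite opprK addrC.
move=> j /andP[Jj _]; have j0 : j%:R != 0 :> R by rewrite pnatr_eq0 -lt0n (leq_trans J0).
rewrite natrM -[j.+1]addn1 natrD; field.
by rewrite j0 natr1 pnatr_eq0.
Qed.

Lemma pol_blocks_le cp cm s Y (J K : nat) (th al : R) : nc s <= 1 -> 0 <= al <= 1 ->
  (0 < J)%N -> (J <= K)%N -> 0 <= th ->
  (forall j, (J <= j < K)%N -> ~ bad cp Y j th /\ ~ bad cm Y j th) ->
  nc (pol cp cm s Y (J ^ 20) (K ^ 20) al) <= 4 * th / J%:R.
Proof.
move=> s1 al01 J0 JK th0 good.
apply: (@le_trans _ _ (\sum_(J <= j < K) 4 * th / (j * j.+1)%N%:R)); last first.
  rewrite -mulr_sumr sum_inv_consecutive // ler_wpM2l ?mulr_ge0 //.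
  by rewrite gerBl invr_ge0.
elim: K JK good => [|K IH] JK good.
  by move: JK J0; case: (J).
have [JK'|JK'] := leqP J K; last first.
  have -> : J = K.+1 by apply/eqP; rewrite eqn_leq JK.
  by rewrite /pol !big_geq // nc0.
rewrite (pol_cat _ _ _ _ _ (b := K ^ 20)) ?leq_exp2r ?JK' ?leqnSn //.
apply: le_trans (ncD _ _) _; rewrite big_nat_recr //=; apply: lerD.
  by apply: IH => // j /andP[Jj jK]; apply: good; rewrite Jj ltnW.
by have [|b1 b2] := good K; [rewrite JK' /=|exact: pol_block_le].
Qed.

Lemma sum_inv_sqr_le (a b : nat) : (0 < a)%N ->
  \sum_(a.+1 <= n < b.+1) (n%:R ^- 2 : R) <= a%:R^-1.
Proof.
move=> a0; have [ab|ab] := leqP a.+1 b.+1; last first.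
  by rewrite big_geq ?invr_ge0 // ltnW.
apply: (@le_trans _ _ (\sum_(a <= j < b) ((j * j.+1)%N%:R : R)^-1)).
  rewrite big_add1 /= !big_nat; apply: ler_sum => n /andP[an _].
  have n0 : (0 < n)%N by rewrite (leq_trans a0).
  rewrite lef_pV2 ?posrE ?exprn_gt0 ?ltr0n ?muln_gt0 ?n0 //.
  by rewrite -natrX ler_nat expnS expn1 leq_mul.
by rewrite sum_inv_consecutive // gerBl invr_ge0.
Qed.

Lemma pow_root_exists (e q : nat) : (0 < e)%N -> exists K, (K ^ e <= q < K.+1 ^ e)%N.
Proof.
move=> e0; elim: q => [|q [K /andP[h1 h2]]]; first by exists 0%N; rewrite exp0n // exp1n.
have [h|h] := ltnP q.+1 (K.+1 ^ e); first by exists K; rewrite h (leq_trans h1).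
by exists K.+1; rewrite h /= (leq_ltn_trans h2) // ltn_exp2r.
Qed.

(** The series for [S] cut at |n| <= N: the minus sign in the second coefficient is that of the
    denominator -n. *)
Definition polS (s : R[i]) Y (N : nat) al : R[i] :=
  pol (fun n => n%:R^-1) (fun n => - n%:R^-1) s Y 0 N al.

End PolBounds.

(** * Character sums against the truncated series *)

Section CharacterTail.
Context (R : realType).

Definition char_sum_dev (q : nat) (q_pr : prime q) (k N x : nat) : R :=
  `|2 * pi / Num.sqrt q%:R * nc (\sum_(1 <= n < x.+1) dchar R q_pr k n%:Z) -
    nc (polS (dchar R q_pr k (-1)) (fun n => dchar R q_pr k n%:Z) N (x%:R / q%:R))|.

Lemma four_pi_le16 : 4 * pi <= 16 :> R.
Proof. by have := pi_lt4 R; lra. Qed.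

(* With [K] of size [q ^ (1/34)], smoothing over [H = K ^ 16] shifts costs
   [H / sqrt q <= 1 / K] and leaves a tail [O(q / (H * K ^ 20)) = O(1 / K)] beyond
   frequency [K ^ 20]; below it, the second moment of the characters over products
   [n <= K ^ 40] is at most [K ^ 6 + 1] times the diagonal. *)
Section FixedModulus.
Context (q : nat) (q_pr : prime q) (q_odd : odd q) (J K : nat) (J0 : (0 < J)%N)
  (JK : (J < K)%N) (Kq : (K ^ 34 <= q < K.+1 ^ 34)%N).
Local Notation dch := (@dchar R q q_pr).
Local Notation H := (K ^ 16)%N.

Let K1 : (1 < K)%N. Proof. exact: leq_ltn_trans JK. Qed.
Let K0 : (0 < K)%N. Proof. exact: ltnW K1. Qed.
Let H0 : (0 < H)%N. Proof. by rewrite expn_gt0 K0. Qed.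
Let KR : 0 < K%:R :> R. Proof. by rewrite ltr0n. Qed.
Let q0 : (0 < q)%N. Proof. exact: prime_gt0. Qed.
Let qR : 0 < q%:R :> R. Proof. by rewrite ltr0n. Qed.

Lemma K20_half : (K ^ 20 <= q./2)%N.
Proof.
rewrite -leq_double -(leq_add2l (odd q)) odd_double_half q_odd -muln2.
apply: leq_trans (proj1 (andP Kq)); rewrite -[34%N]/(20 + 14)%N expnD.
apply: (@leq_trans (K ^ 20 * 2 ^ 2)%N).
  by rewrite -[(2 ^ 2)%N]/(2 + 2)%N mulnDr addnC leq_add2l muln_gt0 expn_gt0 K0.
rewrite leq_mul2l; apply/orP; right.
by apply: (@leq_trans (K ^ 2)%N); rewrite ?leq_exp2r // leq_exp2l.
Qed.

Lemma H_div_q : H%:R / q%:R <= K%:R^-1 :> R.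
Proof.
rewrite ler_pdivrMr // mulrC ler_pdivlMr // -natrM ler_nat -expnSr.
by apply: leq_trans (proj1 (andP Kq)); rewrite leq_exp2l.
Qed.

Lemma H_div_sqrt : H%:R / Num.sqrt q%:R <= K%:R^-1 :> R.
Proof.
have s0 : 0 < Num.sqrt q%:R :> R by rewrite sqrtr_gt0.
rewrite ler_pdivrMr // mulrC ler_pdivlMr // -natrM -expnSr.
rewrite -[leLHS](ger0_norm (ler0n R _)) -sqrtr_sqr ler_wsqrtr //.
by rewrite -natrX ler_nat -expnM (proj1 (andP Kq)).
Qed.

Lemma q_div_HK : q%:R / (H%:R * (K ^ 20)%N%:R) <= 2 ^+ 34 / K%:R :> R.
Proof.
rewrite -natrM -expnD ler_pdivrMr ?ltr0n ?expn_gt0 ?K0 //.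
rewrite mulrAC ler_pdivlMr //.
apply: (@le_trans _ _ ((K.+1 ^ 34)%N%:R * K%:R)).
  by rewrite ler_pM2r // ler_nat ltnW // (proj2 (andP Kq)).
apply: (@le_trans _ _ (((2 * K) ^ 34)%N%:R * K%:R)).
  by rewrite ler_pM2r // ler_nat leq_exp2r // mul2n -addnn -addn1 leq_add2l.
rewrite -natrX -!natrM ler_nat expnMn -mulnA leq_mul2l; apply/orP; right.
by rewrite -expnSr leq_exp2l.
Qed.

Lemma cpq_le n : (0 < n)%N -> nc (cpq R q H n) <= 4 / n%:R.
Proof.
move=> n0; rewrite /cpq; case: ifP => nq; last by rewrite nc0 divr_ge0.
have [b1 b2] := half_bounds R q_odd (introT andP (conj n0 nq)).
by have := cf_le H q0 b1 b2; rewrite ger0_norm.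
Qed.

Lemma cmq_le n : (0 < n)%N -> nc (cmq R q H n) <= 4 / n%:R.
Proof.
move=> n0; rewrite /cmq; case: ifP => nq; last by rewrite nc0 divr_ge0.
have [b1 b2] := half_bounds R q_odd (introT andP (conj n0 nq)).
have := @cf_le R q H (- n%:R) q0; rewrite normrN => /(_ b1 b2).
by rewrite ger0_norm.
Qed.

(** Three ranges of frequencies: up to J^20 the coefficients are replaced by those of [polS], at a
    cost 2 (300 + 300) / K per term; from J^20 to K^20 the blocks are good; beyond K^20 the
    quadratic decay allows absolute values. Smoothing itself costs 16 / K. *)
Lemma char_dev_good k x : (0 < k < q.-1)%N -> (x <= q)%N ->
  (forall j, (J <= j < K)%N -> ~ bad (cpq R q H) (fun n => dch k n%:Z) j 2^-1 /\
      ~ bad (cmq R q H) (fun n => dch k n%:Z) j 2^-1) ->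
  char_sum_dev q_pr k (J ^ 20) x <=
   (16 + 1200 * (J ^ 20)%N%:R + 16 * 2 ^+ 34) / K%:R + 2 / J%:R.
Proof.
move=> kq xq good; have := q_div_HK; move: (2 ^+ 34) => A Q.
set Y := fun n : nat => dch k n%:Z; set s := dch k (-1); set al : R := x%:R / q%:R.
have s1 : nc s <= 1 by rewrite /s /dchar nc_Fchar lern1 leq_b1.
have Y1 n : nc (Y n) <= 1 by rewrite /Y /dchar nc_Fchar lern1 leq_b1.
have al01 : 0 <= al <= 1 by rewrite divr_ge0 //= ler_pdivrMr // mul1r ler_nat.
have sm := smoothed_polya R q_pr q_odd x kq H0; rewrite -/Y -/s -/al in sm.
pose P := pol (cpq R q H) (cmq R q H) s Y.
have split1 : P 0 q./2 al = P 0 (J ^ 20)%N al + P (J ^ 20)%N (K ^ 20)%N al + P (K ^ 20)%N q./2 al.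
  rewrite /P -pol_cat; last by rewrite leq0n leq_exp2r // ltnW.
  by rewrite -pol_cat // leq0n K20_half.
have main : nc (P 0 (J ^ 20)%N al - polS s Y (J ^ 20) al) <= 1200 * (J ^ 20)%N%:R / K%:R.
  rewrite /P /polS pol_coefB; apply: le_trans (pol_abs_le _ _ _ _ _ s1 Y1) _.
  apply: (@le_trans _ _ (\sum_(1 <= n < (J ^ 20).+1) 1200 / K%:R)); last first.
    by rewrite sumr_const_nat subSS subn0 -[leLHS]mulr_natr mulrAC.
  rewrite !big_nat; apply: ler_sum => n /andP[n0 nJ].
  have nq : (n <= q./2)%N.
    rewrite ltnS in nJ; apply: leq_trans K20_half; apply: leq_trans nJ _.
    by rewrite leq_exp2r // ltnW.
  rewrite /cpq /cmq nq.
  have [b1 b2] := half_bounds R q_odd (introT andP (conj n0 nq)).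
  have a1 := cf_approx q0 H0 b1 b2.
  have := @cf_approx R q H (- n%:R) q0 H0; rewrite normrN => /(_ b1 b2) a2.
  have e1 : (n%:R^-1 : R)%:C%C = n%:R^-1 :> R[i] by rewrite fmorphV /= rmorph_nat.
  have e2 : ((- n%:R)^-1 : R)%:C%C = - n%:R^-1 :> R[i].
    by rewrite invrN rmorphN /= e1.
  rewrite e1 in a1; rewrite e2 in a2.
  have := H_div_q; move: a1 a2; rewrite -!mulrA.
  by move: (_ / _) (_^-1) => u v; lra.
have mid : nc (P (J ^ 20)%N (K ^ 20)%N al) <= 2 / J%:R.
  rewrite (_ : 2 = 4 * 2^-1); last by lra.
  by apply: pol_blocks_le => //; exact: ltnW.
have tail : nc (P (K ^ 20)%N q./2 al) <= 16 * A / K%:R.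
  apply: le_trans (pol_abs_le _ _ _ _ _ s1 Y1) _.
  apply: (@le_trans _ _ (\sum_((K ^ 20).+1 <= n < (q./2).+1)
     (16 * (q%:R / H%:R)) * n%:R ^- 2)).
    rewrite !big_nat; apply: ler_sum => n /andP[Kn nq]; rewrite ltnS in nq.
    have n0 : (0 < n)%N by apply: leq_ltn_trans Kn.
    have [b1 b2] := half_bounds R q_odd (introT andP (conj n0 nq)).
    rewrite /cpq /cmq nq; have a1 := cf_decay q0 H0 b1 b2.
    have := @cf_decay R q H (- n%:R) q0 H0; rewrite normrN => /(_ b1 b2) a2.
    rewrite ger0_norm // in a1 a2.
    have e : 4 * q%:R / (H%:R * n%:R ^+ 2) = 4 * (q%:R / H%:R * n%:R ^- 2) :> R.
      by rewrite invfM; ring.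
    rewrite e in a1 a2; rewrite -[leRHS]mulrA; move: a1 a2.
    by move: (q%:R / H%:R * _) => u; lra.
  rewrite -mulr_sumr.
  have S := sum_inv_sqr_le R q./2 (_ : 0 < K ^ 20)%N; rewrite expn_gt0 K0 in S.
  apply: (@le_trans _ _ (16 * (q%:R / H%:R) * (K ^ 20)%N%:R^-1)).
    by rewrite ler_wpM2l ?S // mulr_ge0 // divr_ge0.
  rewrite invfM mulrA in Q.
  by rewrite -[leLHS]mulrA -[leRHS]mulrA ler_pM2l.
have dP : `|nc (P 0 q./2 al) - nc (polS s Y (J ^ 20) al)| <=
    1200 * (J ^ 20)%N%:R / K%:R + 2 / J%:R + 16 * A / K%:R.
  apply: le_trans (nc_dist_dist _ _) _; rewrite split1 addrAC.
  apply: le_trans (ncD _ _) _; apply: lerD => //; rewrite addrAC.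
  by apply: le_trans (ncD _ _) _; apply: lerD.
rewrite /char_sum_dev; apply: le_trans (ler_distD (nc (P 0 q./2 al)) _ _) _.
apply: le_trans (lerD sm dP) _.
have h16 : 4 * pi * H%:R / Num.sqrt q%:R <= 16 / K%:R :> R.
  rewrite -mulrA; apply: ler_pM => //.
  - by rewrite mulr_ge0 // pi_ge0.
  - exact: four_pi_le16.
  - exact: H_div_sqrt.
have e (a b c d : R) : (a + b + c) / d = a / d + b / d + c / d by ring.
rewrite e; move: h16.
by move: (_ / _) (_ / _) (_ / _) (_ / _) (_ / _) => u v w y z; lra.
Qed.

End FixedModulus.

Lemma nc_dchar_le1 (q : nat) (q_pr : prime q) k n : nc (dchar R q_pr k n) <= 1.
Proof. by rewrite /dchar nc_Fchar lern1 leq_b1. Qed.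

Lemma dchar_natM (q : nat) (q_pr : prime q) k (m n : nat) :
  dchar R q_pr k (m * n)%N%:Z = dchar R q_pr k m%:Z * dchar R q_pr k n%:Z.
Proof. by rewrite PoszM; have [-> _ _] := dchar_dirichlet R q_pr k. Qed.

(** The cut [J] depends on [eps] alone. Only then is [q] taken large, so that K makes [M / K] small
    although [M] grows with J. All blocks from J to K together lose a proportion at most 2 C / J. *)
Lemma char_approx (eps : R) : 0 < eps -> exists J0 : nat, forall J, (J0 <= J)%N ->
  exists q0 : nat, forall (q : nat) (q_pr : prime q), (q0 <= q)%N ->
  cnt R (fun k : 'I_q.-1 => (0 < k)%N /\
    exists2 x, (x <= q)%N & eps < char_sum_dev q_pr k (J ^ 20) x) <= eps * q.-1%:R.
Proof.
move=> eps0; have [C C0 Cbad] := bad_block R.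
have C1 : 0 <= 2 * C / eps + 4 / eps.
  by rewrite addr_ge0 // divr_ge0 ?mulr_ge0 ?(ltW C0) // ltW.
exists (Num.truncn (2 * C / eps + 4 / eps)).+1 => J JJ.
have J0 : (0 < J)%N by apply: leq_ltn_trans JJ.
have JR : 0 < J%:R :> R by rewrite ltr0n.
have Jb : 2 * C + 4 <= eps * J%:R.
  have /andP[_ h] := truncn_itv C1.
  have : 2 * C / eps + 4 / eps <= J%:R by apply: le_trans (ltW h) _; rewrite ler_nat.
  by rewrite -mulrDl ler_pdivrMr // (mulrC eps).
pose M : R := 16 + 1200 * (J ^ 20)%N%:R + 16 * 2 ^+ 34.
have M0 : 0 <= 2 * M / eps.
  rewrite divr_ge0 ?(ltW eps0) // mulr_ge0 // /M.
  have := ler0n R (J ^ 20); have : 0 <= 2 ^+ 34 :> R by exact: exprn_ge0.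
  by move: (2 ^+ 34) => A; lra.
pose K0 := maxn J.+1 (Num.truncn (2 * M / eps)).+1.
exists (maxn 3 (K0 ^ 34)) => q q_pr; rewrite geq_max => /andP[q3 qK0].
have q_odd : odd q by have [q2|//] := even_prime q_pr; move: q3; rewrite q2.
have [K Kq] := pow_root_exists q (isT : (0 < 34)%N).
have K0K : (K0 <= K)%N.
  have /andP[_ h] := Kq; have := leq_ltn_trans qK0 h.
  by rewrite ltn_exp2r // ltnS.
have JK : (J < K)%N by apply: leq_trans K0K; rewrite leq_max leqnn.
have KR : 0 < K%:R :> R by rewrite ltr0n (leq_ltn_trans _ JK).
have MK : M / K%:R <= eps / 2.
  have /andP[_ h] := truncn_itv M0.
  have : 2 * M / eps <= K%:R.
    apply: le_trans (ltW h) _; rewrite ler_nat; apply: leq_trans K0K.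
    by rewrite leq_max leqnn orbT.
  rewrite !ler_pdivrMr // => h2; rewrite mulrAC ler_pdivlMr //; lra.
have J2 : 2 / J%:R <= eps / 2 by rewrite ler_pdivrMr //; lra.
pose Y (k : 'I_q.-1) (n : nat) := dchar R q_pr k n%:Z.
have badle c j : (forall n, (0 < n)%N -> nc (c n) <= 4 / n%:R) -> (J <= j < K)%N ->
    cnt R (fun k => bad c (Y k) j 2^-1) <= C / (j * j.+1)%N%:R * q.-1%:R.
  move=> cle /andP[Jj jK]; have j0 : (0 < j)%N by apply: leq_trans Jj.
  have q0 := prime_gt0 q_pr; have qR : 0 < q%:R :> R by rewrite ltr0n.
  rewrite -[X in _ * X%:R](card_ord q.-1).
  apply: (Cbad _ Y c j ((j.+1 ^ 20 * j.+1 ^ 20)%N%:R / q%:R + 1)) => //.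
  - by move=> k m n _ _; exact: dchar_natM.
  - by move=> k n; exact: nc_dchar_le1.
  - exact: dchar_second_moment.
  (* Products of two integers up to (j+1)^20 may exceed q, but at most by a factor (j+1)^6, because
     j + 1 <= K and K^34 <= q. *)
  have l0 : 0 <= (j.+1 ^ 20 * j.+1 ^ 20)%N%:R / q%:R :> R.
    exact: divr_ge0 (ler0n _ _) (ler0n _ _).
  have j6 : 1 <= j.+1%:R ^+ 6 :> R by rewrite exprn_ege1 // ler1n.
  suff : (j.+1 ^ 20 * j.+1 ^ 20)%N%:R / q%:R <= j.+1%:R ^+ 6 :> R.
    by move: (_ / _) (_ ^+ _) l0 j6 => u v *; apply/andP; lra.
  rewrite ler_pdivrMr // -natrX -natrM ler_nat -expnD.
  apply: (@leq_trans (j.+1 ^ 6 * K ^ 34)%N).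
    by rewrite -[(20 + 20)%N]/(6 + 34)%N expnD leq_mul2l leq_exp2r // jK orbT.
  by rewrite leq_mul2l (proj1 (andP Kq)) orbT.
apply: (@le_trans _ _ (\sum_(J <= j < K) 2 * C / (j * j.+1)%N%:R * q.-1%:R)).
  apply: (@le_trans _ _ (\sum_(J <= j < K) cnt R (fun k =>
      bad (cpq R q (K ^ 16)) (Y k) j 2^-1 \/ bad (cmq R q (K ^ 16)) (Y k) j 2^-1))).
    apply: le_trans (cnt_bigcup R J K _); apply: cnt_le => k [k0 [x xq dev]].
    apply: contrapT => nobad; move: dev; apply/negP; rewrite -leNgt.
    apply: le_trans (char_dev_good q_odd J0 JK Kq _ xq _) _; rewrite ?k0 ?ltn_ord //.
      move=> j jJK; split=> b; apply: nobad; exists j => //; first by left.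
      by right.
    by rewrite -/M; lra.
  rewrite !big_nat; apply: ler_sum => j jJK.
  apply: le_trans (cnt_or _ _ _) _.
  have h1 := badle _ _ (cpq_le q_pr q_odd K) jJK.
  have h2 := badle _ _ (cmq_le q_pr q_odd K) jJK.
  by apply: le_trans (lerD h1 h2) _; rewrite le_eqVlt; apply/orP; left; apply/eqP; ring.
rewrite -mulr_suml -mulr_sumr sum_inv_consecutive ?(ltnW JK) // ler_wpM2r //.
apply: (@le_trans _ _ (2 * C * J%:R^-1)).
  by rewrite ler_wpM2l ?mulr_ge0 ?(ltW C0) // gerBl invr_ge0.
by rewrite ler_pdivrMr //; lra.
Qed.

End CharacterTail.

(** * The discrete model *)

Section DiscreteModel.
Context (R : realType).

Definition pidx (N : nat) : finType := {p : 'I_N.+1 | p \in [pred i : 'I_N.+1 | prime i]}.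

Definition pidx_val (N : nat) (x : pidx N) : nat := val (val x).

Lemma pidx_prime N (x : pidx N) : prime (pidx_val x).
Proof. by case: x => p pp; have := pp; rewrite inE. Qed.

Lemma pidx_le N (x : pidx N) : (pidx_val x <= N)%N.
Proof. by rewrite -ltnS; apply: ltn_ord. Qed.

Lemma pidx_val_inj N : injective (@pidx_val N).
Proof. by move=> x y /val_inj/val_inj. Qed.

Lemma pidx_surj N p : prime p -> (p <= N)%N -> exists x : pidx N, pidx_val x = p.
Proof.
move=> pp pN; have pN1 : (p < N.+1)%N by rewrite ltnS.
have pin : Ordinal pN1 \in [pred i : 'I_N.+1 | prime i] by rewrite inE.
by exists (exist (fun i : 'I_N.+1 => i \in [pred i : 'I_N.+1 | prime i]) _ pin).
Qed.

(** It agrees with [cmul] up to [N]. As larger primes are ignored, it depends on finitely many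
    values and is still multiplicative at all positive integers. *)
Definition cmulI N (v : pidx N -> R[i]) (n : nat) : R[i] :=
  \prod_x v x ^+ logn (pidx_val x) n.

Lemma cmul_cmulI N (y : nat -> R[i]) n : (0 < n <= N)%N ->
  cmul y n = cmulI (fun x : pidx N => y (pidx_val x)) n.
Proof.
move=> /andP[n0 nN]; rewrite (cmulE y n0 (_ : n < N.+1)%N) ?ltnS //.
by rewrite big_mkord /cmulI -(big_sub (fun i : 'I_N.+1 => prime i)
  (fun p : 'I_N.+1 => y p ^+ logn p n)).
Qed.

Lemma cmulIM N (v : pidx N -> R[i]) m n : (0 < m)%N -> (0 < n)%N ->
  cmulI v (m * n) = cmulI v m * cmulI v n.
Proof.
move=> m0 n0; rewrite /cmulI -big_split /=; apply: eq_bigr => x _.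
by rewrite lognM // exprD.
Qed.

Lemma nc_cmulI_le1 N (v : pidx N -> R[i]) n : (forall x, nc (v x) <= 1) ->
  nc (cmulI v n) <= 1.
Proof.
move=> v1; rewrite nc_prod; apply: prodr_ile1 => p _.
by rewrite nc_ge0 ncX exprn_ile1 ?nc_ge0.
Qed.

Lemma cmulI_dist N (v w : pidx N -> R[i]) n : (forall x, nc (v x) <= 1) ->
  (forall x, nc (w x) <= 1) ->
  nc (cmulI v n - cmulI w n) <= n%:R * \sum_x nc (v x - w x).
Proof.
move=> v1 w1; apply: le_trans (nc_prod_dist _ _ _) _.
- by move=> x; rewrite ncX exprn_ile1 ?nc_ge0.
- by move=> x; rewrite ncX exprn_ile1 ?nc_ge0.
rewrite mulr_sumr; apply: ler_sum => x _.
have dist e : nc (v x ^+ e - w x ^+ e) <= e%:R * nc (v x - w x).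
  elim: e => [|e IH]; first by rewrite !expr0 subrr nc0 mul0r.
  have -> : v x ^+ e.+1 - w x ^+ e.+1 =
    v x * (v x ^+ e - w x ^+ e) + w x ^+ e * (v x - w x) by rewrite !exprS; ring.
  apply: le_trans (ncD _ _) _; rewrite -[e.+1]addn1 natrD mulrDl mul1r !Normc.normcM.
  apply: lerD; first by apply: le_trans IH; rewrite ler_piMl ?nc_ge0.
  by rewrite ler_piMl ?nc_ge0 // ncX exprn_ile1 ?nc_ge0.
apply: le_trans (dist _) _; rewrite ler_wpM2r ?nc_ge0 // ler_nat.
case: n => [|n]; first by rewrite logn0.
by rewrite ltnW // ltn_logl.
Qed.

Definition dpt N T (z : {ffun pidx N -> 'I_T}) (x : pidx N) : R[i] := rootu R T (z x).

Lemma nc_dpt N T (z : {ffun pidx N -> 'I_T}) x : nc (dpt z x) = 1.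
Proof. exact: nc_rootu. Qed.

Lemma eq_logn_pidx N m n : (0 < m <= N)%N -> (0 < n <= N)%N ->
  (forall x : pidx N, logn (pidx_val x) m = logn (pidx_val x) n) -> m = n.
Proof.
move=> /andP[m0 mN] /andP[n0 nN] e; apply: (eqn_from_log m0 n0) => p.
have [pp|pp] := boolP (prime p); last by rewrite [LHS]lognE [RHS]lognE (negbTE pp).
have [pN|pN] := leqP p N; first by have [x <-] := pidx_surj pp pN; exact: e.
have l0 k : (0 < k <= N)%N -> logn p k = 0%N.
  move=> /andP[k0 kN]; rewrite lognE pp k0 /=; case: ifP => // pk.
  by have := dvdn_leq k0 pk; rewrite leqNgt (leq_ltn_trans kN pN).
by rewrite !l0 ?m0 ?n0.
Qed.

(** Exponents of integers up to N are below T, so their congruence modulo T is equality; and an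
    integer up to N is determined by its exponents at primes up to N. *)
Lemma dpt_orth N T m n : (N < T)%N -> (0 < m <= N)%N -> (0 < n <= N)%N ->
  \sum_(z : {ffun pidx N -> 'I_T}) cmulI (dpt z) m * (cmulI (dpt z) n)^*%C =
  #|{ffun pidx N -> 'I_T}|%:R * (m == n)%:R.
Proof.
move=> NT mN nN; have T0 : (0 < T)%N by apply: leq_ltn_trans NT.
pose F (x : pidx N) (t : 'I_T) : R[i] :=
  rootu R T (t * logn (pidx_val x) m) * (rootu R T (t * logn (pidx_val x) n))^*%C.
transitivity (\sum_(z : {ffun pidx N -> 'I_T}) \prod_x F x (z x)).
  apply: eq_bigr => z _; rewrite /cmulI rmorph_prod -big_split /=.
  by apply: eq_bigr => x _; rewrite /F /dpt !(mulnC (z x)) !rootuM.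
rewrite -(bigA_distr_bigA F) card_ffun card_ord natrX.
have ltT k x : (0 < k <= N)%N -> (logn (pidx_val x) k < T)%N.
  move=> /andP[k0 kN]; apply: leq_ltn_trans NT; apply: leq_trans kN.
  exact/ltnW/ltn_logl.
have FE x : \sum_t F x t = T%:R * (logn (pidx_val x) m == logn (pidx_val x) n)%:R.
  by rewrite rootu_orth // !modn_small ?ltT.
rewrite (eq_bigr _ (fun x _ => FE x)) big_split /= prodr_const; congr (_ * _).
case: eqP => [->|mn]; first by rewrite big1 // => x _; rewrite eqxx.
have [x xmn] : exists x : pidx N, logn (pidx_val x) m != logn (pidx_val x) n.
  apply: contra_notP mn => /forallNP h; apply: (eq_logn_pidx mN nN) => x.
  by apply/eqP; have /negP := h x; rewrite negbK.
by rewrite (bigD1 x) //= (negbTE xmn) mul0r.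
Qed.

Lemma dpt_second_moment N T : (N < T)%N ->
  second_moment_le (fun (z : {ffun pidx N -> 'I_T}) n => cmulI (dpt z) n) N 1.
Proof.
move=> NT; apply: (@second_moment_of_orth _ _ _ _ (fun m n => m == n)).
- by move=> m n mN nN; exact: dpt_orth.
- by move=> m n; exact: eq_sym.
- move=> m mN; rewrite -natr_sum (@ler_nat R _ 1).
  by under eq_bigr do rewrite eq_sym; exact: sum_eq1_le.
Qed.

Lemma dchar_cmul (q : nat) (q_pr : prime q) k n : (0 < n)%N ->
  dchar R q_pr k n%:Z = cmul (fun p => dchar R q_pr k p%:Z) n.
Proof.
elim/ltn_ind: n => n IH n0; have [n1|n1] := ltnP 1 n; last first.
  have -> : n = 1%N by apply/eqP; rewrite eqn_leq n1.
  by rewrite /cmul big_nil /dchar -pmulrn Fchar1.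
have pp := pdiv_prime n1; have pd := pdiv_dvd n.
have nE : n = (pdiv n * (n %/ pdiv n))%N by rewrite mulnC divnK.
have m0 : (0 < n %/ pdiv n)%N by rewrite divn_gt0 ?prime_gt0 // dvdn_leq.
have mn : (n %/ pdiv n < n)%N by rewrite ltn_Pdiv // prime_gt1.
move: (pdiv n) (n %/ pdiv n)%N pp m0 mn nE {pd} => p m pp m0 mn ->.
rewrite dchar_natM cmulM ?(prime_gt0 pp) //; congr (_ * _); last exact: IH.
by rewrite /cmul primes_prime // big_seq1 logn_prime // eqxx expr1.
Qed.

Lemma eq_polS (s : R[i]) (Y Y' : nat -> R[i]) N al :
  (forall n, (0 < n <= N)%N -> Y n = Y' n) -> polS s Y N al = polS s Y' N al.
Proof.
move=> YY'; rewrite /polS /pol !big_nat; apply: eq_bigr => n /andP[n0 nN].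
by rewrite YY' // n0.
Qed.

Lemma polS_dist (s : R[i]) N (v w : pidx N -> R[i]) al : nc s <= 1 ->
  (forall x, nc (v x) <= 1) -> (forall x, nc (w x) <= 1) ->
  `|nc (polS s (cmulI v) N al) - nc (polS s (cmulI w) N al)| <=
  4 * N%:R * \sum_x nc (v x - w x).
Proof.
move=> s1 v1 w1; apply: le_trans (nc_dist_dist _ _) _.
rewrite /polS /pol -sumrB; apply: le_trans (nc_sum _ _ _) _.
apply: (@le_trans _ _ (\sum_(1 <= n < N.+1) 4 * \sum_x nc (v x - w x))); last first.
  by rewrite sumr_const_nat subSS subn0 -[leLHS]mulr_natr mulrAC.
rewrite !big_nat; apply: ler_sum => n /andP[n0 _].
have nR : 0 < n%:R :> R by rewrite ltr0n.
rewrite -mulrBl Normc.normcM.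
apply: (@le_trans _ _ (n%:R * (\sum_x nc (v x - w x)) * (4 * n%:R^-1))); last first.
  by rewrite le_eqVlt; apply/orP; left; apply/eqP; field; exact: lt0r_neq0.
have d x : nc (1 - cis1 x) <= 2 :> R.
  by apply: le_trans (ncB _ _) _; rewrite nc1 nc_cis1.
apply: ler_pM; rewrite ?nc_ge0 ?cmulI_dist //.
apply: le_trans (ncD _ _) _.
rewrite !Normc.normcM ncN Normc.normcV nc_nat.
apply: (@le_trans _ _ (n%:R^-1 * 2 + 1 * (n%:R^-1 * 2))); last by lra.
apply: lerD; first by rewrite ler_wpM2l // invr_ge0.
apply: ler_pM; rewrite ?mulr_ge0 ?nc_ge0 ?invr_ge0 //.
by rewrite ler_wpM2l // invr_ge0.
Qed.

Lemma polS_lip (s : R[i]) N (Y : nat -> R[i]) al be : nc s <= 1 ->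
  (forall n, nc (Y n) <= 1) ->
  `|nc (polS s Y N al) - nc (polS s Y N be)| <= 32 * N%:R * `|al - be|.
Proof.
move=> s1 Y1; apply: le_trans (nc_dist_dist _ _) _; rewrite /polS /pol -sumrB.
apply: le_trans (nc_sum _ _ _) _.
apply: (@le_trans _ _ (\sum_(1 <= n < N.+1) 32 * `|al - be|)); last first.
  by rewrite sumr_const_nat subSS subn0 -[leLHS]mulr_natr mulrAC.
rewrite !big_nat; apply: ler_sum => n /andP[n0 _].
have nR : 0 < n%:R :> R by rewrite ltr0n.
rewrite -mulrBr Normc.normcM; apply: le_trans (ler_piMl (nc_ge0 _) (Y1 n)) _.
have -> : n%:R^-1 * (1 - cis1 (n%:R * al)) + s * (- n%:R^-1 * (1 - cis1 (- (n%:R * al)))) -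
  (n%:R^-1 * (1 - cis1 (n%:R * be)) + s * (- n%:R^-1 * (1 - cis1 (- (n%:R * be))))) =
  n%:R^-1 * ((cis1 (n%:R * be) - cis1 (n%:R * al)) -
    s * (cis1 (- (n%:R * be)) - cis1 (- (n%:R * al)))) by ring.
rewrite Normc.normcM Normc.normcV nc_nat mulrC ler_pdivrMr //.
apply: le_trans (ncB _ _) _; rewrite Normc.normcM.
have h1 := cis1_lip (n%:R * be) (n%:R * al).
have h2 := cis1_lip (- (n%:R * be)) (- (n%:R * al)).
have h3 := ler_piMl (nc_ge0 (cis1 (- (n%:R * be)) - cis1 (- (n%:R * al)))) s1.
have e1 : `|n%:R * be - n%:R * al| = n%:R * `|al - be|.
  by rewrite -mulrBr normrM ger0_norm // distrC.
have e2 : `|- (n%:R * be) - - (n%:R * al)| = n%:R * `|al - be|.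
  by rewrite -opprD normrN -mulrBr normrM ger0_norm // distrC.
rewrite e1 in h1; rewrite e2 in h2; move: h1 h2 h3.
have -> : 32 * `|al - be| * n%:R = 32 * (n%:R * `|al - be|) by ring.
by move: (n%:R * _) (nc (_ - _)) (nc (_ - _)) (nc s * _) => a b c e *; lra.
Qed.

End DiscreteModel.

Arguments rootu : simpl never.
Arguments cis1 : simpl never.

(** * Coupling characters with roots of unity by Fejer kernels *)

Section FejerCoupling.
Context (R : realType).

(** The Fejer kernel of order T, normalized to be a probability distribution on the T-th roots of
    unity when |y| = 1. *)
Definition ker (T : nat) (y : R[i]) (t : nat) : R :=
  nc (\sum_(j < T) y ^+ j * (rootu R T (t * j))^*%C) ^+ 2 / T%:R ^+ 2.

Lemma ker_ge0 T y t : 0 <= ker T y t.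
Proof. by rewrite divr_ge0 ?exprn_ge0 ?nc_ge0. Qed.

Lemma kerE T y t : (ker T y t)%:C%C = \sum_(ij : 'I_T * 'I_T)
  (T%:R ^+ 2)^-1 * (y ^+ ij.1 * (y ^+ ij.2)^*%C) *
  ((rootu R T (t * ij.1))^*%C * rootu R T (t * ij.2)).
Proof.
rewrite /ker real_complexM nc_sqr.
have -> : ((T%:R ^+ 2)^-1 : R)%:C%C = (T%:R ^+ 2)^-1 :> R[i].
  by rewrite fmorphV rmorphXn /= rmorph_nat.
rewrite conjc_sum big_distrlr /= pair_big /= mulr_suml; apply: eq_bigr => -[i j] _ /=.
have -> : (y ^+ j * (rootu R T (t * j))^*%C)^*%C = (y ^+ j)^*%C * rootu R T (t * j).
  by rewrite rmorphM; congr (_ * _); exact: conjcK.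
by ring.
Qed.

Lemma sum_ker T y : (0 < T)%N -> nc y = 1 -> \sum_(t < T) ker T y t = 1.
Proof.
move=> T0 y1; apply: (@complexI R); rewrite rmorph_sum /=.
have TC : T%:R != 0 :> R[i] by rewrite pnatr_eq0 -lt0n.
under eq_bigr do rewrite kerE.
rewrite exchange_big /=.
transitivity (\sum_(ij : 'I_T * 'I_T) (T%:R ^+ 2)^-1 * (y ^+ ij.1 * (y ^+ ij.2)^*%C) *
    (T%:R * (ij.2 == ij.1)%:R)).
  apply: eq_bigr => -[i j] _ /=; rewrite -mulr_sumr; congr (_ * _).
  have := rootu_orth R j i T0; rewrite !modn_small // => <-.
  by apply: eq_bigr => t _; rewrite mulrC.
rewrite -(pair_bigA _ (fun i j : 'I_T => (T%:R ^+ 2)^-1 * (y ^+ i * (y ^+ j)^*%C) *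
    (T%:R * (j == i)%:R))) /=.
transitivity (\sum_(i < T) (T%:R^-1 : R[i])).
  apply: eq_bigr => i _; rewrite (bigD1 i) //= eqxx big1 => [|j /negbTE ->]; last first.
    by rewrite !mulr0.
  by rewrite -nc_sqr ncX y1 !expr1n addr0 mulr1 mulr1; field.
by rewrite sumr_const card_ord -[LHS]mulr_natl divff.
Qed.

(** The factor y - w closes the geometric sum to u^T - 1, of modulus at most 2. Summed over t, this
    makes the root drawn from [ker] concentrate at y as T grows. *)
Lemma ker_dist T y t : (0 < T)%N -> nc y = 1 ->
  nc (y - rootu R T t) ^+ 2 * ker T y t <= 4 / T%:R ^+ 2.
Proof.
move=> T0 y1; rewrite /ker mulrA ler_pM2r ?invr_gt0 ?exprn_gt0 ?ltr0n //.
set w := rootu R T t; pose u := y * w^*%C.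
have u1 : nc u = 1 by rewrite Normc.normcM nc_conj y1 nc_rootu mulr1.
have -> : \sum_(j < T) y ^+ j * (rootu R T (t * j))^*%C = \sum_(j < T) u ^+ j.
  by apply: eq_bigr => j _; rewrite mulnC rootuM exprMn rmorphXn.
have -> : y - w = w * (u - 1).
  by rewrite mulrBr mulr1 /u mulrCA /w rootuMJ mulr1.
rewrite Normc.normcM nc_rootu mul1r -exprMn -Normc.normcM -subrX1.
have -> : 4 = 2 ^+ 2 :> R by ring.
rewrite lerXn2r // ?nnegrE ?nc_ge0 //.
by apply: le_trans (ncB _ _) _; rewrite ncX u1 expr1n nc1.
Qed.

Lemma sum_ker_dist T y : (0 < T)%N -> nc y = 1 ->
  \sum_(t < T) ker T y t * nc (y - rootu R T t) ^+ 2 <= 4 / T%:R.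
Proof.
move=> T0 y1; apply: (@le_trans _ _ (\sum_(t < T) 4 / T%:R ^+ 2)).
  by apply: ler_sum => t _; rewrite mulrC; exact: ker_dist.
rewrite sumr_const card_ord -[leLHS]mulr_natr.
have TR : T%:R != 0 :> R by rewrite pnatr_eq0 -lt0n.
by rewrite le_eqVlt; apply/orP; left; apply/eqP; field.
Qed.

Definition sgb (b : bool) : R[i] := (-1) ^+ b.

Lemma nc_sgb b : nc (sgb b) = 1.
Proof. by rewrite /sgb ncX ncN nc1 expr1n. Qed.

(* [Wt k] is a probability distribution on the discrete model concentrated near
   the values of the character [k].  It is a trigonometric polynomial of degree
   less than [T] in each of these values, so when the products of prime powers
   involved stay below [q / 2] orthogonality of characters is exact and the
   average of [Wt k] over [k] is the uniform distribution. *)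
Section Weights.
Context (q : nat) (q_pr : prime q) (N T : nat) (T0 : (0 < T)%N) (Nq : (N < q)%N)
  (Mq : (2 * \prod_(x : pidx N) pidx_val x ^ T < q)%N).
Local Notation v k := (fun x : pidx N => dchar R q_pr k (pidx_val x)%:Z).
Local Notation chi := (@Fchar R q q_pr).

Let pq (x : pidx N) : ~~ (q %| pidx_val x)%N.
Proof.
apply/negP => /(dvdn_leq (prime_gt0 (pidx_prime x))).
by rewrite leqNgt (leq_ltn_trans (pidx_le x) Nq).
Qed.

Lemma nc_dchar_pidx k x : nc (v k x) = 1.
Proof. by rewrite /= dchar_nat nc_Fchar natq_eq0 // pq. Qed.

Lemma dcharN1_sign k : exists b, dchar R q_pr k (-1) = sgb b.
Proof.
have [chiM _ _] := dchar_dirichlet R q_pr k.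
have : dchar R q_pr k (-1) ^+ 2 = 1.
  by rewrite expr2 -chiM mulrNN mulr1 /dchar -pmulrn Fchar1.
move/eqP; rewrite sqrf_eq1 => /orP[] /eqP ->; [by exists false; rewrite /sgb expr0|].
by exists true; rewrite /sgb expr1.
Qed.

(** Written as a polynomial in the value at -1, the sign condition too can be averaged by
    orthogonality. *)
Lemma sign_indicator k b :
  (`[< dchar R q_pr k (-1) = sgb b >])%:R = (1 + sgb b * dchar R q_pr k (-1)) / 2 :> R[i].
Proof.
have [b' ->] := dcharN1_sign k.
have n1 : (-1 : R[i]) != 1.
  by rewrite -subr_eq0 -opprD oppr_eq0 -(natrD _ 1 1) pnatr_eq0.
have two0 : 2 != 0 :> R[i] by rewrite pnatr_eq0.
case: asboolP => [->|bb].
  by rewrite /sgb -exprD addnn -mul2n exprM sqrrN !expr1n divff.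
suff -> : sgb b * sgb b' = -1 by rewrite subrr mul0r.
by move: bb; rewrite /sgb; case: b b' => -[]//; rewrite ?expr0 ?expr1 ?mulr1 ?mul1r.
Qed.

Definition Wt (k : nat) (z : {ffun pidx N -> 'I_T}) (b : bool) : R :=
  (`[< dchar R q_pr k (-1) = sgb b >])%:R * \prod_x ker T (v k x) (z x).

Lemma Wt_ge0 k z b : 0 <= Wt k z b.
Proof. by rewrite mulr_ge0 // prodr_ge0 // => x _; exact: ker_ge0. Qed.

Lemma sum_sign_indicator k : \sum_(b : bool) (`[< dchar R q_pr k (-1) = sgb b >])%:R = 1 :> R.
Proof.
have n1 : (-1 : R[i]) != 1.
  by rewrite -subr_eq0 -opprD oppr_eq0 -(natrD _ 1 1) pnatr_eq0.
rewrite big_bool; have [[] ->] := dcharN1_sign k; rewrite /sgb /= expr0 expr1.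
  by rewrite asboolT // asboolF ?addr0 // => /eqP; rewrite (negbTE n1).
by rewrite asboolF ?asboolT ?add0r // => /esym/eqP; rewrite (negbTE n1).
Qed.

Lemma sum_Wt_disc k : \sum_(b : bool) \sum_z Wt k z b = 1.
Proof.
rewrite /Wt; under eq_bigr do rewrite -mulr_sumr.
rewrite -mulr_suml sum_sign_indicator mul1r.
rewrite -(bigA_distr_bigA (fun (x : pidx N) (t : 'I_T) => ker T (v k x) t)).
by rewrite big1 // => x _; rewrite sum_ker // nc_dchar_pidx.
Qed.

Lemma sum_Wt_dist k (x0 : pidx N) :
  \sum_(b : bool) \sum_z Wt k z b * nc (v k x0 - dpt R z x0) ^+ 2 <= 4 / T%:R.
Proof.
apply: (@le_trans _ _ (\sum_(b : bool) (`[< dchar R q_pr k (-1) = sgb b >])%:R *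
   \sum_(z : {ffun pidx N -> 'I_T}) \prod_x (ker T (v k x) (z x) *
     (if x == x0 then nc (v k x0 - rootu R T (z x)) ^+ 2 else 1)))).
  rewrite le_eqVlt; apply/orP; left; apply/eqP.
  apply: eq_bigr => b _; rewrite mulr_sumr; apply: eq_bigr => z _.
  rewrite /Wt -[LHS]mulrA; congr (_ * _); rewrite [RHS]big_split /=; congr (_ * _).
  by rewrite -big_mkcond big_pred1_eq.
rewrite -mulr_suml sum_sign_indicator mul1r.
rewrite -(bigA_distr_bigA (fun (x : pidx N) (t : 'I_T) => ker T (v k x) t *
     (if x == x0 then nc (v k x0 - rootu R T t) ^+ 2 else 1))).
rewrite (bigD1 x0) //= eqxx [X in _ * X]big1 ?mulr1 ?sum_ker_dist ?nc_dchar_pidx //.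
move=> x /negbTE ->; under eq_bigr do rewrite mulr1.
by rewrite sum_ker // nc_dchar_pidx.
Qed.

Let nf (e : pidx N -> 'I_T) : nat := (\prod_x pidx_val x ^ e x)%N.

Let nf_gt0 e : (0 < nf e)%N.
Proof. by rewrite prodn_gt0 // => x; rewrite expn_gt0 prime_gt0 // pidx_prime. Qed.

Let nf_lt e : (2 * nf e < q)%N.
Proof.
apply: leq_ltn_trans Mq; rewrite leq_mul2l /=.
by apply: leq_prod => x _; rewrite leq_exp2l ?prime_gt1 ?pidx_prime // ltnW.
Qed.

Let nf_ltq e : (nf e < q)%N.
Proof. by apply: leq_ltn_trans (nf_lt e); rewrite leq_pmull. Qed.

Let logn_nf e x : logn (pidx_val x) (nf e) = e x.
Proof.
have e0 y : (0 < pidx_val y ^ e y)%N by rewrite expn_gt0 prime_gt0 // pidx_prime.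
rewrite /nf (bigD1 x) //= lognM //; last by apply: prodn_cond_gt0 => y _; exact: e0.
rewrite pfactorK ?pidx_prime // -[RHS]addn0; congr addn.
apply: logn_coprime; elim/big_rec: _ => [|y n yx IH]; first exact: coprimen1.
rewrite coprimeMr IH andbT coprimeXr // prime_coprime ?pidx_prime //.
rewrite dvdn_prime2 ?pidx_prime //; apply: contra yx => /eqP/pidx_val_inj ->.
by [].
Qed.

Let nf_inj e e' : nf e = nf e' -> forall x, e x = e' x.
Proof. by move=> h x; apply: val_inj; rewrite /= -!logn_nf h. Qed.

Let natf e : (nf e)%:R != 0 :> 'F_q.
Proof.
by rewrite natq_eq0 //; apply/negP => /(dvdn_leq (nf_gt0 e)); rewrite leqNgt nf_ltq.
Qed.

Let chi_nf k (e : pidx N -> 'I_T) : \prod_x v k x ^+ e x = chi k (nf e)%:R.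
Proof.
rewrite /nf natr_prod; rewrite (big_morph (chi k) (FcharM R q_pr k) (Fchar1 R q_pr k)).
apply: eq_bigr => x _; rewrite dchar_nat natrX.
by elim: (nat_of_ord _) => [|n IH]; rewrite ?expr0 ?Fchar1 // !exprS FcharM IH.
Qed.

(** Expanding the kernels gives pairs of integers a1, a2 < q/2 with the chosen exponents.
    Orthogonality over k keeps a1 = a2; unique factorization then forces equal exponents at every
    prime, where the phases cancel. *)
Lemma sum_Wt_char z b : \sum_(k < q.-1) Wt k z b = q.-1%:R / (2 * T%:R ^+ #|pidx N|).
Proof.
apply: (@complexI R); rewrite rmorph_sum /=.
have two0 : 2 != 0 :> R[i] by rewrite pnatr_eq0.
have TC : T%:R != 0 :> R[i] by rewrite pnatr_eq0 -lt0n.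
pose ph (x : pidx N) (ij : 'I_T * 'I_T) : R[i] :=
  (rootu R T (z x * ij.1))^*%C * rootu R T (z x * ij.2).
pose r := #|pidx N|.
have WE (k : 'I_q.-1) : (Wt k z b)%:C%C = \sum_(F : {ffun pidx N -> 'I_T * 'I_T})
   (T%:R ^+ 2)^-1 ^+ r * (\prod_x ph x (F x)) * ((1 + sgb b * dchar R q_pr k (-1)) / 2 *
   (chi k (nf (fun x => (F x).1))%:R * (chi k (nf (fun x => (F x).2))%:R)^*%C)).
  rewrite /Wt real_complexM rmorph_nat sign_indicator rmorph_prod /=.
  rewrite (eq_bigr _ (fun x _ => kerE T (v k x) (z x))).
  rewrite (bigA_distr_bigA (fun (x : pidx N) (ij : 'I_T * 'I_T) =>
    (T%:R ^+ 2)^-1 * (v k x ^+ ij.1 * (v k x ^+ ij.2)^*%C) *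
    ((rootu R T (z x * ij.1))^*%C * rootu R T (z x * ij.2)))) mulr_sumr.
  apply: eq_bigr => F _; rewrite 3!big_split /= prodr_const -!chi_nf rmorph_prod /=.
  by rewrite /ph big_split /=; ring.
rewrite (eq_bigr _ (fun k _ => WE k)) exchange_big /=.
have EE (F : {ffun pidx N -> 'I_T * 'I_T}) :
   ((nf (fun x => (F x).1))%:R == (nf (fun x => (F x).2))%:R :> 'F_q)%:R =
   \prod_x ((F x).1 == (F x).2)%:R :> R[i].
  rewrite natq_eq // !modn_small //; case: eqP => [/nf_inj h|h].
    by rewrite big1 // => x _; rewrite h eqxx.
  have [x xne] : exists x, (F x).1 != (F x).2.
    apply: contra_notP h => /forallNP h; rewrite /nf; apply: eq_bigr => x _.
    by have /negP := h x; rewrite negbK => /eqP ->.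
  by rewrite (bigD1 x) //= (negbTE xne) mul0r.
transitivity (\sum_(F : {ffun pidx N -> 'I_T * 'I_T})
   (T%:R ^+ 2)^-1 ^+ r * (q.-1%:R / 2) *
   \prod_x (ph x (F x) * ((F x).1 == (F x).2)%:R)).
  apply: eq_bigr => F _; rewrite -mulr_sumr [X in _ = _ * X]big_split /= -EE.
  set a1 := (nf (fun x => (F x).1))%:R; set a2 := (nf (fun x => (F x).2))%:R.
  (* The sign term would need q to divide a1 + a2, but 0 < a1 + a2 < q: this is the purpose of the
     factor 2 in [Mq]. *)
  have aN : (- a1 == a2 :> 'F_q) = false.
    apply: negbTE; rewrite eq_sym -addr_eq0 -natrD natq_eq0 //; apply/negP.
    move=> /(dvdn_leq _); rewrite addn_gt0 nf_gt0 => /(_ isT); apply/negP; rewrite -ltnNge.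
    have := nf_lt (fun x => (F x).1); have := nf_lt (fun x => (F x).2); lia.
  have -> : \sum_(k < q.-1) (1 + sgb b * dchar R q_pr k (-1)) / 2 *
      (chi k a1 * (chi k a2)^*%C) =
      2^-1 * (\sum_(k < q.-1) chi k a1 * (chi k a2)^*%C) +
      sgb b / 2 * (\sum_(k < q.-1) chi k (- a1) * (chi k a2)^*%C).
    rewrite !mulr_sumr -big_split /=; apply: eq_bigr => k _.
    have -> : chi k (- a1) = dchar R q_pr k (-1) * chi k a1.
      by rewrite /dchar -FcharM mulrN1z mulN1r.
    by ring.
  rewrite !Fchar_orth ?oppr_eq0 ?natf // aN !mulr0 addr0.
  by ring.
rewrite -mulr_sumr -(bigA_distr_bigA (fun (x : pidx N) (ij : 'I_T * 'I_T) =>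
  ph x ij * (ij.1 == ij.2)%:R)).
have phE x : \sum_(ij : 'I_T * 'I_T) ph x ij * (ij.1 == ij.2)%:R = T%:R.
  rewrite -(pair_bigA _ (fun i j : 'I_T => ph x (i, j) * (i == j)%:R)) /=.
  rewrite -[T in RHS]card_ord -sumr_const; apply: eq_bigr => i _.
  rewrite (bigD1 i) //= eqxx big1 => [|j ji]; last by rewrite eq_sym (negbTE ji) mulr0.
  by rewrite /ph /= mulr1 addr0 mulrC rootuMJ.
rewrite (eq_bigr _ (fun x _ => phE x)) prodr_const -/r.
rewrite !real_complexM fmorphV /= real_complexM rmorphXn /= !rmorph_nat.
by rewrite exprVn -exprM mulnC exprM; field; rewrite ?two0 ?expf_neq0.
Qed.

(** [Wt] is a coupling: it has mass 1 for each k and averages to the uniform distribution over k. If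
    [A] holds at k, the drawn point satisfies [A'] or lies further than [eta] away, and Markov's
    inequality bounds the second case. *)
Lemma char_to_disc (A A' : R[i] -> (pidx N -> R[i]) -> Prop) (eta : R) : 0 < eta ->
  (forall s u w, A s u -> \sum_x nc (u x - w x) ^+ 2 <= eta -> A' s w) ->
  cnt R (fun k : 'I_q.-1 => A (dchar R q_pr k (-1)) (v k)) <=
  (cnt R (fun bz : bool * {ffun pidx N -> 'I_T} => A' (sgb bz.1) (dpt R bz.2)) /
     (2 * T%:R ^+ #|pidx N|) +
   4 * #|pidx N|%:R / (T%:R * eta)) * q.-1%:R.
Proof.
move=> eta0 AA'; have TR : 0 < T%:R :> R by rewrite ltr0n.
pose dist k (z : {ffun pidx N -> 'I_T}) := \sum_x nc (v k x - dpt R z x) ^+ 2.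
pose ind (b : bool) (z : {ffun pidx N -> 'I_T}) : R := (`[< A' (sgb b) (dpt R z) >])%:R.
have dist0 k z : 0 <= dist k z by apply: sumr_ge0 => x _; rewrite exprn_ge0 ?nc_ge0.
apply: (@le_trans _ _ (\sum_(k < q.-1) \sum_(b : bool) \sum_z
    Wt k z b * (ind b z + eta^-1 * dist k z))).
  apply: ler_sum => k _; case: asboolP => [Ak|_] /=; last first.
    apply: sumr_ge0 => b _; apply: sumr_ge0 => z _.
    by rewrite mulr_ge0 ?Wt_ge0 // addr_ge0 // mulr_ge0 // invr_ge0 ltW.
  rewrite -(sum_Wt_disc k); apply: ler_sum => b _; apply: ler_sum => z _.
  have [e|ne] := pselect (dchar R q_pr k (-1) = sgb b); last first.
    by rewrite /Wt asboolF // !mul0r.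
  rewrite -[leLHS]mulr1 ler_wpM2l ?Wt_ge0 // /ind.
  case: asboolP => [_|nA'].
    by rewrite lerDl mulr_ge0 // invr_ge0 ltW.
  rewrite add0r mulrC ler_pdivlMr // mul1r leNgt; apply/negP => /ltW de.
  by apply: nA'; rewrite -e; apply: AA' Ak de.
have -> : \sum_(k < q.-1) \sum_(b : bool) \sum_z Wt k z b * (ind b z + eta^-1 * dist k z) =
   \sum_(b : bool) \sum_z ind b z * (\sum_(k < q.-1) Wt k z b) +
   eta^-1 * \sum_(k < q.-1) \sum_x \sum_(b : bool) \sum_z
     Wt k z b * nc (v k x - dpt R z x) ^+ 2.
  rewrite mulr_sumr.
  transitivity (\sum_(k < q.-1) (\sum_(b : bool) \sum_z Wt k z b * ind b z +
     eta^-1 * \sum_x \sum_(b : bool) \sum_z Wt k z b * nc (v k x - dpt R z x) ^+ 2)).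
    apply: eq_bigr => k _.
    rewrite (exchange_big _ _ _ _ _ (fun x b => \sum_z _)) /= mulr_sumr -big_split /=.
    apply: eq_bigr => b _; rewrite exchange_big /= mulr_sumr -big_split /=.
    apply: eq_bigr => z _; rewrite mulrDr; congr (_ + _).
    by rewrite /dist mulrCA; congr (_ * _); rewrite mulr_sumr.
  rewrite big_split /=; congr (_ + _).
  rewrite exchange_big /=; apply: eq_bigr => b _.
  rewrite exchange_big /=; apply: eq_bigr => z _.
  by rewrite mulr_sumr; apply: eq_bigr => k _; rewrite mulrC.
rewrite mulrDl; apply: lerD.
  rewrite le_eqVlt; apply/orP; left; apply/eqP.
  under eq_bigr do under eq_bigr do rewrite sum_Wt_char.
  rewrite pair_big /= /cnt /ind -mulr_suml -mulrA (mulrC _^-1).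
  by congr (_ * _); apply: eq_bigr.
apply: (@le_trans _ _ (eta^-1 * \sum_(k < q.-1) \sum_(x : pidx N) 4 / T%:R)).
  rewrite ler_wpM2l ?invr_ge0 ?(ltW eta0) //; apply: ler_sum => k _.
  by apply: ler_sum => x _; exact: sum_Wt_dist.
have -> : \sum_(k < q.-1) \sum_(x : pidx N) 4 / T%:R =
    4 / T%:R * #|pidx N|%:R * q.-1%:R :> R.
  by rewrite !sumr_const card_ord !mulr_natr.
rewrite le_eqVlt; apply/orP; left; apply/eqP; field.
by rewrite !lt0r_neq0.
Qed.

End Weights.

End FejerCoupling.

(** * The random model *)

Section Arcs.
Context (R : realType).
Implicit Types (T t : nat) (s : R) (w : R[i]).

Definition arc_center T t : R := (t%:R + 2^-1) / T%:R.

(* The third condition says that the angle to the midpoint of the [t]-th of [T]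
   equal arcs is at most half the length of an arc. *)
Definition circ_arc T t : set (measurableTypeR R * measurableTypeR R) :=
  [set ab : R * R | [/\ ab.1 ^+ 2 + ab.2 ^+ 2 <= 1, 1 <= ab.1 ^+ 2 + ab.2 ^+ 2 &
    cos (pi / T%:R) <= ab.1 * cos (2 * pi * arc_center T t) +
       ab.2 * sin (2 * pi * arc_center T t)]].

Lemma arc_cis1 T t s : circ_arc T t (plane (cis1 s)) <->
  cos (pi / T%:R) <= cos (2 * pi * (s - arc_center T t)).
Proof.
rewrite /circ_arc /plane /cis1 /= cos2Dsin2 lexx mulrBr cosB.
by split=> [[]|].
Qed.

Lemma arc_nc T t w : circ_arc T t (plane w) -> nc w = 1.
Proof.
case=> /= h1 h2 _; have e : nc w ^+ 2 = 1.
  by rewrite nc_sqrE; apply/eqP; rewrite eq_le h1 h2.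
by apply/eqP; rewrite -(@eqrXn2 _ 2) ?nc_ge0 // e expr1n.
Qed.

Lemma arc_close T t w : (0 < T)%N -> circ_arc T t (plane w) ->
  nc (w - rootu R T t) <= 16 / T%:R.
Proof.
move=> T0 arcw; have TR : 0 < T%:R :> R by rewrite ltr0n.
have w1 := arc_nc arcw; case: arcw => /= _ _ hcos.
pose u : R[i] := cis1 (arc_center T t).
have d1 : nc (w - u) <= 8 / T%:R.
  rewrite -(@ler_pXn2r _ 2%N) ?nnegrE ?nc_ge0 ?divr_ge0 //.
  have w2 : complex.Re w ^+ 2 + complex.Im w ^+ 2 = 1 by rewrite -nc_sqrE w1 expr1n.
  have -> : nc (w - u) ^+ 2 = 2 - 2 * (complex.Re w * cos (2 * pi * arc_center T t) +
      complex.Im w * sin (2 * pi * arc_center T t)).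
    rewrite nc_sqrE /u /cis1 !raddfB /=.
    have cs := cos2Dsin2 (2 * pi * arc_center T t).
    move: (cos _) (sin _) cs => c s cs.
    transitivity ((complex.Re w ^+ 2 + complex.Im w ^+ 2) + (c ^+ 2 + s ^+ 2) -
      2 * (complex.Re w * c + complex.Im w * s)); first by ring.
    by rewrite w2 cs.
  have := cos_sub1 (pi / T%:R : R); rewrite ler_norml => /andP[c1 _].
  have p1 : (pi / T%:R) ^+ 2 <= 16 / T%:R ^+ 2 :> R.
    rewrite expr_div_n ler_pM2r ?invr_gt0 ?exprn_gt0 //.
    have -> : 16 = 4 ^+ 2 :> R by ring.
    by rewrite lerXn2r ?nnegrE ?pi_ge0 // ltW // pi_lt4.
  have -> : (8 / T%:R) ^+ 2 = 4 * (16 / T%:R ^+ 2) :> R by field; exact: lt0r_neq0.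
  have : 0 <= 16 / T%:R ^+ 2 :> R by rewrite divr_ge0 ?exprn_ge0.
  move: hcos c1 p1; move: (cos _) (_ ^+ 2) (16 / _) (_ * _ + _) => a b c e.
  by move=> *; lra.
have d2 : nc (u - rootu R T t) <= 8 / T%:R.
  apply: le_trans (cis1_lip _ _) _.
  have -> : arc_center T t - t%:R / T%:R = 2^-1 / T%:R by rewrite /arc_center; ring.
  rewrite ger0_norm ?divr_ge0 ?invr_ge0 //.
  by rewrite mulrA ler_pM2r ?invr_gt0 //; lra.
apply: le_trans (nc_dist_trans _ u _) _; apply: le_trans (lerD d1 d2) _.
by rewrite -mulrDl ler_pM2r ?invr_gt0 //; lra.
Qed.

Lemma cos_le_abs (x y : R) : `|x| <= `|y| -> `|y| <= pi -> cos y <= cos x.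
Proof.
move=> xy ypi; rewrite -(cos_norm x) -(cos_norm y).
have [->//|ne] := eqVneq `|x| `|y|.
rewrite ltW // ltr_cos ?in_itv /= ?normr_ge0 ?ypi ?(le_trans xy ypi) //.
by rewrite lt_neqAle ne.
Qed.

Lemma cos_lt_abs (x y : R) : `|x| < `|y| -> `|y| <= pi -> cos y < cos x.
Proof.
move=> xy ypi; rewrite -(cos_norm x) -(cos_norm y).
by rewrite ltr_cos ?in_itv /= ?normr_ge0 ?ypi ?(le_trans (ltW xy) ypi).
Qed.

Lemma norm_2pi s : `|2 * pi * s| = 2 * pi * `|s| :> R.
Proof. by rewrite normrM ger0_norm // mulr_ge0 // pi_ge0. Qed.

Lemma norm_piT T : (0 < T)%N -> `|pi / T%:R| = 2 * pi * (2^-1 / T%:R) :> R.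
Proof.
move=> T0; rewrite ger0_norm ?divr_ge0 ?pi_ge0 //.
by field; rewrite pnatr_eq0 -lt0n.
Qed.

Lemma two_pi_gt0 : 0 < 2 * pi :> R.
Proof. by rewrite mulr_gt0 // pi_gt0. Qed.

Lemma arc_cover T s : (0 < T)%N -> 0 <= s <= 1 ->
  exists2 t, (t < T)%N & circ_arc T t (plane (cis1 s)).
Proof.
move=> T0 /andP[s0 s1]; have TR : 0 < T%:R :> R by rewrite ltr0n.
have [t tT dist] : exists2 t, (t < T)%N & `|s - arc_center T t| <= 2^-1 / T%:R.
  have dE t : (s - arc_center T t) * T%:R = s * T%:R - t%:R - 2^-1.
    by rewrite /arc_center; field; exact: lt0r_neq0.
  have dT (x : R) : `|x| <= 2^-1 / T%:R <-> `|x * T%:R| <= 2^-1.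
    by rewrite normrM (ger0_norm (ltW TR)) ler_pdivlMr.
  have [sT|sT] := ltP s 1.
    have := truncn_itv (mulr_ge0 s0 (ltW TR)).
    move: (Num.truncn _) => n /andP[h1 h2]; exists n.
      by rewrite -(ltr_nat R) (le_lt_trans h1) // -[ltRHS]mul1r ltr_pM2r.
    apply/dT; rewrite dE; move: h1 h2; rewrite -natr1 ler_norml.
    by move: (n%:R) (s * _) => a b *; apply/andP; lra.
  (* At s = 1 truncation would give the index T; the closed last arc contains this endpoint. *)
  exists T.-1; first by rewrite ltn_predL.
  have sE : s = 1 by apply/eqP; rewrite eq_le s1.
  apply/dT; rewrite dE sE mul1r.
  have -> : T%:R = T.-1%:R + 1 :> R by rewrite natr1 prednK.
  by rewrite ler_norml; move: (T.-1%:R : R) => a; apply/andP; lra.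
exists t => //; apply/arc_cis1.
have T1 : 1 <= T%:R :> R by rewrite ler1n.
apply: cos_le_abs; first by rewrite norm_2pi norm_piT // ler_pM2l ?two_pi_gt0.
rewrite ger0_norm ?divr_ge0 ?pi_ge0 //.
by rewrite ler_pdivrMr // ler_peMr // pi_ge0.
Qed.

(** Arcs live on the circle, where the parameters 0 and 1 coincide. An arc touching that point also
    picks up the opposite end of the parameter interval, which has measure zero. *)
Lemma arc_sub T t s : (t < T)%N -> 0 <= s <= 1 -> circ_arc T t (plane (cis1 s)) ->
  t%:R / T%:R <= s <= t.+1%:R / T%:R \/ s = 0 \/ s = 1.
Proof.
move=> tT /andP[s0 s1] /arc_cis1; have T0 : (0 < T)%N by apply: leq_ltn_trans tT.
have TR : 0 < T%:R :> R by rewrite ltr0n.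
have T1 : 1 <= T%:R :> R by rewrite ler1n.
set c := arc_center T t; set h : R := 2^-1 / T%:R => hcos.
have h0 : 0 < h by rewrite divr_gt0.
have cE : c = t%:R / T%:R + h by rewrite /c /arc_center mulrDl.
have tE : t.+1%:R / T%:R = t%:R / T%:R + 2 * h :> R.
  by rewrite -natr1 mulrDl /h; field; exact: lt0r_neq0.
have tT1 : t.+1%:R / T%:R <= 1 :> R by rewrite ler_pdivrMr // mul1r ler_nat.
have tT0 : 0 <= t%:R / T%:R :> R by rewrite divr_ge0.
have contra x : h < `|x| -> `|x| <= 1 / 2 -> cos (2 * pi * x) < cos (pi / T%:R).
  move=> hx x2; apply: cos_lt_abs; rewrite ?norm_2pi ?norm_piT //.
    by rewrite ltr_pM2l ?two_pi_gt0.
  by have := ler_wpM2l (ltW two_pi_gt0) x2; lra.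
move: hcos; rewrite leNgt => /negP hcos.
have [le_h|lt_h] := leP `|s - c| h.
  left; rewrite tE; move: le_h; rewrite ler_norml cE => /andP[].
  by move=> *; apply/andP; lra.
right; have [le2|lt2] := leP `|s - c| (1 / 2); first by case: hcos; exact: contra.
have shift : cos (2 * pi * (s - c)) = cos (2 * pi * (1 - `|s - c|)).
  rewrite -[LHS]cos_norm norm_2pi.
  have -> : 2 * pi * (1 - `|s - c|) = - (2 * pi * `|s - c|) + pi *+ 2.
    by rewrite mulr2n; ring.
  by rewrite cosD2pi cosN.
have n1 : `|1 - `|s - c| | = 1 - `|s - c|.
  by apply: ger0_norm; rewrite subr_ge0 ler_norml cE; apply/andP; lra.
rewrite shift in hcos.
have [le3|lt3] := leP (1 - `|s - c|) h; last first.
  by case: hcos; apply: contra; rewrite n1 //; lra.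
case: (lerP 0 (s - c)) => sc; move: le3; rewrite ?(ger0_norm sc) ?(ltr0_norm sc) cE => le3.
  by right; lra.
by left; lra.
Qed.

End Arcs.

(** * Covering the random model by boxes *)

Section RandomBoxes.
Context (R : realType).
Local Notation RR := (measurableTypeR R * measurableTypeR R)%type.

Lemma measurable_le_set (d : measure_display) (T : measurableType d) (f g : T -> R) :
  measurable_fun [set: T] f -> measurable_fun [set: T] g ->
  measurable [set x | f x <= g x].
Proof. by move=> mf mg; rewrite -[X in measurable X]setTI; exact: measurable_fun_le. Qed.

Lemma measurable_circ_arc (T t : nat) : measurable (@circ_arc R T t).
Proof.
have m1 : measurable_fun [set: RR] (fun ab : RR => ab.1 : R) by exact: measurable_fst.
have m2 : measurable_fun [set: RR] (fun ab : RR => ab.2 : R) by exact: measurable_snd.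
have ms : measurable_fun [set: RR] (fun ab : RR => (ab.1 : R) ^+ 2 + (ab.2 : R) ^+ 2).
  by apply: measurable_funD; apply: measurable_funX.
rewrite (_ : @circ_arc R T t =
  [set ab : RR | (ab.1 : R) ^+ 2 + (ab.2 : R) ^+ 2 <= 1] `&`
  ([set ab : RR | 1 <= (ab.1 : R) ^+ 2 + (ab.2 : R) ^+ 2] `&`
   [set ab : RR | cos (pi / T%:R) <= (ab.1 : R) * cos (2 * pi * @arc_center R T t) +
       (ab.2 : R) * sin (2 * pi * @arc_center R T t)])); last first.
  by apply/seteqP; split=> ab /=; [case=> ? ? ?; split|case=> ? [? ?]; split].
apply: measurableI; first exact: measurable_le_set.
apply: measurableI; first exact: measurable_le_set.
apply: measurable_le_set => //.
by apply: measurable_funD; apply: measurable_funM.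
Qed.

Lemma measurable_plane_cis1 : measurable_fun [set: R] (fun s : R => plane (cis1 s) : RR).
Proof.
have c2 : continuous (fun s : R => 2 * pi * s) by exact: mulrl_continuous.
apply: measurable_fun_pair; apply: continuous_measurable_fun => s.
  by apply: continuous_comp; [exact: c2|exact: continuous_cos].
by apply: continuous_comp; [exact: c2|exact: continuous_sin].
Qed.

Lemma measurable_circle_param (B : set RR) : measurable B ->
  measurable [set s : R | 0 <= s <= 1 /\ B (plane (cis1 s))].
Proof.
move=> mB; rewrite (_ : [set _ | _] = `[0, 1]%classic `&`
   ([set: R] `&` (fun s : R => plane (cis1 s) : RR) @^-1` B)); last first.
  by apply/seteqP; split=> s /=; rewrite in_itv /=; [case=> ? ?; split|case=> ? [? ?]; split].
by apply: measurableI; [exact: measurable_itv|exact: measurable_plane_cis1].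
Qed.

Lemma lebesgue_circ_arc (T t : nat) : (t < T)%N ->
  (lebesgue_measure [set s : R | (0 <= s <= 1)%R /\ @circ_arc R T t (plane (cis1 s))]
    <= (T%:R^-1)%:E)%E.
Proof.
move=> tT; have T0 : (0 < T)%N by apply: leq_ltn_trans tT.
have TR : 0 < T%:R :> R by rewrite ltr0n.
pose I : set R := `[t%:R / T%:R, t.+1%:R / T%:R]%classic.
have mI : measurable I by exact: measurable_itv.
have lt : t%:R / T%:R < t.+1%:R / T%:R :> R by rewrite ltr_pM2r ?invr_gt0 // ltr_nat.
have IE : lebesgue_measure I = (T%:R^-1)%:E.
  rewrite lebesgue_measure_itv /= lte_fin lt -EFinB; congr EFin.
  by rewrite -natr1; field; exact: lt0r_neq0.
have m01 : measurable ([set 0] `|` [set 1] : set R) by apply: measurableU; exact: measurable_set1.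
apply: (@le_trans _ _ (lebesgue_measure (I `|` ([set 0] `|` [set 1])))).
  apply: le_measure; rewrite ?inE.
  - by apply: measurable_circle_param; exact: measurable_circ_arc.
  - exact: measurableU.
  - move=> s /= [s01 /(arc_sub tT s01)].
    by rewrite /I /= in_itv /= => -[|[|]]; [left|right; left|right; right].
apply: (@le_trans _ _ (lebesgue_measure I +
   lebesgue_measure ([set 0%R] `|` [set 1%R] : set R))%E); first exact: measureU2.
have z : (lebesgue_measure ([set 0%R] `|` [set 1%R] : set R) <= 0)%E.
  apply: (@le_trans _ _ (lebesgue_measure ([set 0%R] : set R) +
    lebesgue_measure ([set 1%R] : set R))%E); first by apply: measureU2; exact: measurable_set1.
  by rewrite !lebesgue_measure_set1 adde0.
by rewrite -[leRHS]adde0; apply: leeD => //; rewrite IE.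
Qed.

Section Model.
Context (d : measure_display) (T : measurableType d) (P : probability T R)
  (X : int -> T -> R[i]) (HX : random_model P X).
Local Notation out := (mu_ext P).

Lemma out_le (A B : set T) : A `<=` B -> (out A <= out B)%E.
Proof. exact: le_mu_ext. Qed.

Lemma out_measurable (A : set T) : measurable A -> out A = P A.
Proof. exact: measurable_mu_extE. Qed.

Lemma out_U2 (A B : set T) : (out (A `|` B) <= out A + out B)%E.
Proof. exact: (outer_measureU2 (mu_ext P : {outer_measure set T -> \bar R})). Qed.

Lemma out_fin (I : finType) (A : I -> set T) :
  (out [set w | exists i, A i w] <= \sum_i out (A i))%E.
Proof.
apply: (@le_trans _ _ (out [set w | exists2 i, i \in index_enum I & A i w])).
  by apply: out_le => w /= [i Ai]; exists i => //; rewrite mem_index_enum.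
elim: (index_enum I) => [|i r IH].
  rewrite big_nil (_ : [set _ | _] = set0) ?mu_ext0 //.
  by apply/seteqP; split=> w //= [].
rewrite big_cons; apply: le_trans (leeD (lexx _) IH).
apply: le_trans (out_U2 _ _); apply: out_le => w /= [k].
by rewrite inE => /predU1P[->|kr] Ak; [left|right; exists k].
Qed.

Lemma measurable_coord i (B : set RR) : base_index i -> measurable B ->
  measurable [set w | B (plane (X i w))].
Proof.
move=> bi mB; have := model_measurable HX bi measurableT mB.
by rewrite setTI.
Qed.

Lemma base_index_N1 : base_index (-1).
Proof. by left. Qed.

Lemma base_index_pidx N (x : pidx N) : base_index (pidx_val x)%:Z.
Proof. by right; exists (pidx_val x) => //; exact: pidx_prime. Qed.

Lemma measurable_pt (z : R[i]) : measurable ([set plane z] : set RR).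
Proof.
rewrite (_ : [set plane z] = [set complex.Re z] `*` [set complex.Im z]).
  by apply: measurableX; exact: measurable_set1.
by apply/seteqP; split=> -[a b] /=; [case=> -> ->|case=> -> ->].
Qed.

Lemma plane_inj : injective (@plane R).
Proof. by move=> [a b] [a' b'] [-> ->]. Qed.

Lemma sign_setE b : [set w | [set plane (sgb R b)] (plane (X (-1) w))] =
  [set w | X (-1) w = sgb R b].
Proof. by apply/seteqP; split=> w /=; [exact: plane_inj|move->]. Qed.

Lemma P_sign b : P [set w | X (-1) w = sgb R b] = (2^-1)%:E.
Proof.
by case: b; rewrite /sgb ?expr1 ?expr0; [exact: (model_neg HX)|exact: (model_pos HX)].
Qed.

Lemma measurable_sign b : measurable [set w | X (-1) w = sgb R b].
Proof.
rewrite -sign_setE; apply: measurable_coord; first exact: base_index_N1.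
exact: measurable_pt.
Qed.

Lemma sgb_inj : injective (sgb R).
Proof.
have n1 : (-1 : R[i]) != 1.
  by rewrite -subr_eq0 -opprD oppr_eq0 -(natrD _ 1 1) pnatr_eq0.
by case=> -[]; rewrite /sgb ?expr0 ?expr1 // => /eqP; rewrite ?(eq_sym 1) (negbTE n1).
Qed.

Lemma out_sign_null : out [set w | ~ exists b, X (-1) w = sgb R b] = 0%E.
Proof.
pose S b := [set w | X (-1) w = sgb R b].
have mS b : measurable (S b) by exact: measurable_sign.
rewrite (_ : [set _ | _] = ~` (S true `|` S false)); last first.
  apply/seteqP; split=> w /=; first by move=> h [h'|h']; apply: h; [exists true|exists false].
  by move=> h [[] h']; apply: h; [left|right].
rewrite out_measurable; last by apply: measurableC; exact: measurableU.
rewrite probability_setC; last exact: measurableU.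
rewrite measureU //; last first.
  by apply/seteqP; split=> w //=; rewrite /S /= => -[-> /sgb_inj].
apply: (etrans (congr2 (fun x y => 1 - (x + y))%E (P_sign true) (P_sign false))).
rewrite -[LHS]/((1 - (2^-1 + 2^-1))%R%:E); congr EFin; lra.
Qed.

Lemma out_arc_null N m (x : pidx N) : (0 < m)%N ->
  out [set w | ~ exists2 t, (t < m)%N & @circ_arc R m t (plane (X (pidx_val x)%:Z w))] = 0%E.
Proof.
move=> m0; pose U : set RR := \bigcup_(t in `I_m) @circ_arc R m t.
have mU : measurable U by apply: fin_bigcup_measurable => // t _; exact: measurable_circ_arc.
have E : [set w | ~ exists2 t, (t < m)%N & @circ_arc R m t (plane (X (pidx_val x)%:Z w))] =
    [set w | (~` U) (plane (X (pidx_val x)%:Z w))].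
  by apply/seteqP; split=> w /=.
rewrite E out_measurable; last first.
  by apply: measurable_coord; [exact: base_index_pidx|exact: measurableC].
rewrite (model_prime HX (pidx_prime x) (measurableC mU)).
rewrite (_ : [set _ | _] = set0) ?measure0 //.
apply/seteqP; split=> s //= [s01]; apply.
by have [t tm ts] := arc_cover m0 s01; exists t.
Qed.

Section Box.
Context (N m : nat) (b : bool) (z : {ffun pidx N -> 'I_m}).

Let idx : seq int := -1 :: [seq (pidx_val x)%:Z | x <- enum (pidx N)].

Let idx_uniq : uniq idx.
Proof.
rewrite /= map_inj_uniq ?enum_uniq ?andbT; last by move=> x y [/pidx_val_inj].
by apply/negP => /mapP[x _].
Qed.

Let J : {fset int} := seq_fset tt idx.

Let Jperm : perm_eq J idx.
Proof. by apply: perm_trans (seq_fset_perm _ _) _; rewrite undup_id. Qed.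

(** [mutually_independent] asks for a measurable set at every integer, hence the default [setT]. *)
Let B (i : int) : set RR :=
  if i == -1 then [set plane (sgb R b)]
  else if [pick x : pidx N | (pidx_val x)%:Z == i] is Some x
       then @circ_arc R m (z x) else setT.

Let B_N1 : B (-1) = [set plane (sgb R b)].
Proof. by rewrite /B eqxx. Qed.

Let B_pidx x : B (pidx_val x)%:Z = @circ_arc R m (z x).
Proof.
rewrite /B /=; case: pickP => [y /eqP[/pidx_val_inj ->]//|/(_ x)].
by rewrite eqxx.
Qed.

Let mB i : measurable (B i).
Proof.
rewrite /B; case: eqP => _; first exact: measurable_pt.
by case: pickP => [x _|_]; [exact: measurable_circ_arc|exact: measurableT].
Qed.

Definition box : set T := [set w | X (-1) w = sgb R b /\
  forall x : pidx N, @circ_arc R m (z x) (plane (X (pidx_val x)%:Z w))].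

Let boxE : box = \bigcap_(i in [set` J]) [set w | B i (plane (X i w))].
Proof.
have memJ i : (i \in J) = (i \in idx) by apply: perm_mem.
apply/seteqP; split=> w /=.
  move=> [h1 h2] i /=; rewrite memJ inE => /predU1P[->|/mapP[x _ ->]].
    by rewrite B_N1 h1.
  by rewrite B_pidx.
move=> h; split=> [|x].
  have := h (-1); rewrite /= memJ inE eqxx B_N1 => /(_ isT); exact: plane_inj.
have := h (pidx_val x)%:Z; rewrite /= memJ inE map_f ?mem_enum ?orbT // B_pidx.
by apply.
Qed.

Lemma out_box : (out box <= (2 * m%:R ^+ #|pidx N|)^-1%:E)%E.
Proof.
have Jbase : [set` J] `<=` base_index.
  move=> i /=; rewrite (perm_mem Jperm) inE => /predU1P[->|/mapP[x _ ->]].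
    exact: base_index_N1.
  exact: base_index_pidx.
rewrite out_measurable; last first.
  rewrite boxE; apply: fin_bigcap_measurable => // i iJ.
  by apply: measurable_coord; [exact: Jbase|exact: mB].
rewrite boxE (model_independent HX Jbase mB) (perm_big _ Jperm) /=.
rewrite big_cons B_N1 sign_setE P_sign big_map.
rewrite invfM EFinM -exprVn cardE.
have F0 x : (0 <= P [set w | B (pidx_val x)%:Z (plane (X (pidx_val x)%:Z w))])%E.
  exact: measure_ge0.
have F1 (x : pidx N) : (P [set w | B (pidx_val x)%:Z (plane (X (pidx_val x)%:Z w))] <=
    (m%:R^-1)%:E)%E.
  rewrite B_pidx (model_prime HX (pidx_prime x) (measurable_circ_arc _ _)).
  exact: lebesgue_circ_arc.
apply: lee_pmul => //; first by apply: prode_ge0.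
elim: (enum _) => [|x r IH]; first by rewrite big_nil expr0.
rewrite big_cons /= exprS EFinM; apply: lee_pmul => //.
by apply: prode_ge0.
Qed.

End Box.

(** Up to null sets the boxes cover the whole space, and within a box each value is at distance at
    most 16 / m from its root of unity. So the event is covered by the boxes whose point satisfies
    [A'], each of outer measure at most the uniform weight of a point. *)
Lemma random_to_disc (N m : nat) (A A' : R[i] -> (pidx N -> R[i]) -> Prop) : (0 < m)%N ->
  (forall s u v, A s u -> nc s = 1 -> (forall x, nc (u x) = 1) -> (forall x, nc (v x) = 1) ->
     (forall x, nc (u x - v x) <= 16 / m%:R) -> A' s v) ->
  (out [set w | A (X (-1) w) (fun x => X (pidx_val x)%:Z w)] <=
   (cnt R (fun bz : bool * {ffun pidx N -> 'I_m} => A' (sgb R bz.1) (dpt R bz.2)) /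
     (2 * m%:R ^+ #|pidx N|))%:E)%E.
Proof.
move=> m0 AA'.
pose N1 := [set w | ~ exists b, X (-1) w = sgb R b].
pose N2 (x : pidx N) := [set w | ~ exists2 t, (t < m)%N &
   @circ_arc R m t (plane (X (pidx_val x)%:Z w))].
pose Bx (bz : bool * {ffun pidx N -> 'I_m}) :=
  [set w | A' (sgb R bz.1) (dpt R bz.2) /\ box bz.1 bz.2 w].
apply: (@le_trans _ _ (out (N1 `|` ([set w | exists x, N2 x w] `|` [set w | exists bz, Bx bz w])))).
  apply: out_le => w /= Aw.
  have [n1|/contrapT[b hb]] := pselect (N1 w); first by left.
  right; have [n2|n2] := pselect (exists x, N2 x w); [by left|right].
  have cov (x : pidx N) : exists t : 'I_m, @circ_arc R m t (plane (X (pidx_val x)%:Z w)).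
    have [[t tm ht]|h] := pselect (exists2 t, (t < m)%N &
      circ_arc m t (plane (X (pidx_val x)%:Z w))); first by exists (Ordinal tm).
    by case: n2; exists x.
  have [f hf] := choice cov.
  exists (b, [ffun x => f x]); split=> /=; last by split=> // x; rewrite ffunE.
  rewrite hb in Aw; apply: (AA' _ _ _ Aw); rewrite ?nc_sgb // => x.
  - exact: arc_nc (hf x).
  - exact: nc_dpt.
  - by rewrite /dpt ffunE; apply: arc_close.
apply: le_trans (out_U2 _ _) _; rewrite out_sign_null add0e.
apply: le_trans (out_U2 _ _) _.
apply: (@le_trans _ _ (\sum_x out (N2 x) + \sum_bz out (Bx bz))%E).
  by apply: leeD; exact: out_fin.
rewrite big1 => [|x _]; last exact: out_arc_null.
rewrite add0e /cnt mulr_suml -sumEFin; apply: lee_sum => bz _.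
case: asboolP => [h|h].
  rewrite mul1r; apply: le_trans (out_box bz.1 bz.2).
  by apply: out_le => w [].
rewrite mul0r (_ : Bx bz = set0) ?mu_ext0 //.
by apply/seteqP; split=> w //= [].
Qed.

End Model.
End RandomBoxes.

(** * Tail of the random series *)

Section RandomTail.
Context (R : realType) (d : measure_display) (T : measurableType d)
  (P : probability T R) (X : int -> T -> R[i]) (HX : random_model P X).
Local Notation out := (mu_ext P).
Local Notation Xn w := (cmul (fun p : nat => X p%:Z w)).

Lemma tsum_dist (c Y Y' : nat -> R[i]) (b : nat) (a : nat) (al e : R) :
  (forall n, (0 < n)%N -> nc (c n) <= 4 / n%:R) ->
  (forall n, (0 < n <= b)%N -> nc (Y n - Y' n) <= n%:R * e) -> 0 <= e ->
  nc (tsum c Y a b al - tsum c Y' a b al) <= 4 * b%:R * e.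
Proof.
move=> cB YY e0; rewrite /tsum -sumrB; apply: le_trans (nc_sum _ _ _) _.
apply: (@le_trans _ _ (\sum_(a.+1 <= n < b.+1) 4 * e)).
  rewrite !big_nat; apply: ler_sum => n /andP[an nb].
  have n0 : (0 < n)%N by apply: leq_ltn_trans an.
  have nR : 0 < n%:R :> R by rewrite ltr0n.
  rewrite -mulrBl -mulrBr !Normc.normcM nc_cis1 mulr1.
  have -> : 4 * e = 4 / n%:R * (n%:R * e) by field; exact: lt0r_neq0.
  by apply: ler_pM; rewrite ?nc_ge0 ?cB ?YY ?n0.
rewrite sumr_const_nat subSS -[leLHS]mulr_natr.
have -> : 4 * b%:R * e = 4 * e * b%:R by ring.
by rewrite ler_wpM2l ?mulr_ge0 // ler_nat leq_subr.
Qed.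

Lemma eq_tsum (c Y Y' : nat -> R[i]) (a b : nat) (al : R) :
  (forall n, (0 < n <= b)%N -> Y n = Y' n) -> tsum c Y a b al = tsum c Y' a b al.
Proof.
move=> YY'; rewrite /tsum !big_nat; apply: eq_bigr => n /andP[an nb].
by rewrite YY' // (leq_ltn_trans _ an).
Qed.

Lemma cnt_pair (I : finType) (Q : I -> Prop) :
  cnt R (fun bz : bool * I => Q bz.2) = 2 * cnt R Q.
Proof.
rewrite /cnt -(pair_bigA _ (fun (b : bool) (i : I) => (`[< Q i >])%:R)) /=.
by rewrite big_bool /=; ring.
Qed.

(** [second_moment_le] concerns finite families, so the estimate is transferred from roots of unity.
    Their order [m] exceeds [N] for exact orthogonality and is at least [M], so that rounding costs
    at most half of the threshold; the constant does not depend on [m]. *)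
Lemma out_bad : exists2 C : R, 0 < C & forall (c : nat -> R[i]) (j : nat), (0 < j)%N ->
  (forall n, (0 < n)%N -> nc (c n) <= 4 / n%:R) ->
  (out [set w | bad c (Xn w) j 1] <= (C / (j * j.+1)%N%:R)%:E)%E.
Proof.
have [C C0 Cbad] := bad_block R; exists C => // c j j0 cB.
set N := (j.+1 ^ 20 * j.+1 ^ 20)%N; set x := (j.+1 ^ 20)%N.
have xN : (x <= N)%N by rewrite /N leq_pmulr // expn_gt0.
pose r := #|pidx N|; have jj0 : 0 < (j * j.+1)%N%:R :> R by rewrite ltr0n muln_gt0 j0.
pose M : R := 128 * x%:R * r%:R * (j * j.+1)%N%:R.
have M0 : 0 <= M.
  exact: mulr_ge0 (mulr_ge0 (mulr_ge0 (ler0n _ 128) (ler0n _ _)) (ler0n _ _)) (ler0n _ _).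
pose m := (N + (Num.truncn M).+1)%N.
have Nm : (N < m)%N by rewrite /m -[X in (X < _)%N]addn0 ltn_add2l.
have m0 : (0 < m)%N by apply: leq_ltn_trans Nm.
have mR : 0 < m%:R :> R by rewrite ltr0n.
have Mm : M <= m%:R.
  have /andP[_ h] := truncn_itv M0; apply: le_trans (ltW h) _.
  by rewrite ler_nat leq_addl.
pose A (s : R[i]) (u : pidx N -> R[i]) := bad c (cmulI u) j 1.
pose A' (s : R[i]) (v : pidx N -> R[i]) := bad c (cmulI v) j 2^-1.
have AA' s u v : A s u -> nc s = 1 -> (forall x, nc (u x) = 1) -> (forall x, nc (v x) = 1) ->
     (forall x, nc (u x - v x) <= 16 / m%:R) -> A' s v.
  move=> [al al01 h] _ u1 v1 uv; exists al => //.
  have e0 : 0 <= r%:R * (16 / m%:R) :> R.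
    exact: mulr_ge0 (ler0n _ _) (divr_ge0 (ler0n _ 16) (ler0n _ _)).
  have dist n : (0 < n <= x)%N -> nc (cmulI u n - cmulI v n) <= n%:R * (r%:R * (16 / m%:R)).
    move=> _; apply: le_trans (cmulI_dist _ _ _) _; first by move=> y; rewrite u1.
      by move=> y; rewrite v1.
    rewrite ler_wpM2l //; apply: (@le_trans _ _ (\sum_(y : pidx N) 16 / m%:R)).
      by apply: ler_sum => y _; exact: uv.
    by rewrite sumr_const -/r [leRHS]mulr_natl.
  have D := tsum_dist (j ^ 20) al cB dist e0.
  have De : 4 * x%:R * (r%:R * (16 / m%:R)) <= 2^-1 / (j * j.+1)%N%:R :> R.
    have e (a b g k : R) : k != 0 -> 4 * a * (b * (16 / k)) * g = 2^-1 * (128 * a * b * g) / k.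
      by move=> k0; field.
    by rewrite ler_pdivlMr // e ?lt0r_neq0 // ler_pdivrMr // ler_pM2l ?invr_gt0.
  have := nc_leD (tsum c (cmulI u) (j ^ 20) x al) (tsum c (cmulI v) (j ^ 20) x al).
  have := le_trans D De; move: h; rewrite -/x mul1r => h.
  move: h; move: ((j * j.+1)%N%:R^-1 : R) (nc (_ - _)) (nc (tsum c (cmulI u) _ _ _))
    (nc (tsum c (cmulI v) _ _ _)) => a b e f; clear; lra.
apply: (@le_trans _ _ (out [set w | A (X (-1) w) (fun x => X (pidx_val x)%:Z w)])).
  apply: out_le => w /= [al al01 h]; exists al => //.
  rewrite -(@eq_tsum c (Xn w)) // => n /andP[n0 nx].
  by apply: cmul_cmulI; rewrite n0 (leq_trans nx).
apply: le_trans (random_to_disc HX m0 AA') _; rewrite lee_fin.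
rewrite (cnt_pair (fun z : {ffun pidx N -> 'I_m} => bad c (cmulI (dpt R z)) j 2^-1)) invfM mulrACA divff // mul1r ler_pdivrMr ?exprn_gt0 //.
have := Cbad _ (fun (z : {ffun pidx N -> 'I_m}) n => cmulI (dpt R z) n) c j 1 j0.
rewrite card_ffun card_ord natrX; apply => //.
- by move=> w n k n0 k0; exact: cmulIM.
- by move=> w n; apply: nc_cmulI_le1 => y; rewrite nc_dpt.
- exact: dpt_second_moment.
rewrite ler01 /=; have : 1 <= j.+1%:R ^+ 6 :> R by rewrite exprn_ege1 // ler1n.
by move: (_ ^+ 6) => a; lra.
Qed.

Lemma out_bigcup_bound (A : nat -> set T) (f : nat -> R) (B : R) :
  (forall n, (out (A n) <= (f n)%:E)%E) ->
  (forall n, \sum_(0 <= k < n) f k <= B) ->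
  (out (\bigcup_n A n) <= B%:E)%E.
Proof.
move=> Af fB; apply: le_trans (mu_ext_sigma_subadditive _ _) _ => //.
apply: lime_le.
  by apply: is_cvg_nneseries => n _ _; apply: mu_ext_ge0 => ?; exact: measure_ge0.
apply: nearW => n; apply: (@le_trans _ _ (\sum_(0 <= k < n) (f k)%:E)%E).
  by apply: lee_sum => k _; exact: Af.
by rewrite sumEFin lee_fin.
Qed.

Lemma out_not_unimodular :
  out [set w | ~ (nc (X (-1) w) = 1 /\ forall p : nat, prime p -> nc (X p%:Z w) = 1)] = 0%E.
Proof.
apply/eqP; rewrite eq_le mu_ext_ge0 ?andbT //.
pose A (n : nat) : set T := if n is p.+1 then [set w | prime p /\ ~ nc (X p%:Z w) = 1]
  else [set w | ~ exists b, X (-1) w = sgb R b].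
apply: (@le_trans _ _ (out (\bigcup_n A n))).
  apply: out_le => w /= h; apply: contrapT => nA; apply: h; split.
    have [[b ->]|nb] := pselect (exists b, X (-1) w = sgb R b); first exact: nc_sgb.
    by case: nA; exists 0%N.
  by move=> p pp; apply: contrapT => np; apply: nA; exists p.+1.
apply: (out_bigcup_bound (f := fun=> 0)) => [[|p]|n]; last by rewrite big1.
  by rewrite /A (out_sign_null HX).
rewrite /A; have [pp|np] := boolP (prime p); last first.
  by rewrite (_ : [set _ | _] = set0) ?mu_ext0 //; apply/seteqP; split=> w //= [].
have [x <-] := pidx_surj pp (leqnn p).
(* With a single arc, covering just says that the value lies on the unit circle. *)
apply: (@le_trans _ _ 0%E) => //; rewrite -(out_arc_null HX x (ltn0Sn 0)).
apply: out_le => w /= [_ n1] [t _ h].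
exact: n1 (arc_nc h).
Qed.

(** The mean value bound for powers, multiplied by [x] to avoid the exponent n - 1. *)
Lemma exp_sub_le (n : nat) (x y : R) : 0 <= y <= x ->
  x * (x ^+ n - y ^+ n) <= n%:R * x ^+ n * (x - y).
Proof.
move=> /andP[y0 yx]; have x0 : 0 <= x by apply: le_trans yx.
elim: n => [|n IH]; first by rewrite !expr0 subrr mulr0 mul0r mul0r.
have -> : x * (x ^+ n.+1 - y ^+ n.+1) =
   x * (x * (x ^+ n - y ^+ n)) + x * (y ^+ n * (x - y)) by rewrite !exprS; ring.
rewrite -[n.+1%:R]natr1 mulrDl mulrDl; apply: lerD.
  by apply: le_trans (ler_wpM2l x0 IH) _; rewrite exprS le_eqVlt; apply/orP; left; apply/eqP; ring.
rewrite mul1r exprS -mulrA ler_wpM2l // ler_wpM2r ?subr_ge0 //.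
by rewrite lerXn2r // nnegrE.
Qed.

(** A block has O(K^19) terms of size O(K^-20), so an incomplete last block can be bounded by
    absolute values. *)
Lemma block_length (K : nat) : (0 < K)%N ->
  ((K.+1 ^ 20)%N%:R - (K ^ 20)%N%:R) / (K ^ 20)%N%:R <= 20 * 2 ^+ 20 / K%:R :> R.
Proof.
move=> K0; have KR : 0 < K%:R :> R by rewrite ltr0n.
have K1 : 0 < K.+1%:R :> R by rewrite ltr0n.
rewrite !natrX ler_pdivrMr ?exprn_gt0 //.
have := @exp_sub_le 20 K.+1%:R K%:R; rewrite ler0n ler_nat leqnSn => /(_ isT).
have -> : K.+1%:R - K%:R = 1 :> R by rewrite -natr1 addrC addKr.
rewrite mulr1 => h.
apply: (@le_trans _ _ (20 * K.+1%:R ^+ 20 / K.+1%:R)).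
  by rewrite ler_pdivlMr // mulrC.
have -> : 20 * 2 ^+ 20 / K%:R * K%:R ^+ 20 = 20 * (2 * K%:R) ^+ 20 / K%:R :> R.
  have e (a b c k : R) : a * b / k * c = a * (b * c) / k by ring.
  by rewrite e -exprMn.
apply: ler_pM; rewrite ?invr_ge0 ?mulr_ge0 ?exprn_ge0 //.
  rewrite ler_wpM2l // lerXn2r ?nnegrE ?mulr_ge0 //.
  by rewrite -natr1; have : 1 <= K%:R :> R; [rewrite ler1n|lra].
by rewrite lef_pV2 ?posrE // ler_nat.
Qed.

(** This gives access to the [limn] in [S_series]: completeness is used for real and imaginary
    parts, and the limit found is tied to [limn] with error bounds in terms of the real-valued
    modulus. *)
Lemma complex_cauchy (u : nat -> R[i]) :
  (forall e : R, 0 < e -> exists n, forall m k, (n <= m)%N -> (n <= k)%N ->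
     nc (u m - u k) <= e) ->
  exists2 l, limn (u : nat -> R[i]^o) = l &
    forall e : R, 0 < e -> exists n, forall m, (n <= m)%N -> nc (u m - l) <= e.
Proof.
move=> cau.
have cauR (f : R[i] -> R) : (forall z w, `|f z - f w| <= nc (z - w)) ->
    exists l : R, forall e : R, 0 < e -> exists n, forall m, (n <= m)%N -> `|f (u m) - l| <= e.
  move=> fB; pose v n := f (u n).
  have cv : cvgn v.
    apply/cauchy_cvgP/cauchy_ballP => e e0.
    have [|n hn] := cau (e / 2); first by rewrite divr_gt0.
    exists ([set v k | k in [set k | (n <= k)%N]], [set v k | k in [set k | (n <= k)%N]]).
      by split; exists n => // k /= nk; exists k.
    move=> [a b] /= [[k nk <-] [m nm <-]]; rewrite /ball /=.
    apply: le_lt_trans (fB _ _) _; apply: le_lt_trans (hn _ _ nk nm) _; lra.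
  exists (limn v) => e e0; have /cvgrPdist_le /(_ e e0) [n _ hn] := cv.
  by exists n => m nm; rewrite distrC; exact: hn.
have [a ha] : exists l : R, forall e : R, 0 < e ->
    exists n, forall m, (n <= m)%N -> `|complex.Re (u m) - l| <= e.
  by apply: cauR => z w; rewrite -raddfB; exact: nc_Re.
have [b hb] : exists l : R, forall e : R, 0 < e ->
    exists n, forall m, (n <= m)%N -> `|complex.Im (u m) - l| <= e.
  by apply: cauR => z w; rewrite -raddfB; exact: nc_Im.
pose l : R[i] := Complex a b.
have lim e : 0 < e -> exists n, forall m, (n <= m)%N -> nc (u m - l) <= e.
  move=> e0; have e2 : 0 < e / 2 by rewrite divr_gt0.
  have [n1 h1] := ha _ e2; have [n2 h2] := hb _ e2.
  exists (maxn n1 n2) => m; rewrite geq_max => /andP[m1 m2].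
  apply: le_trans (nc_le_ReIm _) _; rewrite !raddfB /=.
  by have := h1 _ m1; have := h2 _ m2; lra.
exists l => //; apply: cvg_lim; first exact: norm_hausdorff.
apply/cvgrPdist_le => -[e i]; rewrite ltcE /= => /andP[/eqP -> e0].
have [n hn] := lim _ e0; exists n => // m /= nm.
rewrite normc_def -[(_ +i* 0)%C]/(e%:C%C) lecR.
by have := hn _ nm; rewrite nc_distC; case: (l - u m).
Qed.

Definition cinv (n : nat) : R[i] := n%:R^-1.
Definition cinvN (n : nat) : R[i] := - n%:R^-1.

Lemma nc_cinv n : nc (cinv n) = n%:R^-1.
Proof. by rewrite /cinv Normc.normcV nc_nat. Qed.

Lemma nc_cinvN n : nc (cinvN n) = n%:R^-1.
Proof. by rewrite /cinvN ncN -/(cinv n) nc_cinv. Qed.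

(** The first 4 is for the complete blocks beyond J, the rest for the incomplete block containing
    the cut. *)
Definition tail_const : R := 4 + 4 * (20 * 2 ^+ 20).

Lemma tail_const_gt0 : 0 < tail_const.
Proof.
rewrite /tail_const; have : 0 < 2 ^+ 20 :> R by rewrite exprn_gt0.
by move: (2 ^+ 20) => a; lra.
Qed.

Lemma polS_tail (s : R[i]) (Y : nat -> R[i]) (J M : nat) (al : R) :
  nc s <= 1 -> (forall n, nc (Y n) <= 1) -> (0 < J)%N -> 0 <= al <= 1 ->
  (forall j, (J <= j)%N -> ~ bad cinv Y j 1 /\ ~ bad cinvN Y j 1) -> (J ^ 20 <= M)%N ->
  nc (polS s Y M al - polS s Y (J ^ 20) al) <= tail_const / J%:R.
Proof.
move=> s1 Y1 J0 al01 good JM.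
have [K /andP[KM MK]] := pow_root_exists M (isT : (0 < 20)%N).
have JK : (J <= K)%N by rewrite -ltnS -(@ltn_exp2r _ _ 20) // (leq_ltn_trans JM).
have K0 : (0 < K)%N by apply: leq_trans JK.
have JR : 0 < J%:R :> R by rewrite ltr0n.
have KR : 0 < K%:R :> R by rewrite ltr0n.
have K20 : 0 < (K ^ 20)%N%:R :> R by rewrite ltr0n expn_gt0 K0.
have JK20 : (J ^ 20 <= K ^ 20)%N by rewrite leq_exp2r.
have -> : polS s Y M al - polS s Y (J ^ 20) al =
    pol cinv cinvN s Y (J ^ 20) (K ^ 20) al + pol cinv cinvN s Y (K ^ 20) M al.
  rewrite -pol_cat ?JK20 // /polS -/cinv -/cinvN.
  by rewrite (pol_cat _ _ _ _ _ (b := J ^ 20) (c := M)) ?JM // addrC addKr.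
rewrite /tail_const mulrDl; apply: le_trans (ncD _ _) _; apply: lerD.
  rewrite -[4 in leRHS]mulr1; apply: pol_blocks_le => // j /andP[Jj _].
  exact: good.
apply: le_trans (pol_abs_le _ _ _ _ _ s1 Y1) _.
apply: (@le_trans _ _ (\sum_((K ^ 20).+1 <= n < M.+1) 4 / (K ^ 20)%N%:R)).
  rewrite !big_nat; apply: ler_sum => n /andP[Kn _].
  rewrite nc_cinv nc_cinvN.
  have : n%:R^-1 <= (K ^ 20)%N%:R^-1 :> R.
    by rewrite lef_pV2 ?posrE ?ltr0n ?(leq_ltn_trans _ Kn) ?expn_gt0 ?K0 // ler_nat ltnW.
  by move: (_^-1) (_^-1) => a b; lra.
rewrite sumr_const_nat subSS -[leLHS]mulr_natr natrB //.
have := block_length K0; move: (20 * 2 ^+ 20) => B hB.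
have B0 : 0 <= B.
  have h : 0 <= B / K%:R.
    apply: le_trans hB; rewrite divr_ge0 // subr_ge0 ler_nat leq_exp2r //.
  by move: h; rewrite pmulr_lge0 // invr_gt0.
apply: (@le_trans _ _ (4 * (B / K%:R))).
  rewrite -mulrA ler_pM2l //; apply: le_trans hB; rewrite mulrC.
  by rewrite ler_pM2r ?invr_gt0 // lerB // ler_nat ltnW.
rewrite -[leRHS]mulrA ler_pM2l // ler_wpM2l // lef_pV2 ?posrE // ler_nat //.
Qed.

Lemma S_partial_pol w M (al : R) :
  \sum_(1 <= n < M.+1) (S_term X w al n%:Z + S_term X w al (- n%:Z)) =
  polS (X (-1) w) (Xn w) M al.
Proof.
rewrite /polS /pol !big_nat; apply: eq_bigr => n /andP[n0 _].
rewrite /S_term /X_ext ltz_nat ltn0 mul1r abszN absz_nat oppr_lt0 ltz_nat n0.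
rewrite intrN mulNr -pmulrn -/(cmul (fun p : nat => X p%:Z w) n).
have -> : (n%:Z%:~R : R[i]) = n%:R by rewrite -pmulrn.
have -> : ((- n%:Z)%:~R : R[i]) = - n%:R by rewrite intrN -pmulrn.
by rewrite invrN; ring.
Qed.

Lemma S_series_tail w (J : nat) (al : R) :
  nc (X (-1) w) <= 1 -> (forall n, nc (Xn w n) <= 1) -> (0 < J)%N -> 0 <= al <= 1 ->
  (forall j, (J <= j)%N -> ~ bad cinv (Xn w) j 1 /\ ~ bad cinvN (Xn w) j 1) ->
  nc (S_series X w al - polS (X (-1) w) (Xn w) (J ^ 20) al) <= tail_const / J%:R.
Proof.
move=> s1 Y1 J0 al01 good.
pose u M := polS (X (-1) w) (Xn w) M al.
have tail J' M : (J <= J')%N -> (J' ^ 20 <= M)%N -> nc (u M - u (J' ^ 20)%N) <= tail_const / J'%:R.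
  move=> JJ' JM; apply: polS_tail => //; first exact: leq_trans JJ'.
  by move=> j J'j; apply: good; apply: leq_trans J'j.
have tc0 := tail_const_gt0.
have [|l lE ul] := @complex_cauchy u.
  move=> e e0; have t0 : 0 <= 2 * tail_const / e by rewrite divr_ge0 ?mulr_ge0 // ltW.
  have /andP[_ h] := truncn_itv t0.
  pose J' := maxn J (Num.truncn (2 * tail_const / e)).+1.
  have JJ' : (J <= J')%N by rewrite leq_maxl.
  have J'R : 0 < J'%:R :> R by rewrite ltr0n (leq_trans J0).
  have J'e : tail_const / J'%:R <= e / 2.
    have : 2 * tail_const / e <= J'%:R.
      by apply: le_trans (ltW h) _; rewrite ler_nat leq_maxr.
    by rewrite !ler_pdivrMr // => h2; rewrite mulrAC ler_pdivlMr //; lra.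
  exists (J' ^ 20)%N => m k Jm Jk.
  apply: le_trans (nc_dist_trans _ (u (J' ^ 20)%N) _) _; rewrite (nc_distC (u (J' ^ 20)%N)).
  by have := tail _ _ JJ' Jm; have := tail _ _ JJ' Jk; lra.
have -> : S_series X w al = l.
  rewrite -lE /S_series (_ : (fun N : nat => _) = u) //.
  by apply/funext => M; exact: S_partial_pol.
apply/ler_addgt0Pr => e e0; have [n hn] := ul _ e0.
have h1 := hn (maxn n (J ^ 20)) (leq_maxl _ _).
have h2 := tail _ (maxn n (J ^ 20)) (leqnn J) (leq_maxr _ _).
apply: le_trans (nc_dist_trans _ (u (maxn n (J ^ 20))) _) _.
by rewrite addrC; apply: lerD => //; rewrite nc_distC.
Qed.

Definition tail_small (J : nat) (D : R) (w : T) : Prop :=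
  [/\ nc (X (-1) w) = 1, forall p : nat, prime p -> nc (X p%:Z w) = 1 &
     forall al : R, 0 <= al <= 1 ->
       nc (S_series X w al - polS (X (-1) w) (Xn w) (J ^ 20) al) <= D].

(** Apart from a null set, the exceptional event lies in the union over j >= J of events of outer
    measure O(1 / j^2). Off this union the partial sums are Cauchy, so convergence of the series
    comes with the tail bound. *)
Lemma random_tail : exists2 D : R, 0 < D & forall J : nat, (0 < J)%N ->
  (out [set w | ~ tail_small J (D / J%:R) w] <= (D / J%:R)%:E)%E.
Proof.
have [C C0 hC] := out_bad; have tc0 := tail_const_gt0.
exists (tail_const + 2 * C); first by rewrite addr_gt0 // mulr_gt0.
move=> J J0; have JR : 0 < J%:R :> R by rewrite ltr0n.
pose U := [set w | ~ (nc (X (-1) w) = 1 /\ forall p : nat, prime p -> nc (X p%:Z w) = 1)].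
pose A n := [set w | bad cinv (Xn w) (J + n) 1 \/ bad cinvN (Xn w) (J + n) 1].
have DJ : tail_const / J%:R <= (tail_const + 2 * C) / J%:R.
  by rewrite ler_pM2r ?invr_gt0 // lerDl mulr_ge0 // ltW.
apply: (@le_trans _ _ (out (U `|` \bigcup_n A n))).
  apply: out_le => w /= h; have [Uw|/contrapT[s1 X1]] := pselect (U w); first by left.
  right; apply: contrapT => nA; apply: h; split=> // al al01.
  apply: le_trans DJ; apply: S_series_tail => //; first by rewrite s1.
    move=> n; rewrite nc_prod big_seq big1 // => p.
    by rewrite mem_primes => /andP[pp _]; rewrite ncX X1 // expr1n.
  move=> j Jj; split=> b; apply: nA; exists (j - J)%N => //; rewrite /A /= subnKC //.
    by left.
  by right.
apply: le_trans (out_U2 _ _ _) _; rewrite out_not_unimodular add0e.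
have c4 n : (0 < n)%N -> n%:R^-1 <= 4 / n%:R :> R.
  by move=> n0; rewrite ler_peMl ?invr_ge0 // ler1n.
apply: (out_bigcup_bound (f := fun n => 2 * C / ((J + n) * (J + n).+1)%N%:R)).
  move=> n; have Jn : (0 < J + n)%N by rewrite addn_gt0 J0.
  apply: le_trans (out_U2 _ _ _) _.
  have h1 := hC cinv (J + n)%N Jn; have h2 := hC cinvN (J + n)%N Jn.
  apply: (@le_trans _ _ ((C / ((J + n) * (J + n).+1)%N%:R)%:E + (C / ((J + n) * (J + n).+1)%N%:R)%:E)%E).
    apply: leeD; [apply: h1|apply: h2] => k k0; first by rewrite nc_cinv c4.
    by rewrite nc_cinvN c4.
  by rewrite -EFinD lee_fin; move: (_^-1) => v; lra.
move=> n; rewrite -mulr_sumr.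
apply: (@le_trans _ _ (2 * C * J%:R^-1)); last first.
  by rewrite ler_pM2r ?invr_gt0 // lerDr ltW.
rewrite ler_wpM2l ?mulr_ge0 ?(ltW C0) //.
have := sum_inv_consecutive R J0 (leq_addr n J).
rewrite -{1}[J]add0n big_addn addKn => E.
under eq_bigr do rewrite addnC.
by rewrite E gerBl invr_ge0.
Qed.

End RandomTail.

(** * Comparison of distribution functions *)

Section Comparison.
Context (R : realType).

Definition exceeds (N : nat) (u : R) (s : R[i]) (v : pidx N -> R[i]) : Prop :=
  exists2 al, 0 <= al <= 1 & u < nc (polS s (cmulI v) N al).

Lemma exceeds_dist (N : nat) (u e : R) (s : R[i]) (v w : pidx N -> R[i]) :
  nc s <= 1 -> (forall x, nc (v x) <= 1) -> (forall x, nc (w x) <= 1) ->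
  4 * N%:R * \sum_x nc (v x - w x) <= e ->
  exceeds u s v -> exceeds (u - e) s w.
Proof.
move=> s1 v1 w1 de [al al01 h]; exists al => //.
have := le_trans (polS_dist al s1 v1 w1) de.
rewrite ler_norml => /andP[_]; move: h.
by move: (nc (polS _ _ _ _)) (nc (polS _ _ _ _)) => a b; lra.
Qed.

Lemma nexceeds_dist (N : nat) (u e : R) (s : R[i]) (v w : pidx N -> R[i]) :
  nc s <= 1 -> (forall x, nc (v x) <= 1) -> (forall x, nc (w x) <= 1) ->
  4 * N%:R * \sum_x nc (v x - w x) <= e ->
  ~ exceeds u s v -> ~ exceeds (u + e) s w.
Proof.
move=> s1 v1 w1 de h h'; apply: h; rewrite -(addrK e u).
apply: (exceeds_dist s1 w1 v1 _ h').
by under eq_bigr do rewrite nc_distC.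
Qed.

Definition dprob (N m : nat) (Q : R[i] -> (pidx N -> R[i]) -> Prop) : R :=
  cnt R (fun bz : bool * {ffun pidx N -> 'I_m} => Q (sgb R bz.1) (dpt R bz.2)) /
  (2 * m%:R ^+ #|pidx N|).

Lemma dprob_not (N m : nat) (Q : R[i] -> (pidx N -> R[i]) -> Prop) : (0 < m)%N ->
  dprob m (fun s v => ~ Q s v) = 1 - dprob m Q.
Proof.
move=> m0; rewrite /dprob cnt_not mulrBl; congr (_ - _).
rewrite card_prod card_bool card_ffun card_ord natrM natrX divff //.
by rewrite mulf_neq0 ?pnatr_eq0 // expf_neq0 // pnatr_eq0 -lt0n.
Qed.

Section CharEvent.
Context (q : nat) (q_pr : prime q).

(** For u = 2 e^gamma tau this is m(chi) > tau in the scale of [S]; k = 0 is the principal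
    character. *)
Definition large_sum (u : R) (k : 'I_q.-1) : Prop := (0 < k)%N /\
  exists2 x, (0 < x <= q)%N &
    u < 2 * pi / Num.sqrt q%:R * nc (\sum_(1 <= n < x.+1) dchar R q_pr k n%:Z).

Let val N (k : 'I_q.-1) := fun x : pidx N => dchar R q_pr k (pidx_val x)%:Z.

Lemma polS_dchar (k : 'I_q.-1) N al :
  polS (dchar R q_pr k (-1)) (fun n => dchar R q_pr k n%:Z) N al =
  polS (dchar R q_pr k (-1)) (cmulI (@val N k)) N al.
Proof.
apply: eq_polS => n nN; rewrite dchar_cmul; last by case/andP: nN.
exact: cmul_cmulI.
Qed.

Lemma char_event (N m : nat) (e : R) (A A' : R[i] -> (pidx N -> R[i]) -> Prop) :
  (0 < m)%N -> (N < q)%N -> (2 * \prod_(x : pidx N) pidx_val x ^ m < q)%N -> 0 < e ->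
  4 * #|pidx N|%:R / (m%:R * (e / (4 * N%:R * #|pidx N|%:R + 1)) ^+ 2) <= e ->
  (forall s v w, nc s <= 1 -> (forall x, nc (v x) <= 1) -> (forall x, nc (w x) <= 1) ->
    4 * N%:R * \sum_x nc (v x - w x) <= e -> A s v -> A' s w) ->
  cnt R (fun k : 'I_q.-1 => A (dchar R q_pr k (-1)) (@val N k)) <= (dprob m A' + e) * q.-1%:R.
Proof.
move=> m0 Nq Mq e0 me AA'.
pose K : R := 4 * N%:R * #|pidx N|%:R + 1.
have K0 : 0 < K.
  by apply: ltr_wpDl => //; exact: mulr_ge0 (mulr_ge0 (ler0n _ 4) (ler0n _ _)) (ler0n _ _).
(* If the squared distances sum to at most dl^2, each distance is at most dl, and 4 N times their
   sum is at most e. *)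
pose dl := e / K; have dl0 : 0 < dl by rewrite divr_gt0.
pose B (s : R[i]) (v : pidx N -> R[i]) := [/\ nc s <= 1, forall x, nc (v x) <= 1 & A s v].
pose B' (s : R[i]) (w : pidx N -> R[i]) := (forall x, nc (w x) <= 1) -> A' s w.
have BB' s v w : B s v -> \sum_x nc (v x - w x) ^+ 2 <= dl ^+ 2 -> B' s w.
  move=> [s1 v1 Av] h w1; apply: (AA' _ _ _ s1 v1 w1 _ Av).
  have nd x : nc (v x - w x) <= dl.
    rewrite -(@ler_pXn2r _ 2) ?nnegrE ?nc_ge0 ?(ltW dl0) //; apply: le_trans h.
    by rewrite (bigD1 x) //= lerDl sumr_ge0 // => y _; rewrite exprn_ge0 ?nc_ge0.
  apply: (@le_trans _ _ (4 * N%:R * (#|pidx N|%:R * dl))).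
    apply: ler_wpM2l; first exact: mulr_ge0 (ler0n _ 4) (ler0n _ _).
    apply: le_trans (ler_sum _ (fun x _ => nd x)) _.
    by rewrite sumr_const [leRHS]mulr_natl.
  have -> : 4 * N%:R * (#|pidx N|%:R * dl) = (K - 1) * dl by rewrite /K; ring.
  rewrite mulrBl mul1r {1}/dl mulrCA divff ?lt0r_neq0 // mulr1.
  by rewrite gerBl ltW.
apply: (@le_trans _ _ (cnt R (fun k : 'I_q.-1 => B (dchar R q_pr k (-1)) (@val N k)))).
  apply: cnt_le => k Ak; split => //; last by move=> x; rewrite nc_dchar_pidx.
  by have [b ->] := dcharN1_sign R q_pr k; rewrite nc_sgb.
apply: le_trans (char_to_disc q_pr m0 Nq Mq (exprn_gt0 2 dl0) BB') _.
apply: ler_wpM2r => //; apply: lerD => //.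
apply: ler_wpM2r; first by rewrite invr_ge0; exact: mulr_ge0 (ler0n _ 2) (exprn_ge0 _ (ler0n _ _)).
by apply: cnt_le => bz; apply => x; rewrite nc_dpt.
Qed.

Let devbad (N : nat) (e : R) (k : 'I_q.-1) : Prop :=
  (0 < k)%N /\ exists2 x, (x <= q)%N & e < char_sum_dev R q_pr k N x.

Lemma large_sum_exceeds (N : nat) (e u : R) k : large_sum u k ->
  devbad N e k \/ exceeds (u - e) (dchar R q_pr k (-1)) (@val N k).
Proof.
move=> [k0 [x /andP[x0 xq] h]].
have [dev|dev] := ltP e (char_sum_dev R q_pr k N x); first by left; split=> //; exists x.
right; exists (x%:R / q%:R).
  by rewrite divr_ge0 //= ler_pdivrMr ?ltr0n ?prime_gt0 // mul1r ler_nat.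
move: dev; rewrite /char_sum_dev polS_dchar ler_norml => /andP[_]; move: h.
by move: (2 * pi / _ * _) (nc (polS _ _ _ _)) => a b; lra.
Qed.

Lemma nlarge_sum_exceeds (N : nat) (e u : R) k : (N < q)%N -> 0 < e ->
  32 * N%:R / q%:R <= e ->
  ~ large_sum u k ->
  ((k = 0 :> nat) \/ devbad N e k) \/ ~ exceeds (u + 2 * e) (dchar R q_pr k (-1)) (@val N k).
Proof.
move=> Nq e0 Nqe nk; have [k0|k0] := posnP k; first by left; left.
have [dev|ndev] := pselect (devbad N e k); first by left; right.
right=> -[al al01 h]; apply: nk; split=> //.
have q0 := prime_gt0 q_pr.
have dev x : (x <= q)%N -> char_sum_dev R q_pr k N x <= e.
  by move=> xq; rewrite leNgt; apply/negP => ?; apply: ndev; split=> //; exists x.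
have [t] := sample_point q0 al01; rewrite ltnS => tq alt.
have s1 : nc (dchar R q_pr k (-1)) <= 1.
  by have [b ->] := dcharN1_sign R q_pr k; rewrite nc_sgb.
have v1 n : nc (cmulI (@val N k) n) <= 1.
  by apply: nc_cmulI_le1 => x; rewrite nc_dchar_pidx.
have lip : 32 * N%:R * `|al - t%:R / q%:R| <= e.
  apply: le_trans Nqe; apply: ler_wpM2l => //; exact: mulr_ge0 (ler0n _ 32) (ler0n _ _).
have := le_trans (polS_lip N al (t%:R / q%:R) s1 v1) lip.
have := dev _ tq; rewrite /char_sum_dev polS_dchar !ler_norml => /andP[_ d2] /andP[d3 d4].
have key : u < 2 * pi / Num.sqrt q%:R * nc (\sum_(1 <= n < t.+1) dchar R q_pr k n%:Z).
  have := dev _ tq; rewrite /char_sum_dev polS_dchar ler_norml => /andP[d1 _].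
  move: d1 d4 h; move: (2 * pi / _ * _) (nc (polS _ _ _ _)) (nc (polS _ _ _ _)) => a b c; lra.
(* Rounding may give t = 0, which [large_sum] excludes. The empty sum then forces u < 0, and x = 1
   serves. *)
have [t0|t0] := posnP t; last by exists t; rewrite ?t0.
move: key; rewrite t0 big_geq // nc0 mulr0 => u0; exists 1%N; first by rewrite q0.
apply: lt_le_trans u0 _; rewrite mulr_ge0 ?nc_ge0 // divr_ge0 ?sqrtr_ge0 //.
by rewrite mulr_ge0 ?pi_ge0.
Qed.

Section Bounds.
Context (N m : nat) (e : R) (m0 : (0 < m)%N) (Nq : (N < q)%N)
  (Mq : (2 * \prod_(x : pidx N) pidx_val x ^ m < q)%N) (e0 : 0 < e)
  (me : 4 * #|pidx N|%:R / (m%:R * (e / (4 * N%:R * #|pidx N|%:R + 1)) ^+ 2) <= e)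
  (dq : cnt R (devbad N e) <= e * q.-1%:R).

Lemma large_sum_upper u :
  cnt R (large_sum u) <= (dprob m (@exceeds N (u - 2 * e)) + 2 * e) * q.-1%:R.
Proof.
apply: le_trans (cnt_le R (fun k => @large_sum_exceeds N e u k)) _.
apply: le_trans (cnt_or _ _ _) _.
have := char_event (A := @exceeds N (u - e)) m0 Nq Mq e0 me
  (fun s v w s1 v1 w1 h => exceeds_dist s1 v1 w1 h).
rewrite -addrA -opprD -[e + e]mulr2n -[e *+ 2]mulr_natl => h.
by move: (lerD dq h); rewrite !mulrDl => h'; apply: le_trans h' _; lra.
Qed.

Lemma nlarge_sum_upper u : 32 * N%:R / q%:R <= e -> 1 <= e * q.-1%:R ->
  cnt R (fun k => ~ large_sum u k) <=
  (dprob m (fun s v => ~ @exceeds N (u + 3 * e) s v) + 3 * e) * q.-1%:R.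
Proof.
move=> Nqe eq1.
apply: le_trans (cnt_le R (fun k => @nlarge_sum_exceeds N e u k Nq e0 Nqe)) _.
apply: le_trans (cnt_or _ _ _) _.
have h1 := cnt_or R (fun k : 'I_q.-1 => k = 0 :> nat) (devbad N e).
have h0 : cnt R (fun k : 'I_q.-1 => k = 0 :> nat) <= 1.
  rewrite /cnt -natr_sum -[1]/(1%:R) ler_nat.
  have q1 : (0 < q.-1)%N by rewrite -ltnS prednK ?prime_gt0 ?prime_gt1.
  rewrite (bigD1 (Ordinal q1)) //= big1 => [|k kn]; first by rewrite addn0 leq_b1.
  by rewrite asboolF // => k0; case/eqP: kn; apply: val_inj.
have := char_event (A := fun s v => ~ @exceeds N (u + 2 * e) s v) m0 Nq Mq e0 me
  (fun s v w s1 v1 w1 h => nexceeds_dist s1 v1 w1 h).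
have -> : u + 2 * e + e = u + 3 * e by ring.
move=> h; apply: le_trans (lerD h1 h) _; move: h0 dq eq1.
rewrite !mulrDl -mulrA.
by move: (cnt R _) (cnt R _) (_ * _) (_ * _) => a b c g; lra.
Qed.

End Bounds.
End CharEvent.

Section RandomEvent.
Context (d : measure_display) (T : measurableType d)
  (P : probability T R) (X : int -> T -> R[i]) (HX : random_model P X).
Local Notation out := (mu_ext P).

Lemma random_event (J m : nat) (D e : R) (Ev : set T)
    (A A' : R[i] -> (pidx (J ^ 20) -> R[i]) -> Prop) : (0 < m)%N ->
  (out [set w | ~ tail_small X J D w] <= D%:E)%E ->
  4 * (J ^ 20)%N%:R * (#|pidx (J ^ 20)|%:R * (16 / m%:R)) <= e ->
  (forall w, tail_small X J D w -> Ev w ->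
     A (X (-1) w) (fun x => X (pidx_val x)%:Z w)) ->
  (forall s v w, nc s <= 1 -> (forall x, nc (v x) <= 1) -> (forall x, nc (w x) <= 1) ->
    4 * (J ^ 20)%N%:R * \sum_x nc (v x - w x) <= e -> A s v -> A' s w) ->
  (out Ev <= (dprob m A' + D)%:E)%E.
Proof.
move=> m0 tD me EvA AA'.
apply: (@le_trans _ _ (out ([set w | A (X (-1) w) (fun x => X (pidx_val x)%:Z w)] `|`
    [set w | ~ tail_small X J D w]))).
  apply: out_le => w Ew; have [t|t] := pselect (tail_small X J D w); last by right.
  by left; exact: EvA.
apply: le_trans (out_U2 _ _ _) _; rewrite EFinD; apply: leeD => //.
apply: (random_to_disc HX) => // s v w Asv s1 v1 w1 vw.
apply: (AA' s v w) => //; rewrite ?s1 //; try by move=> x; rewrite ?v1 ?w1.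
apply: le_trans me; apply: ler_wpM2l; first exact: mulr_ge0 (ler0n _ 4) (ler0n _ _).
apply: le_trans (ler_sum _ (fun x _ => vw x)) _.
by rewrite sumr_const [leRHS]mulr_natl.
Qed.

Lemma tail_small_polS (J : nat) (D : R) w al : tail_small X J D w -> 0 <= al <= 1 ->
  `|nc (S_series X w al) -
    nc (polS (X (-1) w) (cmulI (fun x : pidx (J ^ 20) => X (pidx_val x)%:Z w)) (J ^ 20) al)| <= D.
Proof.
move=> [_ _ h] al01; apply: le_trans (h al al01).
apply: le_trans (nc_dist_dist _ _) _.
rewrite -(@eq_polS R _ (cmul (fun p : nat => X p%:Z w))) // => n nN.
exact: cmul_cmulI.
Qed.

Context (J m : nat) (D e : R) (m0 : (0 < m)%N) (De : D <= e)
  (tD : (out [set w | ~ tail_small X J D w] <= D%:E)%E)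
  (me : 4 * (J ^ 20)%N%:R * (#|pidx (J ^ 20)|%:R * (16 / m%:R)) <= e).

Lemma S_max_upper (u : R) : (out [set w | (u%:E < S_max X w)%E] <=
  (dprob m (@exceeds (J ^ 20) (u - 2 * e)) + e)%:E)%E.
Proof.
have -> : u - 2 * e = u - e - e by ring.
apply: (@le_trans _ _ (dprob m (@exceeds (J ^ 20) (u - e - e)) + D)%:E); last first.
  by rewrite lee_fin lerD2l.
apply: (random_event (A := @exceeds (J ^ 20) (u - e)) m0 tD me); last first.
  by move=> s v w s1 v1 w1 h; exact: exceeds_dist.
move=> w tw /= /ereal_sup_gtP[_ [al al01 <-]]; rewrite lte_fin => h.
exists al => //; have := le_trans (tail_small_polS tw al01) De.
rewrite ler_norml => /andP[_]; move: h.
by move: (nc (S_series _ _ _)) (nc (polS _ _ _ _)) => a b; lra.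
Qed.

Lemma nS_max_upper (u : R) : (out [set w | ~ (u%:E < S_max X w)%E] <=
  (dprob m (fun s v => ~ @exceeds (J ^ 20) (u + 2 * e) s v) + e)%:E)%E.
Proof.
have -> : u + 2 * e = u + e + e by ring.
apply: (@le_trans _ _ (dprob m (fun s v => ~ @exceeds (J ^ 20) (u + e + e) s v) + D)%:E); last first.
  by rewrite lee_fin lerD2l.
apply: (random_event (A := fun s v => ~ @exceeds (J ^ 20) (u + e) s v) m0 tD me); last first.
  by move=> s v w s1 v1 w1 h; exact: nexceeds_dist.
move=> w tw /= nS [al al01 h]; apply: nS; apply/ereal_sup_gtP.
exists (nc (S_series X w al))%:E; first by exists al.
have := le_trans (tail_small_polS tw al01) De.
rewrite lte_fin ler_norml => /andP[+ _]; move: h.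
by move: (nc (S_series _ _ _)) (nc (polS _ _ _ _)) => a b; lra.
Qed.

Lemma out_setC_ge (A : set T) : (1 <= out A + out [set w | ~ A w])%E.
Proof.
apply: le_trans (out_U2 P A [set w | ~ A w]).
by rewrite (_ : _ `|` _ = setT) ?out_measurable ?probability_setT //; exact: setUv.
Qed.

End RandomEvent.

Lemma div_nat_small (c e : R) : 0 < e ->
  exists2 n0, (0 < n0)%N & forall n, (n0 <= n)%N -> c / n%:R <= e.
Proof.
move=> e0; pose n0 := (Num.truncn (`|c| / e)).+1; exists n0 => // n n0n.
have nR : 0 < n%:R :> R by rewrite ltr0n (leq_trans _ n0n).
have /andP[_ h] := truncn_itv (divr_ge0 (normr_ge0 c) (ltW e0)).
have : `|c| / e <= n%:R by apply: le_trans (ltW h) _; rewrite ler_nat.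
rewrite !ler_pdivrMr // => h2; apply: le_trans (ler_norm c) _.
by rewrite mulrC.
Qed.

(** Each inequality joins an upper bound for one side with an upper bound for the complement of the
    other, at a common level of the discrete model: u + 3 e in the first, u - 2 e in the second. The
    parameters are chosen in the order J, m, q. *)
Lemma char_random_sandwich (d : measure_display) (T : measurableType d)
    (P : probability T R) (X : int -> T -> R[i]) (HX : random_model P X) (e : R) : 0 < e ->
  exists q0, forall q (q_pr : prime q), (q0 <= q)%N -> forall u,
    (mu_ext P [set w | ((u + 5 * e)%:E < S_max X w)%E] <=
      (cnt R (large_sum q_pr u) / q.-1%:R + 4 * e)%:E)%E /\
    ((cnt R (large_sum q_pr u) / q.-1%:R)%:E <=
      mu_ext P [set w | ((u - 4 * e)%:E < S_max X w)%E] + (3 * e)%:E)%E.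
Proof.
move=> e0; have [D D0 tD] := random_tail HX.
have [J1 J10 hJ1] := div_nat_small D e0.
have [J0 hJ0] := char_approx e0.
pose J := maxn J0 J1.
have J_gt0 : (0 < J)%N by rewrite leq_max J10 orbT.
have De : D / J%:R <= e by apply: hJ1; rewrite leq_maxr.
have [q1 hq1] := hJ0 J (leq_maxl _ _).
pose N := (J ^ 20)%N; pose r : R := #|pidx N|%:R.
pose dl := e / (4 * N%:R * r + 1).
have [m1 m10 hm1] := div_nat_small (4 * N%:R * (r * 16)) e0.
have [m2 _ hm2] := div_nat_small (4 * r / dl ^+ 2) e0.
pose m := maxn m1 m2.
have m0 : (0 < m)%N by rewrite leq_max m10.
have me1 : 4 * N%:R * (r * (16 / m%:R)) <= e.
  by have := hm1 m (leq_maxl _ _); rewrite !mulrA.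
have me2 : 4 * r / (m%:R * dl ^+ 2) <= e.
  have := hm2 m (leq_maxr _ _); rewrite -[leLHS]mulrA.
  by have -> (a b c : R) : a * (b^-1 * c^-1) = a / (c * b) by rewrite -invfM (mulrC b).
have [q2 _ hq2] := div_nat_small (32 * N%:R) e0.
have [q3 q30 hq3] := div_nat_small 1 e0.
exists (\max_(n <- [:: q1; q2; q3.+1; N.+1; (2 * \prod_(x : pidx N) pidx_val x ^ m).+1]) n).
move=> q q_pr; rewrite !big_cons big_nil maxn0 !geq_max.
case/and5P=> q1q q2q q3q Nq Mq u.
have qR : 0 < q.-1%:R :> R by rewrite ltr0n -ltnS prednK ?prime_gt0 ?prime_gt1.
have q1R : 1 <= e * q.-1%:R.
  rewrite -ler_pdivrMr //; apply: hq3.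
  by rewrite -ltnS prednK // prime_gt0.
have dq := hq1 q q_pr q1q.
have Nqe := hq2 q q2q.
have cU := large_sum_upper m0 Nq Mq e0 me2 dq u.
have cL := nlarge_sum_upper m0 Nq Mq e0 me2 dq u Nqe q1R.
rewrite -!ler_pdivrMr // in cU cL.
have sU := S_max_upper HX m0 De (tD J J_gt0) me1.
have sL := nS_max_upper HX m0 De (tD J J_gt0) me1.
rewrite cnt_not card_ord mulrBl divff ?lt0r_neq0 // dprob_not // in cL.
split.
  apply: le_trans (sU _) _; rewrite lee_fin.
  have -> : u + 5 * e - 2 * e = u + 3 * e by ring.
  by move: cL; rewrite -/N; move: (dprob _ _) (cnt R _ / _) => a b; lra.
have := sL (u - 4 * e); have -> : u - 4 * e + 2 * e = u - 2 * e by ring.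
rewrite dprob_not // => h.
have := le_trans (out_setC_ge P [set w | ((u - 4 * e)%:E < S_max X w)%E]) (leeD (lexx _) h).
move: cU; rewrite -/N; case: (mu_ext P _) => [x||]; rewrite ?leey //.
  rewrite -!EFinD !lee_fin; move: (dprob _ _) (cnt R _ / _) => a b; lra.
Qed.

End Comparison.

(** * The distribution functions and their sandwich *)

Section DistributionFunctions.
Context (R : realType).
Implicit Types (tau : R).

Lemma lt_bigmaxP (F : nat -> R) (s : seq nat) (a : R) :
  a < \big[Num.max/0]_(x <- s) F x <-> a < 0 \/ exists2 x, x \in s & a < F x.
Proof.
elim: s => [|y s IH].
  by rewrite big_nil; split=> [|[//|[x]]]; [left|rewrite in_nil].
rewrite big_cons lt_max; split.
  move=> /orP[h|/IH[h|[x xs h]]]; [right; exists y; rewrite ?mem_head //|by left|].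
  by right; exists x => //; rewrite inE xs orbT.
move=> [h|[x]]; first by apply/orP; right; apply/IH; left.
rewrite inE => /predU1P[->|xs] h; first by rewrite h.
by apply/orP; right; apply/IH; right; exists x.
Qed.

Lemma m_char_gtP (q : nat) (chi : int -> R[i]) tau : (0 < q)%N ->
  tau < m_char q chi <-> exists2 x, (0 < x <= q)%N &
    2 * expR (euler_gamma R) * tau <
    2 * pi / Num.sqrt q%:R * nc (\sum_(1 <= n < x.+1) chi n%:Z).
Proof.
move=> q0; set E := expR _; set r := Num.sqrt _.
have E0 : 0 < E by exact: expR_gt0.
have r0 : 0 < r by rewrite sqrtr_gt0 ltr0n.
have p0 : (0 : R) < pi by exact: pi_gt0.
have eqv a : (2 * E * tau < 2 * pi / r * a) = (tau * (E * r / pi) < a).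
  move: (pi : R) p0 => p p0; have c0 : 0 < 2 * p / r by rewrite divr_gt0 // mulr_gt0.
  rewrite -[RHS](ltr_pM2l c0); congr (_ < _); field.
  by rewrite !lt0r_neq0.
rewrite /m_char -/E -/r ltr_pdivlMr ?divr_gt0 ?mulr_gt0 //.
apply: (iff_trans (lt_bigmaxP _ _ _)); split.
  move=> [h|[x]]; last by rewrite mem_index_iota ltnS => xq h; exists x; rewrite ?eqv.
  (* A negative threshold lies below the default 0 of the maximum; any x would serve. *)
  by exists 1%N; rewrite ?q0 // eqv (lt_le_trans h) // nc_ge0.
by move=> [x xq]; rewrite eqv => h; right; exists x; rewrite // mem_index_iota ltnS.
Qed.

Lemma cnt_card (I : finType) (Q : I -> Prop) : cnt R Q = #|` fset_set [set k | Q k]|%:R.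
Proof.
have fin : finite_set [set k | Q k] by exact: finite_finset.
rewrite /cnt -natr_sum -(card_uniqP (fset_uniq (fset_set [set k | Q k]))); congr (_%:R).
rewrite -sum1_card [RHS]big_mkcond; apply: eq_bigr => k _.
rewrite -[_ \in _]/(k \in fset_set [set k | Q k]) in_fset_set //.
Qed.

Lemma Phi_q_cnt (q : nat) (q_pr : prime q) tau :
  Phi_q q tau = cnt R (large_sum q_pr (2 * expR (euler_gamma R) * tau)) / q.-1%:R.
Proof.
have q0 := prime_gt0 q_pr.
pose Q := [set k : 'I_q.-1 | large_sum q_pr (2 * expR (euler_gamma R) * tau) k].
rewrite /Phi_q totient_prime // cnt_card -/Q; congr (_%:R / _).
pose h (k : 'I_q.-1) := dchar R q_pr k.
have h_inj : injective h by move=> k l /dchar_inj kl; apply/val_inj/kl; exact: ltn_ord.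
rewrite (_ : [set chi : int -> R[i] | _] = h @` Q).
  by rewrite fset_set_image ?card_imfset //; exact: finite_finset.
apply/seteqP; split=> [chi [dchi npr mchi]|chi [k [k0 hk] <-]].
  have [k kq chiE] := dirichlet_dchar q_pr dchi.
  exists (Ordinal kq) => //; split; last by apply/(m_char_gtP _ _ q0); rewrite -chiE.
  rewrite lt0n; apply/eqP => /= k0; apply: npr; rewrite chiE.
  exact/(principal_dchar R q_pr kq).
split; first exact: dchar_dirichlet.
  by move=> /(principal_dchar R q_pr (ltn_ord k)) kE; rewrite kE in k0.
exact/(m_char_gtP _ _ q0).
Qed.

Lemma Phi_q_noninc (q : nat) : prime q -> {homo (Phi_q q : R -> R) : x y / x <= y >-> y <= x}.
Proof.
move=> q_pr x y xy; rewrite !(Phi_q_cnt q_pr) ler_wpM2r ?invr_ge0 //.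
apply: cnt_le => k [k0 [n nq h]]; split=> //; exists n => //.
apply: le_lt_trans h; rewrite ler_wpM2l //.
Qed.

Lemma Phi_q_itv (q : nat) tau : prime q -> 0 <= Phi_q q tau <= 1.
Proof.
move=> q_pr; rewrite (Phi_q_cnt q_pr) divr_ge0 ?cnt_ge0 //=.
have qR : 0 < q.-1%:R :> R by rewrite ltr0n -ltnS prednK ?prime_gt0 ?prime_gt1.
rewrite ler_pdivrMr // mul1r -[X in _ <= X%:R](card_ord q.-1).
by rewrite -subr_ge0 -cnt_not cnt_ge0.
Qed.

Section Limit.
Context (d : measure_display) (T : measurableType d)
  (P : probability T R) (X : int -> T -> R[i]) (HX : random_model P X).

Lemma out_fin_num (A : set T) : mu_ext P A \is a fin_num.
Proof.
rewrite ge0_fin_numE ?mu_ext_ge0 //.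
apply: (@le_lt_trans _ _ 1%E); last exact: ltry.
rewrite -(probability_setT P) -(out_measurable P measurableT).
exact: out_le.
Qed.

Lemma PhiE tau : (Phi P X tau)%:E =
  mu_ext P [set w | ((2 * expR (euler_gamma R) * tau)%:E < S_max X w)%E].
Proof. by rewrite fineK ?out_fin_num. Qed.

Lemma Phi_noninc : {homo Phi P X : x y / x <= y >-> y <= x}.
Proof.
move=> x y xy; rewrite -lee_fin !PhiE; apply: out_le => w /=.
apply: le_lt_trans; rewrite lee_fin ler_wpM2l //.
Qed.

Lemma Phi_q_sandwich (e : R) : 0 < e -> exists q0, forall q, prime q -> (q0 <= q)%N ->
  forall tau, Phi P X (tau + e) - e <= Phi_q q tau <= Phi P X (tau - e) + e.
Proof.
move=> e0; set E := expR (euler_gamma R); have E0 : 0 < E by exact: expR_gt0.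
(* The first bound is for the loss in probability, the second for the shift in tau, which thresholds
   see multiplied by 2 e^gamma. *)
have e'0 : 0 < Num.min (e / 5) (2 * E * e / 5).
  by rewrite lt_min !divr_gt0 // !mulr_gt0.
have [q0 hq0] := char_random_sandwich HX e'0.
exists q0 => q q_pr q0q tau; rewrite (Phi_q_cnt q_pr).
have [] := hq0 q q_pr q0q (2 * E * tau).
move: e'0; set e' := Num.min _ _ => e'0.
have e5 : 5 * e' <= e.
  have : e' <= e / 5 by rewrite ge_min lexx.
  by lra.
have Ee5 : 5 * e' <= 2 * E * e.
  have : e' <= 2 * E * e / 5 by rewrite ge_min lexx orbT.
  by move: (2 * E * e) => a; lra.
move=> h1 h2.
have l1 : ((Phi P X (tau + e))%:E <= (cnt R (large_sum q_pr (2 * E * tau)) / q.-1%:R + 4 * e')%:E)%E.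
  apply: le_trans h1; rewrite PhiE; apply: out_le => w /=.
  by apply: le_lt_trans; rewrite lee_fin mulrDr lerD2l.
have l2 : ((cnt R (large_sum q_pr (2 * E * tau)) / q.-1%:R)%:E <= (Phi P X (tau - e))%:E + (3 * e')%:E)%E.
  apply: le_trans h2 _; rewrite leeD2r // PhiE; apply: out_le => w /=.
  by apply: le_lt_trans; rewrite lee_fin mulrBr lerD2l lerN2 (le_trans _ Ee5) // ler_pM2r // ler_nat.
move: l1 l2; rewrite -EFinD !lee_fin; move: (cnt R _ / _) (Phi _ _ _) (Phi _ _ _) => a b c.
by move=> *; apply/andP; split; lra.
Qed.

End Limit.

End DistributionFunctions.

(** * Convergence *)

Section MonotoneJumps.
Context (R : realType).
Implicit Types (F : R -> R).

(** For nonincreasing F this is continuity at x, in the form that the sandwich consumes. *)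
Definition jumpless F x := forall e, 0 < e -> exists2 dl, 0 < dl & F (x - dl) - F (x + dl) <= e.

(** Compactness of [a, b] makes [dl] uniform. Since x - dl and x + dl may leave the interval,
    continuity is used in full neighbourhoods of its points. *)
Lemma continuous_uniform_jumpless F (a b e : R) : 0 < e ->
  {homo F : x y / x <= y >-> y <= x} ->
  (forall x, a <= x <= b -> {for x, continuous F}) ->
  exists2 dl, 0 < dl & forall x, a <= x <= b -> F (x - dl) - F (x + dl) <= e.
Proof.
move=> e0 Fni cF.
have cpt : compact `[a, b]%classic by exact: segment_compact.
have := (compact_near_coveringP _).1 cpt _ (0%R^'+)
  (fun dl x => 0 < dl -> F (x - dl) - F (x + dl) <= e) _.
case.
  move=> x /=; rewrite in_itv /= => xab.
  have /cvgrPdist_le /(_ (e / 2)) := cF x xab.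
  case; first by rewrite divr_gt0.
  move=> r /= r0 hr.
  exists (ball x (r / 2), [set dl | dl < r / 2]); first split.
  - by apply: nbhsx_ballx; rewrite divr_gt0.
  - by apply: nbhs_right_lt; rewrite divr_gt0.
  case=> y dl /= [xy dr] dl0.
  have near_x z : `|z - y| <= dl -> `|F x - F z| <= e / 2.
    move=> zy; apply: hr => /=; move: xy; rewrite /ball /= => xy.
    apply: le_lt_trans (ler_distD y _ _) _; rewrite (distrC y z).
    by move: xy zy; move: `|x - y| `|z - y| => u v; lra.
  have h1 : `|y - dl - y| <= dl by rewrite addrAC subrr sub0r normrN gtr0_norm.
  have h2 : `|y + dl - y| <= dl by rewrite addrAC subrr add0r gtr0_norm.
  have := near_x _ h1; have := near_x _ h2; rewrite !ler_norml.
  by move: (F _) (F _) (F _) => u v w /andP[? ?] /andP[? ?]; lra.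
move=> r /= r0 hr; exists (r / 2); first by rewrite divr_gt0.
move=> x xab; apply: hr; rewrite /= ?in_itv /= ?divr_gt0 //.
by rewrite sub0r normrN gtr0_norm ?divr_gt0 //; lra.
Qed.

(** Each jump contains a rational strictly inside, and by monotonicity distinct jumps get distinct
    rationals. *)
Lemma countable_jumps F : {homo F : x y / x <= y >-> y <= x} ->
  countable [set x | ~ jumpless F x].
Proof.
move=> Fni.
have ex x : exists r : rat, ~ jumpless F x ->
    forall dl, 0 < dl -> F (x + dl) < ratr r < F (x - dl).
  have [j|nj] := pselect (jumpless F x); first by exists 0 => /(_ j).
  have [e e0 he] : exists2 e, 0 < e & forall dl, 0 < dl -> e < F (x - dl) - F (x + dl).
    apply: contrapT => h; apply: nj => e e0; apply: contrapT => h'; apply: h.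
    exists e => // dl dl0; rewrite ltNge; apply/negP => ?; apply: h'; by exists dl.
  (* The supremum of [E] is the limit of F at x from the right; a rational is picked within [e]
     above it, hence below every value to the left of x. *)
  pose E := [set F (x + dl) | dl in [set dl | 0 < dl]].
  have Eub : has_ubound E.
    by exists (F x) => _ [dl /= dl0 <-]; apply: Fni; rewrite lerDl ltW.
  have E0 : E !=set0 by exists (F (x + 1)); exists 1; rewrite /= ?ltr01.
  have [r] : exists r : rat, ratr r \in `](sup E), (sup E + e)[.
    by apply: rat_in_itvoo; rewrite ltrDl.
  rewrite in_itv /= => /andP[r1 r2]; exists r => _ dl dl0; apply/andP; split.
    by apply: le_lt_trans r1; apply: ub_le_sup => //; exists dl.
  apply: lt_le_trans r2 _; rewrite -lerBrDr; apply: ge_sup => // _ [dl' /= dl'0 <-].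
  rewrite lerBrDr; have m0 : 0 < Num.min dl dl' by rewrite lt_min dl0.
  have h1 : F (x + dl') <= F (x + Num.min dl dl').
    by apply: Fni; rewrite lerD2l ge_min lexx orbT.
  have h2 : F (x - Num.min dl dl') <= F (x - dl).
    by apply: Fni; rewrite lerD2l lerN2 ge_min lexx.
  by have := he _ m0; lra.
have [f hf] := choice ex; apply/countable_injP; exists (fun x => choice.pickle (f x)).
move=> x y; rewrite !inE => /hf hx /hf hy /(pcan_inj choice.pickleK) fxy.
have lt_contra u v : f u = f v -> u < v -> (forall dl, 0 < dl -> F (u + dl) < ratr (f u) < F (u - dl)) ->
   (forall dl, 0 < dl -> F (v + dl) < ratr (f v) < F (v - dl)) -> False.
  move=> fuv uv hu hv; have h0 : 0 < (v - u) / 2 by rewrite divr_gt0 // subr_gt0.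
  have /andP[h1 _] := hu _ h0; have /andP[_] := hv _ h0.
  rewrite -fuv (_ : v - (v - u) / 2 = u + (v - u) / 2); last by field.
  by move=> /(lt_trans h1); rewrite ltxx.
have [xy|yx|//] := ltgtP x y; first by case: (lt_contra x y).
by case: (lt_contra y x).
Qed.

End MonotoneJumps.

Section Convergence.
Context (R : realType) (d : measure_display) (T : measurableType d)
  (P : probability T R) (X : int -> T -> R[i]) (HX : random_model P X).
Local Notation F := (Phi P X).

(** [q0] is chosen before tau, so a [dl] that serves on a whole interval gives uniform convergence
    there, and a [dl] at one point gives convergence at that point. *)
Lemma Phi_q_dist (e dl : R) : 0 < e -> 0 < dl -> exists q0, forall q, prime q -> (q0 <= q)%N ->
  forall tau, F (tau - dl) - F (tau + dl) <= e -> `|F tau - Phi_q q tau| <= 2 * e.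
Proof.
move=> e0 dl0; have m0 : 0 < Num.min e dl by rewrite lt_min e0.
have [q0 hq0] := Phi_q_sandwich HX m0.
exists q0 => q q_pr q0q tau h.
have /andP[h1 h2] := hq0 q q_pr q0q tau.
have me : Num.min e dl <= e by rewrite ge_min lexx.
have md : Num.min e dl <= dl by rewrite ge_min lexx orbT.
have h3 : F (tau - Num.min e dl) <= F (tau - dl) by apply: Phi_noninc; rewrite lerD2l lerN2.
have h4 : F (tau + dl) <= F (tau + Num.min e dl) by apply: Phi_noninc; rewrite lerD2l.
have h5 : F (tau + dl) <= F tau by apply: Phi_noninc; rewrite lerDl ltW.
have h6 : F tau <= F (tau - dl) by apply: Phi_noninc; rewrite gerBl ltW.
move: (Num.min e dl) (F _) (F _) (F _) (F _) (F _) h h1 h2 me h3 h4 h5 h6 => m a b c g k *.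
by rewrite ler_norml; apply/andP; split; lra.
Qed.

Lemma Phi_q_uniform (a b : R) :
  (forall tau, a <= tau <= b -> {for tau, continuous F}) ->
  {uniform [set tau : R | a <= tau <= b],
      (fun q : nat => Phi_q q : R -> R) @ within [set q : nat | prime q] \oo --> F}.
Proof.
move=> cF A; rewrite uniform_nbhs => -[E [entE EA]].
move: entE; rewrite -entourage_from_ballE => -[e /= e0 eE].
have e4 : 0 < e / 4 by rewrite divr_gt0.
have [dl dl0 hdl] := continuous_uniform_jumpless e4 (@Phi_noninc _ _ _ P X) cF.
have [q0 hq0] := Phi_q_dist e4 dl0.
exists q0 => // q /= q0q q_pr; apply: EA => tau tab; apply: eE => /=.
apply: le_lt_trans (hq0 q q_pr q0q tau (hdl tau tab)) _; lra.
Qed.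

(** Dominated convergence with bound |f|, integrable because f is continuous and vanishes outside a
    bounded interval; pointwise convergence can fail only at the countably many jumps of [Phi]. *)
Lemma Phi_q_weak (f : R -> R) : continuous f -> bounded_set [set tau | f tau != 0] ->
  (\int[lebesgue_measure]_tau (f tau * Phi_q q tau))
      @[q --> within [set q : nat | prime q] \oo]
    --> \int[lebesgue_measure]_tau (f tau * F tau).
Proof.
move=> cf [M [_ hM]].
have fM tau : f tau != 0 -> `|tau| <= M + 1 by apply: hM; rewrite ltrDl.
pose mu : measure (measurableTypeR R) R := @lebesgue_measure R.
have mf : measurable_fun [set: R] f by exact: continuous_measurable_fun.
(* Dominated convergence runs over all natural numbers: at those that are not prime the limit itself
   is inserted, and the filter is restricted to primes at the end. *)
pose h (q : nat) : R -> R := if prime q then Phi_q q else F.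
have h_itv q tau : 0 <= h q tau <= 1.
  rewrite /h; case: ifP => q_pr; first exact: Phi_q_itv.
  rewrite -!lee_fin PhiE mu_ext_ge0 //= -(probability_setT P) -(out_measurable P measurableT).
  exact: out_le.
have h_ni q : {homo h q : x y / x <= y >-> y <= x}.
  by rewrite /h; case: ifP => q_pr; [exact: Phi_q_noninc|exact: Phi_noninc].
have mh q : measurable_fun [set: R] (h q) by exact: nonincreasing_measurable.
have ig : mu.-integrable setT (fun x : R => `|f x|%:E).
  pose A : set R := `[- (M + 1), M + 1]%classic.
  have mA : measurable (A : set (measurableTypeR R)) by exact: measurable_itv.
  have : mu.-integrable A (EFin \o (fun x : R => `|f x|)).
    apply: continuous_compact_integrable; first exact: segment_compact.
    apply: continuous_subspaceT => x; apply: continuous_comp; first exact: cf.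
    exact: norm_continuous.
  move=> iA; have := (integrable_mkcond _ mA).1 iA.
  rewrite (_ : _ \_ A = (fun x : R => `|f x|%:E)) //; apply/funext => x; rewrite /patch; case: ifPn => // xA /=.
  have [->|/fM] := eqVneq (f x) 0; first by rewrite normr0.
  by rewrite ler_norml => xM; move: xA; rewrite notin_setE /A /= in_itv /= xM.
have cj : countable [set x | ~ jumpless F x] by apply: countable_jumps; exact: Phi_noninc.
have [] := @dominated_convergence _ _ R mu setT measurableT
  (fun q x => (f x * h q x)%:E) (fun x => (f x * F x)%:E) (fun x => `|f x|%:E).
- by move=> q; apply/measurable_EFinP; apply: measurable_funM => //; exact: mh.
- apply/measurable_EFinP; apply: measurable_funM => //.
  by apply: nonincreasing_measurable => //; exact: Phi_noninc.
- exists [set x | ~ jumpless F x]; split.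
  + by apply: countable_measurable => //; exact: measurable_set1.
  + exact: countable_lebesgue_measure0.
  move=> x /= nx jx; apply: nx => _.
  apply/fine_cvgP; split; first by apply: nearW.
  apply: cvgM; first exact: cvg_cst.
  apply/cvgrPdist_le => e e0; have e2 : 0 < e / 2 by rewrite divr_gt0.
  have [dl dl0 hdl] := jx _ e2; have [q0 hq0] := Phi_q_dist e2 dl0.
  exists q0 => // q /= q0q; rewrite /h; case: ifP => q_pr.
    apply: le_trans (hq0 q q_pr q0q x hdl) _; lra.
  by rewrite subrr normr0 ltW.
- exact: ig.
- apply: aeW => x q _; rewrite /= lee_fin normrM ler_piMr //.
  by have /andP[h0 h1] := h_itv q x; rewrite ger0_norm.
move=> iF _ cv.
have : fine (\int[mu]_x (f x * h q x)%:E)%E @[q --> \oo] --> fine (\int[mu]_x (f x * F x)%:E)%E.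
  by apply: fine_cvg; rewrite fineK ?integrable_fin_num.
move=> /cvgrPdist_le cv'; apply/cvgrPdist_le => e e0.
have [q0 _ hq0] := cv' e e0; exists q0 => // q /= q0q q_pr.
by have := hq0 q q0q; rewrite /= /h q_pr.
Qed.

End Convergence.

Theorem theorem1p4 (R : realType) (d : measure_display) (T : measurableType d)
    (P : probability T R) (X : int -> T -> R[i]) (HX : random_model P X) :
  (forall a b : R, 0 < a -> a <= b ->
    (forall tau : R, a <= tau <= b -> {for tau, continuous (Phi P X)}) ->
    {uniform [set tau : R | a <= tau <= b],
      (fun q : nat => Phi_q q : R -> R) @ within [set q : nat | prime q] \oo
      --> Phi P X})
  /\
  (forall f : R -> R, continuous f -> bounded_set [set tau | f tau != 0] ->
    (\int[lebesgue_measure]_tau (f tau * Phi_q q tau))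
      @[q --> within [set q : nat | prime q] \oo]
    --> \int[lebesgue_measure]_tau (f tau * Phi P X tau)).
Proof.
split=> [a b _ _|f]; first exact: Phi_q_uniform.
exact: Phi_q_weak.
Qed.
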